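(* Let $(M,g,\nabla)$ be a statistical manifold of dimension $m\ge 2$ and of constant curvature $\lambda\in\mathbb{R}$ satisfying the semi-equiaffine condition. Assume that $(M,g)$ is a complete simply-connected Riemannian manifold of constant sectional curvature $c$. Then the statistical structure $(g,\nabla)$ is determined as follows: (1) If $(M,g)=(S^m(c),g_0)$ (the Euclidean sphere of radius $c^{-1/2}$, $c>0$), then $\nabla=\nabla^g$ and $\lambda=c$. (2) If $(M,g)=(\mathbb{R}^m,g_0)$ (Euclidean space, $c=0$), then $\lambda\cdot m(m-1)=g(T,T)-g(K,K)$, and, writing $$K=\sum_{i,j,k=1}^mK^k_{~ij}\frac{\partial}{\partial x^k}\otimes dx^i\otimes dx^j,$$ where $\{x^1,\dots,x^m\}$ is a coordinate system on $\mathbb{R}^m$ such that $\nabla^{g_0}dx^i=0$ for all $i$, each component $K^k_{~ij}$, $i,j,k\in\{1,\dots,m\}$, is constant. (3) If $(M,g)=(\mathbb{H}^m(c),g_0)$ (hyperbolic space of constant sectional curvature $c<0$), then $\nabla=\nabla^g$ and $\lambda=c$.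
   Context: All objects are smooth; manifolds are orientable of dimension $m\ge2$. A statistical manifold $(M,g,\nabla)$ is a manifold with a Riemannian metric $g$ and a torsion-free affine connection $\nabla$ satisfying $(\nabla_Xg)(Y,Z)=(\nabla_Yg)(X,Z)$ for all vector fields $X,Y,Z$. $\nabla^g$ denotes the Levi-Civita connection of $g$. Set $K(X,Y)=\nabla_XY-\nabla^g_XY$, and let $T=\mathrm{tr}_gK=\sum_iK(e_i,e_i)$ ($\{e_i\}$ an orthonormal frame for $g$) be the Tchebychev vector field. $g(K,K)$ denotes the squared norm of the tensor $K$ with respect to $g$. With $R^\nabla(X,Y)Z=\nabla_X\nabla_YZ-\nabla_Y\nabla_XZ-\nabla_{[X,Y]}Z$, the statistical manifold $(M,g,\nabla)$ is of constant curvature $\lambda\in\mathbb{R}$ if $R^\nabla(X,Y)Z=\lambda(g(Y,Z)X-g(X,Z)Y)$ for all vector fields $X,Y,Z$. $(M,g,\nabla)$ satisfies the semi-equiaffine condition if $$\Delta_gT+\sum_{i=1}^m\mathrm{Ric}^g(e_i,T)e_i=0\quad\text{and}\quad \mathrm{div}^g(T)\,T+\nabla^g_TT=0$$ on $M$, where $\Delta_gV=\sum_i(\nabla^g_{e_i}\nabla^g_{e_i}V-\nabla^g_{\nabla^g_{e_i}e_i}V)$ is the rough Laplacian on vector fields, $\mathrm{Ric}^g(X,Y)=\sum_ig(R^{\nabla^g}(e_i,X)Y,e_i)$ is the Ricci tensor of $g$, and $\mathrm{div}^g$ is the divergence with respect to $g$. In each case $g_0$ denotes the standard metric. *)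

(* Defs.v *)
From HB Require Import structures.
From mathcomp Require Import all_boot all_order all_algebra.
From mathcomp Require Import all_classical all_reals all_analysis.

Set Implicit Arguments.
Unset Strict Implicit.
Unset Printing Implicit Defensive.

Import Order.TTheory GRing.Theory Num.Theory.
Import numFieldNormedType.Exports.

Local Open Scope classical_set_scope.
Local Open Scope ring_scope.

Section Smooth.
Context {R : realType} {m : nat}.
Implicit Types (U : set 'rV[R]_m) (f : 'rV[R]_m -> R).

Definition partial (i : 'I_m) f : 'rV[R]_m -> R :=
  fun x => 'D_(delta_mx 0 i) f x.

Fixpoint Ck (n : nat) U f : Prop :=
  match n with
  | 0 => forall x, U x -> {for x, continuous f}
  | n'.+1 => forall i : 'I_m,
      (forall x, U x -> derivable f x (delta_mx 0 i)) /\ Ck n' U (partial i f)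
  end.

Definition smooth_on U f : Prop := forall n, Ck n U f.

End Smooth.

(* [cinv] is only meaningful on the image of [cdom], [cfun] only on [cdom]. *)
Record chart (R : realType) (m : nat) (M : topologicalType) := Chart {
  cdom : set M;
  cfun : M -> 'rV[R]_m;
  cinv : 'rV[R]_m -> M }.

Section Manifold.
Context {R : realType} {m : nat} {M : topologicalType}.
Implicit Types (k : chart R m M) (A : set (chart R m M)) (p : M).

Definition coord k (i : 'I_m) : M -> R := fun p => cfun k p 0 i.

Definition is_chart k : Prop :=
  [/\ open (cdom k), open (cfun k @` cdom k),
      (forall p, cdom k p -> cinv k (cfun k p) = p),
      (forall p, cdom k p -> {for p, continuous (cfun k)}) &
      (forall x, (cfun k @` cdom k) x -> {for x, continuous (cinv k)})].

Definition smooth_transition k k' : Prop :=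
  forall i, smooth_on (cfun k @` (cdom k `&` cdom k')) (coord k' i \o cinv k).

Definition compatible k k' : Prop :=
  smooth_transition k k' /\ smooth_transition k' k.

Definition covers A : Prop := forall p, exists2 k, A k & cdom k p.

Definition smooth_manifold A : Prop :=
  [/\ hausdorff_space M, @second_countable M,
      (forall k, A k -> is_chart k), covers A &
      (forall k k', A k -> A k' -> compatible k k')].

Definition jacobian k k' p : 'M[R]_m :=
  \matrix_(i, j) partial j (coord k' i \o cinv k) (cfun k p).

Definition orientable A : Prop :=
  exists O : set (chart R m M),
    [/\ (forall k, O k -> is_chart k), covers O,
        (forall k k', O k -> A k' -> compatible k k') &
        (forall k k' p, O k -> O k' -> cdom k p -> cdom k' p ->
           0 < \det (jacobian k k' p))].

Definition smooth_at A p (f : M -> R) : Prop :=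
  exists k, [/\ A k, cdom k p &
    exists U, [/\ open U, U (cfun k p) & smooth_on U (f \o cinv k)]].

Definition smooth_fun A (f : M -> R) : Prop := forall p, smooth_at A p f.

(* A tangent vector at p is encoded by its action on the functions that are
   smooth near p; it is set to 0 on all other functions, so that equality of
   tangent vectors is equality of functionals.  [tvec A k p a] is the vector
   \sum_i a_i (d/dx^i)|_p of the chart k. *)
Definition tvec A k p (a : 'rV[R]_m) : (M -> R) -> R :=
  fun f => if `[< smooth_at A p f >]
           then \sum_(i < m) a 0 i * partial i (f \o cinv k) (cfun k p)
           else 0.

Definition tangent A p (v : (M -> R) -> R) : Prop :=
  exists k a, [/\ A k, cdom k p & v = tvec A k p a].

Definition field := M -> (M -> R) -> R.

Implicit Types (X Y Z : field).

Definition vector_field A X : Prop :=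
  (forall p, tangent A p (X p)) /\
  (forall k i, A k -> forall p, cdom k p ->
     smooth_at A p (fun q => X q (coord k i))).

Definition fderiv X (f : M -> R) : M -> R := fun p => X p f.

Definition fscale (h : M -> R) X : field := fun p f => h p * X p f.

Definition lie A X Y : field := fun p f =>
  if `[< smooth_at A p f >] then X p (fderiv Y f) - Y p (fderiv X f) else 0.

Definition coord_field A k (i : 'I_m) : field :=
  fun p => tvec A k p (delta_mx 0 i).

(* A metric: g p v w is the inner product of tangent vectors v, w at p. *)
Definition metric := M -> ((M -> R) -> R) -> ((M -> R) -> R) -> R.

Implicit Type g : metric.

Definition gfield g X Y : M -> R := fun p => g p (X p) (Y p).

Definition riemannian_metric A g : Prop :=
  [/\ (forall p u v w (a : R), tangent A p u -> tangent A p v -> tangent A p w ->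
         g p (a *: u + v) w = a * g p u w + g p v w),
      (forall p v w, tangent A p v -> tangent A p w -> g p v w = g p w v),
      (forall p v, tangent A p v -> v != 0 -> 0 < g p v v) &
      (forall k i j, A k -> forall p, cdom k p ->
         smooth_at A p (gfield g (coord_field A k i) (coord_field A k j)))].

(* A connection: D X Y is \nabla_X Y. Only its values on vector fields matter. *)
Definition connection := field -> field -> field.

Implicit Types D Dg : connection.

Definition affine_connection A D : Prop :=
  [/\ (forall X Y, vector_field A X -> vector_field A Y ->
         vector_field A (D X Y)),
      (forall X X' Y, vector_field A X -> vector_field A X' ->
         vector_field A Y -> D (X + X') Y = D X Y + D X' Y),
      (forall h X Y, smooth_fun A h -> vector_field A X -> vector_field A Y ->
         D (fscale h X) Y = fscale h (D X Y)),
      (forall X Y Y', vector_field A X -> vector_field A Y ->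
         vector_field A Y' -> D X (Y + Y') = D X Y + D X Y') &
      (forall h X Y, smooth_fun A h -> vector_field A X -> vector_field A Y ->
         D X (fscale h Y) = fscale (fderiv X h) Y + fscale h (D X Y))].

Definition torsion_free A D : Prop :=
  forall X Y, vector_field A X -> vector_field A Y -> D X Y - D Y X = lie A X Y.

(* (\nabla_X g)(Y, Z) *)
Definition cov_metric D g X Y Z : M -> R := fun p =>
  X p (gfield g Y Z) - gfield g (D X Y) Z p - gfield g Y (D X Z) p.

Definition levi_civita A g Dg : Prop :=
  [/\ affine_connection A Dg, torsion_free A Dg &
      forall X Y Z p, vector_field A X -> vector_field A Y ->
        vector_field A Z -> cov_metric Dg g X Y Z p = 0].

Definition statistical_manifold A g D : Prop :=
  [/\ riemannian_metric A g, affine_connection A D, torsion_free A D &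
      forall X Y Z p, vector_field A X -> vector_field A Y ->
        vector_field A Z -> cov_metric D g X Y Z p = cov_metric D g Y X Z p].

Definition curvature A D X Y Z : field :=
  D X (D Y Z) - D Y (D X Z) - D (lie A X Y) Z.

Definition constant_curvature A g D (lambda : R) : Prop :=
  forall X Y Z, vector_field A X -> vector_field A Y -> vector_field A Z ->
    curvature A D X Y Z =
    lambda *: (fscale (gfield g Y Z) X - fscale (gfield g X Z) Y).

Definition constant_sectional_curvature A g Dg (c : R) : Prop :=
  forall X Y p, vector_field A X -> vector_field A Y ->
    let area := gfield g X X p * gfield g Y Y p - gfield g X Y p ^+ 2 in
    area != 0 -> gfield g (curvature A Dg X Y Y) X p / area = c.

(* Vector fields e_1, ..., e_m that are orthonormal at the point p.  The
   traces below are taken at p over such a frame; all of them are traces of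
   tensors, hence depend neither on the choice of the frame nor on its values
   outside p. *)
Definition frame A g p : 'I_m -> field :=
  xget (fun=> 0) [set e : 'I_m -> field |
    (forall i, vector_field A (e i)) /\
    (forall i j, g p (e i p) (e j p) = (i == j)%:R)].

Definition difference D Dg X Y : field := D X Y - Dg X Y.

Definition tchebychev A g D Dg : field := fun p =>
  let e := frame A g p in \sum_(i < m) difference D Dg (e i) (e i) p.

Definition difference_sqnorm A g D Dg : M -> R := fun p =>
  let e := frame A g p in
  let K := difference D Dg in
  \sum_(i < m) \sum_(j < m) gfield g (K (e i) (e j)) (K (e i) (e j)) p.

Definition ricci A g Dg X Y : M -> R := fun p =>
  let e := frame A g p in
  \sum_(i < m) gfield g (curvature A Dg (e i) X Y) (e i) p.

Definition divergence A g Dg X : M -> R := fun p =>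
  let e := frame A g p in \sum_(i < m) gfield g (Dg (e i) X) (e i) p.

Definition rough_laplacian A g Dg X : field := fun p =>
  let e := frame A g p in
  \sum_(i < m) (Dg (e i) (Dg (e i) X) - Dg (Dg (e i) (e i)) X) p.

Definition ricci_field A g Dg X : field := fun p =>
  let e := frame A g p in \sum_(i < m) ricci A g Dg (e i) X p *: e i p.

Definition semi_equiaffine A g D Dg : Prop :=
  let T := tchebychev A g D Dg in
  rough_laplacian A g Dg T + ricci_field A g Dg T = 0 /\
  fscale (divergence A g Dg T) T + Dg T T = 0.

Definition smooth_curve A (gam : R -> M) : Prop :=
  continuous gam /\
  forall k i n t, A k -> cdom k (gam t) ->
    derivable (derive1n n (coord k i \o gam)) t 1.

Definition velocity A (gam : R -> M) (t : R) : (M -> R) -> R := fun f =>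
  if `[< smooth_at A (gam t) f >] then derive1 (f \o gam) t else 0.

Definition curve_length A g (gam : R -> M) : \bar R :=
  (\int[lebesgue_measure]_(t in `[0%R, 1%R])
     (Num.sqrt (g (gam t) (velocity A gam t) (velocity A gam t)))%:E)%E.

Definition riemannian_dist A g (p q : M) : \bar R :=
  ereal_inf [set l | exists gam : R -> M,
    [/\ smooth_curve A gam, gam 0 = p, gam 1 = q & l = curve_length A g gam]].

Definition complete_metric A g : Prop :=
  forall u : nat -> M,
    (forall eps : R, 0 < eps -> exists N : nat, forall n n' : nat,
       (N <= n)%N -> (N <= n')%N -> (riemannian_dist A g (u n) (u n') < eps%:E)%E) ->
    exists p, forall eps : R, 0 < eps -> exists N : nat, forall n : nat,
       (N <= n)%N -> (riemannian_dist A g (u n) p < eps%:E)%E.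

(* (M, g) is isometric to the subset S of R^N with the metric induced by the
   bilinear form B: phi is a smooth topological embedding with image S, and an
   immersion because the metric B pulls back to is nondegenerate. *)
Definition isometric_to A g (N : nat)
    (B : 'rV[R]_N -> 'rV[R]_N -> R) (S : set 'rV[R]_N) : Prop :=
  exists phi : M -> 'rV[R]_N,
    [/\ (forall a, smooth_fun A (fun p => phi p 0 a)), range phi = S,
        (exists psi : 'rV[R]_N -> M,
           cancel phi psi /\ {within S, continuous psi}) &
        (forall p v w, tangent A p v -> tangent A p w ->
           g p v w = B (\row_a v (fun q => phi q 0 a))
                       (\row_a w (fun q => phi q 0 a)))].

(* (\nabla_X omega)(Y) for a one-form omega *)
Definition cov_oneform D (omega : field -> M -> R) X Y : M -> R := fun p =>
  X p (omega Y) - omega (D X Y) p.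

Definition dcoord k (i : 'I_m) : field -> M -> R := fun Y => fderiv Y (coord k i).

Definition global_coordinates A k : Prop :=
  [/\ is_chart k, cdom k = setT & forall k', A k' -> compatible k k'].

Definition parallel_coordinates A Dg k : Prop :=
  forall i X Y p, vector_field A X -> vector_field A Y ->
    cov_oneform Dg (dcoord k i) X Y p = 0.

(* K^l_{ij} = dx^l (K (d/dx^i, d/dx^j)) *)
Definition difference_component A D Dg k (l i j : 'I_m) : M -> R :=
  dcoord k l (difference D Dg (coord_field A k i) (coord_field A k j)).

End Manifold.

Definition simply_connected (R : realType) (M : topologicalType) : Prop :=
  (forall p q : M, exists gam : R -> M,
     [/\ {within `[0, 1], continuous gam}, gam 0 = p & gam 1 = q]) /\
  (forall gam : R -> M, {within `[0, 1], continuous gam} -> gam 0 = gam 1 ->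
     exists H : R * R -> M,
       [/\ {within `[0, 1] `*` `[0, 1], continuous H},
           (forall t, 0 <= t <= 1 -> H (0, t) = gam t),
           (forall t, 0 <= t <= 1 -> H (1, t) = gam 0) &
           (forall s, 0 <= s <= 1 -> H (s, 0) = gam 0 /\ H (s, 1) = gam 0)]).

Section Models.
Context {R : realType}.

Definition euclidean_form (N : nat) (x y : 'rV[R]_N) : R :=
  \sum_(a < N) x 0 a * y 0 a.

Definition lorentz_form (n : nat) (x y : 'rV[R]_n.+1) : R :=
  - (x 0 ord0 * y 0 ord0) + \sum_(a < n) x 0 (lift ord0 a) * y 0 (lift ord0 a).

Definition sphere (n : nat) (c : R) : set 'rV[R]_n.+1 :=
  [set x | Num.sqrt (euclidean_form x x) = (Num.sqrt c)^-1].

(* the hyperboloid model *)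
Definition hyperbolic_space (n : nat) (c : R) : set 'rV[R]_n.+1 :=
  [set x | lorentz_form x x = c^-1 /\ 0 < x 0 ord0].

End Models.

Arguments euclidean_form {R} N x y.
Arguments lorentz_form {R} n x y.
Arguments sphere {R} n c.
Arguments hyperbolic_space {R} n c.

(* Main.v *)
From HB Require Import structures.
From mathcomp Require Import all_boot all_order all_algebra.
From mathcomp Require Import all_classical all_reals all_analysis.
From mathcomp Require Import ring lra.
Require Import Defs.
Set Implicit Arguments.
Unset Strict Implicit.
Unset Printing Implicit Defensive.
Import Order.TTheory GRing.Theory Num.Theory.
Import numFieldNormedType.Exports.
Local Open Scope classical_set_scope.
Local Open Scope ring_scope.

(** Write [K = D - Dg], [C(X, Y, Z) = g(K(X, Y), Z)] and [T = tr K].  Torsion-freeness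
    and the Codazzi equation of the statistical structure say that [C] is totally
    symmetric.  Comparing the curvatures of [D] and [Dg] and separating the parts that
    are symmetric and skew in the last two arguments, constant curvature of [D] means
    that [Dg C] is totally symmetric ([codazzi_equation]) and that the curvature of [g]
    is [lambda X /\ Y - [K_X, K_Y]] ([gauss_equation]).  As [g] has constant curvature
    [c], the latter reads [[K_X, K_Y] = (lambda - c) X /\ Y] ([gauss_constant]), and its
    full trace is [(lambda - c) m (m - 1) = |T|^2 - |K|^2] ([sqnorm_identity]).

    Consider first [T].  Its dual 1-form is closed, so with [f = div T] the first
    semi-equiaffine condition becomes [grad f = - 2 c (m - 1) T].  The divergence of the
    second condition [f T + Dg_T T = 0] is then the pointwise identity
    [f^2 + |Dg T|^2 = 3 c (m - 1) |T|^2] ([divergence_identity]).  If [c < 0] it forces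
    [T = 0]; if [c = 0] it forces [Dg T = 0].  If [c > 0], the manifold is a compact
    sphere; at a maximum of [f^2] the gradient [- 4 c (m - 1) f T] vanishes, so [f = 0]
    there by the identity, hence [f = 0] and [T = 0] everywhere.

    Suppose [c != 0], so that [T = 0].  The trace of the Gauss equation gives
    [lambda <= c], with equality only if [K = 0].  If [lambda < c], the cubic form at
    each point is, by the Gauss equation, rigid: maximising it over the unit sphere splits
    off an eigenvector on whose orthogonal complement the situation repeats itself, and
    differentiating the Gauss equation then shows [Dg C = 0] ([cubic_rigidity],
    [cubic_deriv_zero]).  But a parallel [K] is annihilated by the curvature operators
    [c X /\ Y], and contracting gives [c (m + 1) C = 0] ([parallel_zero]), so [K = 0]
    after all, a contradiction.

    Suppose [c = 0].  Then [|K|^2 = |T|^2 - lambda m (m - 1)] is constant, and in the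
    parallel frame of the gradients of the Euclidean coordinates the Laplacian of [C] is
    the Hessian of [T], which vanishes.  Half the Laplacian of [|K|^2] is therefore
    [|Dg C|^2], whence [Dg C = 0] ([flat_parallel]): in parallel coordinates the
    components of [K] are locally constant, and the manifold is connected.

    All tensor calculus is done with globally defined vector fields.  The components
    [phi_a] of the isometric embedding satisfy [g(v, w) = sum eps_a v(phi_a) w(phi_a)],
    with signs [eps_a] that are all 1 except for the timelike coordinate of the
    hyperboloid; hence the gradients [E_a] of the [phi_a] satisfy
    [X = sum eps_a g(X, E_a) E_a] ([field_expand]).  They serve as a global frame for
    expansions and traces, orthonormal frames at a point being needed only for the
    positivity of norms. *)

(** * Functions with continuous partial derivatives *)

(** The approximation property at [x] determines the differential, so it may be checked
    against any continuous linear map. *)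
Lemma differentiable_approx (R : realType) (V W : normedModType R) (f : V -> W)
    (L : {linear V -> W}) (x : V) : continuous L ->
  (forall e : R, 0 < e ->
     \forall v \near (0 : V), `|f (v + x) - (f x + L v)| <= e * `|v|) ->
  differentiable f x.
Proof.
move=> Lc fL; have key : f \o shift x = cst (f x) + L +o_ 0 id.
  by apply/eqaddoP => e e0; exact: fL.
by apply/diff_locallyP; have dL := diff_unique Lc key; split; rewrite dL.
Qed.

Section Calculus.
Context {R : realType} {m : nat}.
Implicit Types (U V : set 'rV[R]_m) (f : 'rV[R]_m -> R) (x v : 'rV[R]_m).

Local Notation δ i := (delta_mx 0 i : 'rV[R]_m).

Lemma is_derive_line f x v s : derivable f (x + s *: v) v ->
  is_derive s 1 (fun s => f (x + s *: v)) ('D_v f (x + s *: v)).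
Proof.
move=> df; have E : (fun h : R => h^-1 *: (((fun s => f (x + s *: v) : R^o) \o shift s)
      (h *: (1 : R^o)) - (f (x + s *: v) : R^o))) =
    (fun h => h^-1 *: (((f : _ -> R^o) \o shift (x + s *: v)) (h *: v)
      - (f (x + s *: v) : R^o))).
  apply/funext => h /=; congr (_ *: (_ - _)); congr (f _).
  by rewrite scalerDl addrCA -[h *: 1]/(h * 1) mulr1.
apply: DeriveDef; first by rewrite /derivable E.
by rewrite /derive E.
Qed.

(** The interval is symmetric around 0 so that both signs of [t] are covered. *)
Lemma line_mvt f x v (t : R) :
  (forall s : R, `|s| <= `|t| -> derivable f (x + s *: v) v) ->
  exists2 c, `|c| <= `|t| & f (x + t *: v) - f x = t * 'D_v f (x + c *: v).
Proof.
move=> df; pose h s := f (x + s *: v).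
have dh (s : R) : `|s| <= `|t| -> is_derive s 1 h ('D_v f (x + s *: v)).
  by move=> st; apply/is_derive_line/df.
have hc (a b : R) : (forall s : R, a <= s <= b -> `|s| <= `|t|) ->
    {within `[a, b], continuous h}.
  move=> ab; apply: derivable_within_continuous => s; rewrite in_itv /= => /ab.
  by move=> /dh [].
have H (a b : R) : a <= b -> (forall s : R, a <= s <= b -> `|s| <= `|t|) ->
    exists2 c, `|c| <= `|t| & h b - h a = 'D_v f (x + c *: v) * (b - a).
  move=> ab abt; have [|c] := @MVT_segment _ h (fun s => 'D_v f (x + s *: v))
      _ _ ab _ (hc _ _ abt).
    move=> s; rewrite in_itv /= => /andP[/ltW sa /ltW sb]; apply/dh/abt.
    by rewrite sa.
  by rewrite in_itv /= => /abt ct E; exists c.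
have h0 : h 0 = f x by rewrite /h scale0r addr0.
case: (leP 0 t) => t0.
  have [|c ct E] := H 0 t t0.
    by move=> s /andP[s0 st]; rewrite !ger0_norm.
  by exists c => //; rewrite -h0 [LHS]E subr0 mulrC.
have [|c ct E] := H t 0 (ltW t0).
  by move=> s /andP[st s0]; rewrite !ler0_norm // ?lerN2 // ltW.
exists c => //; apply/eqP; rewrite -eqr_opp opprB -h0 [X in X == _]E sub0r.
by rewrite mulrN mulrC.
Qed.

Lemma norm_coord v i : `|v 0 i| <= `|v|.
Proof.
rewrite [leRHS]/Num.norm /= mx_normrE.
by apply/bigmax_geP; right => /=; exists (0, i).
Qed.

Lemma norm_row_lt v (r : R) : 0 < r -> (forall i, `|v 0 i| < r) -> `|v| < r.
Proof.
move=> r0 vr; rewrite [ltLHS]/Num.norm /= mx_normrE.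
by apply/bigmax_ltP; split => // -[i j] _ /=; rewrite ord1.
Qed.

Lemma norm_row_le v (r : R) : 0 <= r -> (forall i, `|v 0 i| <= r) -> `|v| <= r.
Proof.
move=> r0 vr; rewrite [leLHS]/Num.norm /= mx_normrE.
by apply/bigmax_leP; split => // -[i j] _ /=; rewrite ord1.
Qed.

(** Walking from [x] to [x + v] one coordinate at a time, the mean value theorem
    turns each step into a partial derivative at a nearby point. *)
Lemma coordinate_walk f x v :
  (forall y i, `|y - x| <= `|v| -> derivable f y (δ i)) ->
  exists c : 'I_m -> 'rV[R]_m, (forall i, `|c i - x| <= `|v|) /\
    f (x + v) - f x = \sum_i v 0 i * partial i f (c i).
Proof.
move=> df; pose w (k : nat) : 'rV[R]_m := \row_j (if (j < k)%N then v 0 j else 0).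
have w0 : w 0%N = 0 by apply/rowP => j; rewrite !mxE.
have wm : w m = v by apply/rowP => j; rewrite !mxE ltn_ord.
have wS (i : 'I_m) : w i.+1 = w i + v 0 i *: δ i.
  apply/rowP => j; rewrite !mxE eqxx /= ltnS leq_eqVlt.
  have [->|ji] := eqVneq j i; first by rewrite eqxx ltnn mulr1 add0r.
  by rewrite (inj_eq val_inj) (negbTE ji) mulr0 addr0.
have wle (i : 'I_m) (s : R) : `|s| <= `|v 0 i| -> `|w i + s *: δ i| <= `|v|.
  move=> si; apply: norm_row_le => // j; rewrite !mxE eqxx /=.
  have [->|ji] := eqVneq j i.
    by rewrite ltnn add0r mulr1; apply: le_trans si (norm_coord _ _).
  by rewrite mulr0 addr0; case: ifP => _; rewrite ?normr0 ?norm_coord.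
have step (i : 'I_m) : exists c : 'rV[R]_m, `|c - x| <= `|v| /\
    f (x + w i.+1) - f (x + w i) = v 0 i * partial i f c.
  have [|c cv E] := @line_mvt f (x + w i) (δ i) (v 0 i).
    by move=> s si; apply: df; rewrite -[x + _ + _]addrA [_ - x]addrC addKr wle.
  exists (x + w i + c *: δ i); rewrite -[x + _ + _]addrA [_ - x]addrC addKr.
  by rewrite wle // wS !addrA; split.
have [c Hc] := choice step; exists c; split=> [i|]; first by case: (Hc i).
have := telescope_sumr (fun k => f (x + w k)) (leq0n m).
rewrite /= wm w0 addr0 => <-.
by rewrite big_mkord; apply: eq_bigr => i _; case: (Hc i) => _ ->.
Qed.

(** The intermediate points of [coordinate_walk] tend to [x], where the partial
    derivatives are continuous. *)
Lemma C1_differentiable U f x : open U -> U x ->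
  (forall i y, U y -> derivable f y (δ i)) ->
  (forall i, {for x, continuous (partial i f)}) -> differentiable f x.
Proof.
move=> oU Ux df cf.
pose L0 v := \sum_i v 0 i * partial i f x.
have L0lin : linear (L0 : 'rV[R]_m -> R^o).
  move=> a u v; rewrite /L0 scaler_sumr -big_split /=; apply: eq_bigr => i _.
  by rewrite !mxE mulrDl -mulrA.
pose L : {linear 'rV[R]_m -> R^o} := HB.pack (L0 : _ -> R^o)
  (GRing.isLinear.Build R 'rV[R]_m R^o *:%R L0 L0lin).
have Lc : continuous L.
  have := @continuous_big R^o 'I_m +%R 0 xpredT (@add_continuous R^o) 'rV[R]_m
    (index_enum _) (fun i v => v 0 i * partial i f x); apply=> i _ v.
  exact: (cvgM (@coord_continuous R 1 m 0 i v) (cvg_cst _)).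
apply: (@differentiable_approx R 'rV[R]_m R^o f L x Lc) => e e0.
  (* [m.+1] rather than [m], since the dimension may be 0. *)
  pose e' := e / m.+1%:R; have e'0 : 0 < e' by rewrite divr_gt0.
  have : \forall y \near x, U y /\ forall i, `|partial i f x - partial i f y| < e'.
    near=> y; split; first by near: y; exact: open_nbhs_nbhs.
    near: y; apply: filter_forall => i.
    by have /cvgrPdist_lt := cf i; apply.
  move=> /nbhs_ballP[r /= r0 Hr].
  near=> v; have vr : `|v| < r.
    near: v; exact: (@nbhs0_lt R 'rV[R]_m r r0).
  have [|c [cv E]] := @coordinate_walk f x v.
    move=> y i yx; apply: df; have [] // := Hr y _.
    by rewrite -ball_normE /= distrC (le_lt_trans yx).
  rewrite [v + x]addrC.
  rewrite opprD addrA E -sumrB (le_trans (ler_norm_sum _ _ _)) //.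
  apply: (@le_trans _ _ (\sum_(i < m) e' * `|v|)); last first.
    rewrite sumr_const card_ord -mulr_natl mulrA ler_wpM2r //.
    rewrite /e' mulrCA ger_pMr // ler_pdivrMr // mul1r ler_nat //.
  apply: ler_sum => i _; rewrite -mulrBr normrM mulrC ler_pM ?norm_coord //.
  have [|_ /(_ i)] := Hr (c i); last by rewrite distrC => /ltW.
  by rewrite -ball_normE /= distrC (le_lt_trans (cv i)).
Unshelve. all: by end_near. Qed.

Lemma derive_partial f x v : differentiable f x ->
  'D_v f x = \sum_i v 0 i * partial i f x.
Proof.
move=> df; rewrite deriveE // {1}(row_sum_delta v) linear_sum /=.
by apply: eq_bigr => i _; rewrite linearZ /= /partial deriveE.
Qed.

Lemma Ck_eq U n f f' : open U -> (forall x, U x -> f x = f' x) ->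
  Ck n U f -> Ck n U f'.
Proof.
move=> oU; have near_eq (h1 h2 : 'rV[R]_m -> R) x :
    (forall x, U x -> h1 x = h2 x) -> U x -> \forall y \near x, h1 y = h2 y.
  move=> eh Ux; have : nbhs x U by exact: open_nbhs_nbhs.
  by apply: filterS => y /eh.
elim: n f f' => [|n IHn] f f' ff' Hf.
  move=> x Ux; rewrite /prop_for /continuous_at -ff' //.
  exact: cvg_trans (near_eq_cvg (near_eq _ _ _ ff' Ux)) (Hf x Ux).
move=> i; have [df pf] := Hf i; split.
  by move=> x Ux; apply: near_eq_derivable (df x Ux); exact: near_eq.
apply: IHn pf => x Ux; apply: near_eq_derive.
exact: near_eq.
Qed.

Lemma Ck_differentiable U f x : open U -> U x -> Ck 1 U f -> differentiable f x.
Proof.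
move=> oU Ux Hf; apply: (C1_differentiable oU Ux) => [i|i].
  by case: (Hf i).
by case: (Hf i) => _; apply.
Qed.

(** Membership in the class [n + 1] says nothing explicit about the function itself; its
    continuity comes from differentiability. *)
Lemma Ck_pred U n f : open U -> Ck n.+1 U f -> Ck n U f.
Proof.
move=> oU; elim: n f => [|n IHn] f Hf.
  by move=> x Ux; apply/differentiable_continuous/(Ck_differentiable oU Ux Hf).
by move=> i; have [df pf] := Hf i; split=> //; apply: IHn.
Qed.

Lemma Ck_sub U V n f : U `<=` V -> Ck n V f -> Ck n U f.
Proof.
move=> UV; elim: n f => [|n IHn] f Hf; first by move=> x /UV; exact: Hf.
by move=> i; have [df pf] := Hf i; split=> [x /UV /df //|]; apply: IHn.
Qed.

Lemma Ck_cst U n (a : R) : Ck n U (cst a).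
Proof.
elim: n a => [|n IHn] a; first by move=> x _; exact: cst_continuous.
move=> i; split=> [x _|]; first exact: derivable_cst.
have -> : partial i (cst a) = cst 0 :> ('rV[R]_m -> R).
  by apply/funext => x; rewrite /partial derive_cst.
exact: IHn.
Qed.

Lemma Ck_add U n f f' : open U -> Ck n U f -> Ck n U f' ->
  Ck n U (fun x => f x + f' x).
Proof.
move=> oU; elim: n f f' => [|n IHn] f f' Hf Hf'.
  by move=> x Ux; exact: (continuousD (Hf x Ux) (Hf' x Ux)).
move=> i; have [df pf] := Hf i; have [df' pf'] := Hf' i; split.
  by move=> x Ux; exact: (derivableD (df x Ux) (df' x Ux)).
apply: (Ck_eq oU _ (IHn _ _ pf pf')) => x Ux.
by rewrite /partial -deriveD //; [exact: df | exact: df'].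
Qed.

Lemma Ck_mul U n f f' : open U -> Ck n U f -> Ck n U f' ->
  Ck n U (fun x => f x * f' x).
Proof.
move=> oU; elim: n f f' => [|n IHn] f f' Hf Hf'.
  by move=> x Ux; exact: (continuousM (Hf x Ux) (Hf' x Ux)).
move=> i; have [df pf] := Hf i; have [df' pf'] := Hf' i; split.
  by move=> x Ux; exact: (derivableM (df x Ux) (df' x Ux)).
apply: (Ck_eq oU _ (Ck_add oU (IHn _ _ (Ck_pred oU Hf) pf')
  (IHn _ _ (Ck_pred oU Hf') pf))) => x Ux.
by rewrite /partial -[RHS]/('D__ (f * f') x) deriveM //; [exact: df | exact: df'].
Qed.

Lemma Ck_inv U n f : open U -> (forall x, U x -> f x != 0) -> Ck n U f ->
  Ck n U (fun x => (f x)^-1).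
Proof.
move=> oU f0; elim: n => [|n IHn] Hf.
  by move=> x Ux; exact: (continuousV (f0 x Ux) (Hf x Ux)).
move=> i; have [df pf] := Hf i; split.
  by move=> x Ux; exact: (derivableV (f0 x Ux) (df x Ux)).
have H := IHn (Ck_pred oU Hf).
apply: (Ck_eq oU _ (Ck_mul oU (Ck_mul oU (Ck_cst U n (-1)) (Ck_mul oU H H)) pf))
    => x Ux.
rewrite /partial (deriveV (f0 x Ux) (df x Ux)).
by rewrite mulN1r -exprVn expr2.
Qed.

Lemma Ck_sum U n (I : Type) (r : seq I) (P : pred I) (F : I -> 'rV[R]_m -> R) :
  open U -> (forall i, P i -> Ck n U (F i)) ->
  Ck n U (fun x => \sum_(i <- r | P i) F i x).
Proof.
move=> oU HF; elim: r => [|i r IHr].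
  by apply: (Ck_eq oU _ (Ck_cst U n 0)) => x _; rewrite big_nil.
case Pi: (P i); last by apply: (Ck_eq oU _ IHr) => x _; rewrite big_cons Pi.
by apply: (Ck_eq oU _ (Ck_add oU (HF i Pi) IHr)) => x _; rewrite big_cons Pi.
Qed.

Lemma smooth_partial U f i : smooth_on U f -> smooth_on U (partial i f).
Proof. by move=> Hf n; case: (Hf n.+1 i). Qed.

Lemma smooth_differentiable U f x :
  open U -> U x -> smooth_on U f -> differentiable f x.
Proof. by move=> oU Ux Hf; apply: Ck_differentiable oU Ux (Hf 1%N). Qed.

(** The chain rule needs differentiability of [f] and [G], not only their partial
    derivatives; it comes from [C1_differentiable]. *)
Lemma chain_partial U V f (G : 'rV[R]_m -> 'rV[R]_m) x i : open U -> open V ->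
  U x -> V (G x) -> smooth_on V f ->
  (forall j, smooth_on U (fun y => G y 0 j)) ->
  derivable (f \o G) x (δ i) /\
  partial i (f \o G) x = \sum_j partial i (fun y => G y 0 j) x * partial j f (G x).
Proof.
move=> oU oV Ux VGx Hf HG.
have dG : differentiable G x.
  have -> : G = \sum_j (fun y => G y 0 j *: δ j).
    by apply/funext => y; rewrite fct_sumE -row_sum_delta.
  apply: differentiable_sum => j; apply: differentiableZl.
  exact: smooth_differentiable oU Ux (HG j).
have df := smooth_differentiable oV VGx Hf.
have dfG : differentiable (f \o G) x by apply: differentiable_comp.
split; first exact: diff_derivable.
rewrite /partial deriveE // diff_comp //= -!deriveE // derive_partial //.
apply: eq_bigr => j _; congr (_ * _).
by rewrite derive_mx ?mxE //; exact: diff_derivable.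
Qed.

Lemma smooth_comp U V f (G : 'rV[R]_m -> 'rV[R]_m) : open U -> open V ->
  (forall x, U x -> V (G x)) -> smooth_on V f ->
  (forall j, smooth_on U (fun y => G y 0 j)) -> smooth_on U (f \o G).
Proof.
move=> oU oV UV Hf HG n; elim: n f Hf => [|n IHn] f Hf.
  move=> x Ux; apply: continuous_comp; last exact: (Hf 0%N _ (UV _ Ux)).
  apply/differentiable_continuous.
  have -> : G = \sum_j (fun y => G y 0 j *: δ j).
    by apply/funext => y; rewrite fct_sumE -row_sum_delta.
  apply: differentiable_sum => j; apply: differentiableZl.
  exact: smooth_differentiable oU Ux (HG j).
move=> i; split=> [x Ux|].
  by have [] := chain_partial i oU oV Ux (UV _ Ux) Hf HG.
have H j : Ck n U (fun x => partial i (fun y => G y 0 j) x * partial j f (G x)).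
  apply: Ck_mul => //; first exact: smooth_partial (HG j) n.
  exact: IHn (smooth_partial j Hf).
apply: (Ck_eq oU _ (Ck_sum (index_enum _) oU (fun j (_ : xpredT j) => H j))) => x Ux.
by have [_ ->] := chain_partial i oU oV Ux (UV _ Ux) Hf HG.
Qed.

End Calculus.

Section Coordinates.
Context {R : realType} {m : nat}.

Lemma is_derive_coord (i j : 'I_m) (x : 'rV[R]_m) :
  is_derive x (delta_mx 0 j) (fun y : 'rV[R]_m => y 0 i) ((i == j)%:R : R).
Proof.
have dc : differentiable (fun y : 'rV[R]_m => y 0 i) x.
  exact: (@differentiable_coord R 1 m x 0 i).
apply: DeriveDef; first exact: diff_derivable.
have := @derive_mx R 'rV[R]_m 1 m id x (delta_mx 0 j) (@derivable_id R 'rV[R]_m x _).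
rewrite derive_id => /rowP /(_ i); rewrite !mxE eqxx /= => ->.
by [].
Qed.

Lemma partial_coord (i j : 'I_m) (x : 'rV[R]_m) :
  partial j (fun y => y 0 i) x = (i == j)%:R.
Proof. by have [_] := is_derive_coord i j x. Qed.

Lemma smooth_coord (U : set 'rV[R]_m) (i : 'I_m) :
  smooth_on U (fun y => y 0 i).
Proof.
case=> [|n] /=; first by move=> x _; exact: (@coord_continuous R 1 m 0 i x).
move=> j; split=> [x _|]; first by have [] := is_derive_coord i j x.
have -> : partial j (fun y : 'rV[R]_m => y 0 i) = cst ((i == j)%:R).
  by apply/funext => x; rewrite partial_coord.
exact: Ck_cst.
Qed.

Lemma partial_eq (U : set 'rV[R]_m) (f h : 'rV[R]_m -> R) i x : open U -> U x ->
  (forall y, U y -> f y = h y) -> partial i f x = partial i h x.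
Proof.
move=> oU Ux fh; apply: near_eq_derive.
have : nbhs x U by exact: open_nbhs_nbhs.
by apply: filterS => y /fh.
Qed.

End Coordinates.

(** * Smooth functions and tangent vectors in charts *)
Section Charts.
Context {R : realType} {m : nat} {M : topologicalType}.
Implicit Types (k : chart R m M) (p q : M) (f h : M -> R).

Definition chart_image k : set 'rV[R]_m := cfun k @` cdom k.

Lemma chart_image_inv k x : is_chart k -> chart_image k x ->
  cdom k (cinv k x) /\ cfun k (cinv k x) = x.
Proof. by case=> _ _ kK _ _ [p kp <-]; rewrite kK. Qed.

Lemma overlap_image k k' : is_chart k ->
  cfun k @` (cdom k `&` cdom k') =
  [set x | chart_image k x /\ cdom k' (cinv k x)].
Proof.
move=> kc; have [_ _ kK _ _] := kc.
apply/seteqP; split=> x /=.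
  by move=> [q [kq k'q] <-]; rewrite kK //; split=> //; exists q.
move=> [kx k'x]; have [Dx xE] := chart_image_inv kc kx.
by exists (cinv k x).
Qed.

Lemma open_overlap k k' : is_chart k -> is_chart k' ->
  open (cfun k @` (cdom k `&` cdom k')).
Proof.
move=> kc kc'; have [okd oki kK cf ci] := kc; have [okd' _ _ _ _] := kc'.
rewrite overlap_image // openE => x [kx k'x].
have : nbhs x (chart_image k) by exact: open_nbhs_nbhs.
have : nbhs x (cinv k @^-1` cdom k').
  by apply: ci => //; exact: open_nbhs_nbhs.
by move=> H1 H2; exact: filterI H2 H1.
Qed.

(** Smoothness near [p] read in the given chart [k], whereas [smooth_at] leaves the chart
    to be chosen. *)
Definition smooth_in k p f : Prop :=
  exists U, [/\ open U, U (cfun k p), U `<=` chart_image k & smooth_on U (f \o cinv k)].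

Lemma smooth_in_change k k' p f : is_chart k -> is_chart k' ->
  smooth_transition k k' -> cdom k p -> cdom k' p ->
  (exists U, [/\ open U, U (cfun k' p) & smooth_on U (f \o cinv k')]) ->
  exists U, [/\ open U, U (cfun k p), U `<=` chart_image k,
    smooth_on U (f \o cinv k) &
    (forall j, smooth_on U (coord k' j \o cinv k)) /\
    (forall x, U x -> f (cinv k x) = (f \o cinv k') (cfun k' (cinv k x)))].
Proof.
move=> kc kc' kk' kp k'p [V [oV Vp sV]].
pose O := cfun k @` (cdom k `&` cdom k').
pose G x := cfun k' (cinv k x).
have oO : open O by exact: open_overlap.
have OP x : O x -> chart_image k x /\ cdom k' (cinv k x).
  by rewrite /O overlap_image.
have [_ _ kK _ ci] := kc; have [_ _ k'K cf' _] := kc'.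
have OG x : O x -> {for x, continuous G}.
  move=> /OP [kx k'x]; apply: continuous_comp; [exact: ci | exact: cf'].
pose W x := O x /\ V (G x).
have oW : open W.
  rewrite openE => x [Ox VGx].
  have H1 : nbhs x O by exact: open_nbhs_nbhs.
  have H2 : nbhs x (G @^-1` V) by apply: OG => //; exact: open_nbhs_nbhs.
  exact: filterI H1 H2.
have fE x : W x -> f (cinv k x) = (f \o cinv k') (G x).
  by case=> /OP[_ k'x] _; rewrite /G /= k'K.
have WO : W `<=` O by move=> x [].
have sG j : smooth_on W (coord k' j \o cinv k).
  by move=> n; apply: Ck_sub WO (kk' j n).
exists W; split=> //.
- by split; [exists p | rewrite /G kK].
- by move=> x [/OP[]].
- move=> n; apply: (Ck_eq oW (fun x Wx => esym (fE x Wx))).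
  by apply: (smooth_comp oW oV _ sV sG n) => x [].
Qed.

Lemma chart_change k k' p f : is_chart k -> is_chart k' ->
  smooth_transition k k' -> cdom k p -> cdom k' p ->
  (exists U, [/\ open U, U (cfun k' p) & smooth_on U (f \o cinv k')]) ->
  forall i, partial i (f \o cinv k) (cfun k p) =
    \sum_j partial i (coord k' j \o cinv k) (cfun k p)
      * partial j (f \o cinv k') (cfun k' p).
Proof.
move=> kc kc' kk' kp k'p Hf i.
have [U [oU Up Uk sf [sG fE]]] := smooth_in_change kc kc' kk' kp k'p Hf.
have [V [oV Vp sV]] := Hf.
have kK : cinv k (cfun k p) = p by case: kc => _ _ ->.
have Ep : V (cfun k' (cinv k (cfun k p))) by rewrite kK.
have := chain_partial i oU oV Up (G := fun x => cfun k' (cinv k x)) Ep sV sG.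
by rewrite kK => -[_ <-]; apply: partial_eq oU Up _.
Qed.

End Charts.

Section ManifoldCalculus.
Context {R : realType} {m : nat} {M : topologicalType} (A : set (chart R m M)).
Context (hM : smooth_manifold A).
Implicit Types (k : chart R m M) (p q : M) (f h : M -> R) (X Y Z : @field R M).

(** Charts of the maximal atlas: global coordinates need not belong to the given
    atlas. *)
Definition admissible k : Prop :=
  is_chart k /\ forall k', A k' -> compatible k k'.

Lemma atlas_admissible k : A k -> admissible k.
Proof.
by case: hM => _ _ cA _ compA kA; split=> [|k' k'A]; [exact: cA | exact: compA].
Qed.

Lemma atlas_chart p : exists2 k, A k & cdom k p.
Proof. by case: hM => _ _ _ + _; apply. Qed.

Lemma smooth_at_in k p f : admissible k -> cdom k p -> smooth_at A p f ->
  smooth_in k p f.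
Proof.
move=> [kc kA] kp [k' [k'A k'p Hf]].
have [k'c _] := atlas_admissible k'A.
have [kk' _] := kA _ k'A.
have [U [? ? ? ? _]] := smooth_in_change kc k'c kk' kp k'p Hf.
by exists U; split.
Qed.

Lemma smooth_in_at k p f : admissible k -> cdom k p -> smooth_in k p f ->
  smooth_at A p f.
Proof.
move=> [kc kA] kp [V [oV Vp _ sV]]; have [k' k'A k'p] := atlas_chart p.
have [k'c _] := atlas_admissible k'A.
have [_ k'k] := kA _ k'A.
have [|U [? ? ? ? _]] := @smooth_in_change _ _ _ k' k p f k'c kc k'k k'p kp.
  by exists V.
by exists k'; split=> //; exists U; split.
Qed.

Lemma smooth_at_eq p f h : (\forall q \near p, f q = h q) ->
  smooth_at A p f -> smooth_at A p h.
Proof.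
move=> fh sf; have [k kA kp] := atlas_chart p.
have ka := atlas_admissible kA; have [kc _] := ka.
have [U [oU Up Uk sU]] := smooth_at_in ka kp sf.
have [okd oki kK cf ci] := kc.
have fh' : nbhs (cinv k (cfun k p)) [set q | f q = h q] by rewrite kK.
have : nbhs (cfun k p) (cinv k @^-1` [set q | f q = h q]).
  by apply: ci => //; exists p.
rewrite nbhsE => -[V [oV Vp] VE].
apply: (smooth_in_at ka kp); exists (U `&` V); split.
- exact: openI.
- by [].
- by move=> x [/Uk].
- move=> n; apply: (@Ck_eq _ _ _ _ (f \o cinv k)); first exact: openI.
    by move=> x [_ /VE].
  by apply: Ck_sub (sU n) => x [].
Qed.

Lemma smooth_at_cst p (a : R) : smooth_at A p (cst a).
Proof.
have [k kA kp] := atlas_chart p; have ka := atlas_admissible kA.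
apply: (smooth_in_at ka kp); exists (chart_image k); split=> //.
- by case: ka => -[].
- by exists p.
- by move=> n; apply: Ck_cst.
Qed.

Lemma smooth_at_op2 (op : R -> R -> R) p f h :
  (forall U (F H : 'rV[R]_m -> R), open U -> smooth_on U F -> smooth_on U H ->
     smooth_on U (fun x => op (F x) (H x))) ->
  smooth_at A p f -> smooth_at A p h -> smooth_at A p (fun q => op (f q) (h q)).
Proof.
move=> Hop sf sh; have [k kA kp] := atlas_chart p; have ka := atlas_admissible kA.
have [U [oU Up Uk sU]] := smooth_at_in ka kp sf.
have [V [oV Vp Vk sV]] := smooth_at_in ka kp sh.
apply: (smooth_in_at ka kp); exists (U `&` V); split.
- exact: openI.
- by [].
- by move=> x [/Uk].
- apply: Hop; first exact: openI.
    by move=> n; apply: Ck_sub (sU n) => x [].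
  by move=> n; apply: Ck_sub (sV n) => x [].
Qed.

Lemma smooth_at_add p f h : smooth_at A p f -> smooth_at A p h ->
  smooth_at A p (fun q => f q + h q).
Proof.
by apply: smooth_at_op2 => U F H oU sF sH n; apply: Ck_add.
Qed.

Lemma smooth_at_mul p f h : smooth_at A p f -> smooth_at A p h ->
  smooth_at A p (fun q => f q * h q).
Proof.
by apply: smooth_at_op2 => U F H oU sF sH n; apply: Ck_mul.
Qed.

Lemma smooth_at_sum p (I : Type) (r : seq I) (P : pred I) (F : I -> M -> R) :
  (forall i, P i -> smooth_at A p (F i)) ->
  smooth_at A p (fun q => \sum_(i <- r | P i) F i q).
Proof.
move=> HF; elim: r => [|i r IHr].
  apply: smooth_at_eq (smooth_at_cst p 0).
  by apply: nearW => q; rewrite big_nil.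
case Pi: (P i).
  apply: smooth_at_eq (smooth_at_add (HF i Pi) IHr).
  by apply: nearW => q; rewrite big_cons Pi.
by apply: smooth_at_eq IHr; apply: nearW => q; rewrite big_cons Pi.
Qed.

Lemma smooth_at_prod p (I : Type) (r : seq I) (P : pred I) (F : I -> M -> R) :
  (forall i, P i -> smooth_at A p (F i)) ->
  smooth_at A p (fun q => \prod_(i <- r | P i) F i q).
Proof.
move=> HF; elim: r => [|i r IHr].
  apply: smooth_at_eq (smooth_at_cst p 1).
  by apply: nearW => q; rewrite big_nil.
case Pi: (P i).
  apply: smooth_at_eq (smooth_at_mul (HF i Pi) IHr).
  by apply: nearW => q; rewrite big_cons Pi.
by apply: smooth_at_eq IHr; apply: nearW => q; rewrite big_cons Pi.
Qed.

Lemma smooth_at_continuous p f : smooth_at A p f -> {for p, continuous f}.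
Proof.
move=> [k [kA kp [U [oU Up sU]]]].
have [[okd _ kK cf _] _] := atlas_admissible kA.
have H : nbhs p (cdom k) by exact: open_nbhs_nbhs.
have E : \forall q \near p, (f \o cinv k) (cfun k q) = f q.
  by apply: filterS H => q kq; rewrite /= kK.
have : {for p, continuous ((f \o cinv k) \o cfun k)}.
  by apply: continuous_comp; [exact: cf | exact: (sU 0%N)].
rewrite /prop_for /continuous_at /= kK //.
exact: cvg_trans (near_eq_cvg E).
Qed.

Lemma smooth_at_inv p f : smooth_at A p f -> f p != 0 ->
  smooth_at A p (fun q => (f q)^-1).
Proof.
move=> sf f0; have [k kA kp] := atlas_chart p; have ka := atlas_admissible kA.
have [U [oU Up Uk sU]] := smooth_at_in ka kp sf.
have [[_ _ kK _ _] _] := ka.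
pose W := U `&` [set x | f (cinv k x) != 0].
have oW : open W.
  rewrite openE => x [Ux fx]; apply: filterI; first exact: open_nbhs_nbhs.
  have H : nbhs (f (cinv k x)) [set y : R | y != 0].
    by apply: open_nbhs_nbhs; split=> //; exact: open_neq.
  exact: (sU 0%N x Ux) _ H.
apply: (smooth_in_at ka kp); exists W; split=> //.
- by split=> //=; rewrite kK.
- by move=> x [/Uk].
- move=> n; apply: Ck_inv => //; first by move=> x [].
  by apply: Ck_sub (sU n) => x [].
Qed.

Lemma smooth_at_partial k p f i : admissible k -> cdom k p -> smooth_at A p f ->
  smooth_at A p (fun q => partial i (f \o cinv k) (cfun k q)).
Proof.
move=> ka kp sf; have [U [oU Up Uk sU]] := smooth_at_in ka kp sf.
apply: (smooth_in_at ka kp); exists U; split=> // n.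
apply: (Ck_eq oU _ (smooth_partial i sU n)) => x /Uk kx /=.
by have [_ ->] := chart_image_inv (proj1 ka) kx.
Qed.

Lemma smooth_at_coord k p i : admissible k -> cdom k p -> smooth_at A p (coord k i).
Proof.
move=> ka kp; have [kc _] := ka; apply: (smooth_in_at ka kp).
have oki : open (chart_image k) by case: kc.
exists (chart_image k); split=> //; first by exists p.
move=> n; apply: (Ck_eq oki _ (@smooth_coord _ _ _ i n)) => x kx.
by rewrite /= /coord; have [_ ->] := chart_image_inv kc kx.
Qed.

Lemma partial_chart_coord k p i j : admissible k -> cdom k p ->
  partial j (coord k i \o cinv k) (cfun k p) = (i == j)%:R.
Proof.
move=> [kc _] kp; rewrite -(partial_coord i j (cfun k p)).
have oki : open (chart_image k) by case: kc.
apply: (partial_eq _ oki); first by exists p.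
by move=> x kx; rewrite /= /coord; have [_ ->] := chart_image_inv kc kx.
Qed.

Lemma smooth_at_chart k p f : admissible k -> cdom k p -> smooth_at A p f ->
  exists U, [/\ open U, U (cfun k p) & smooth_on U (f \o cinv k)].
Proof. by move=> ka kp /(smooth_at_in ka kp) [U []]; exists U. Qed.

Lemma partial_change k k' p f i : A k -> admissible k' -> cdom k p -> cdom k' p ->
  smooth_at A p f ->
  partial i (f \o cinv k) (cfun k p) =
    \sum_j partial i (coord k' j \o cinv k) (cfun k p)
      * partial j (f \o cinv k') (cfun k' p).
Proof.
move=> kA ka' kp k'p sf; have [kc _] := atlas_admissible kA.
have [kc' /(_ _ kA) [_ kk']] := ka'.
exact: chart_change kc kc' kk' kp k'p (smooth_at_chart ka' k'p sf) i.
Qed.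

Lemma tangent_nonsmooth p v f : tangent A p v -> ~ smooth_at A p f -> v f = 0.
Proof. by move=> [k [a [_ _ ->]]] nf; rewrite /tvec asboolF. Qed.

(** By the chain rule a tangent vector may be expanded in any admissible chart, with
    its values on the coordinate functions as components. *)
Lemma tangent_expand k p v f : admissible k -> cdom k p -> tangent A p v ->
  smooth_at A p f ->
  v f = \sum_i v (coord k i) * partial i (f \o cinv k) (cfun k p).
Proof.
move=> ka kp [k0 [a [k0A k0p ->]]] sf.
rewrite {1}/tvec asboolT //.
under eq_bigr => i _ do rewrite (partial_change i k0A ka k0p kp sf) mulr_sumr.
rewrite exchange_big; apply: eq_bigr => j _ /=.
rewrite /tvec asboolT; last exact: smooth_at_coord.
by rewrite mulr_suml; apply: eq_bigr => i _; rewrite mulrA.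
Qed.

Lemma tangent_ext k p v w : admissible k -> cdom k p -> tangent A p v ->
  tangent A p w -> (forall i, v (coord k i) = w (coord k i)) -> v = w.
Proof.
move=> ka kp tv tw vw; apply/funext => f.
have [sf|nf] := pselect (smooth_at A p f).
  rewrite (tangent_expand ka kp tv sf) (tangent_expand ka kp tw sf).
  by apply: eq_bigr => i _; rewrite vw.
by rewrite !(tangent_nonsmooth _ nf).
Qed.

Lemma tvec_coord k p a i : admissible k -> cdom k p ->
  tvec A k p a (coord k i) = a 0 i.
Proof.
move=> ka kp; rewrite /tvec asboolT; last exact: smooth_at_coord.
rewrite (bigD1 i) //= partial_chart_coord // eqxx mulr1 big1 ?addr0 // => j ji.
by rewrite partial_chart_coord // eq_sym (negbTE ji) mulr0.
Qed.

Lemma tangent_tvec k p a : admissible k -> cdom k p -> tangent A p (tvec A k p a).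
Proof.
move=> ka kp; have [k0 k0A k0p] := atlas_chart p.
have [kc /(_ _ k0A) [kk0 _]] := ka; have [kc0 _] := atlas_admissible k0A.
exists k0, (\row_j \sum_i a 0 i * partial i (coord k0 j \o cinv k) (cfun k p)).
split=> //; apply/funext => f; rewrite /tvec.
have [sf|nf] := pselect (smooth_at A p f); last by rewrite !asboolF.
rewrite !asboolT //.
under eq_bigr => i _ do rewrite (chart_change kc kc0 kk0 kp k0p
  (smooth_at_chart (atlas_admissible k0A) k0p sf)) mulr_sumr.
rewrite exchange_big; apply: eq_bigr => j _ /=.
by rewrite mxE mulr_suml; apply: eq_bigr => i _; rewrite mulrA.
Qed.

Lemma tangent_tvec_coord k p v : admissible k -> cdom k p -> tangent A p v ->
  v = tvec A k p (\row_i v (coord k i)).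
Proof.
move=> ka kp tv; apply: (tangent_ext ka kp tv (tangent_tvec _ ka kp)) => i.
by rewrite tvec_coord // mxE.
Qed.

Lemma tangent_lin p (a : R) v w : tangent A p v -> tangent A p w ->
  tangent A p (a *: v + w).
Proof.
have [k kA kp] := atlas_chart p; have ka := atlas_admissible kA => tv tw.
rewrite (tangent_tvec_coord ka kp tv) (tangent_tvec_coord ka kp tw).
set x := \row_i _; set y := \row_i _.
have -> : a *: tvec A k p x + tvec A k p y = tvec A k p (a *: x + y).
  apply/funext => f; transitivity (a * tvec A k p x f + tvec A k p y f) => //.
  rewrite /tvec; case: ifP => _; last by rewrite mulr0 add0r.
  rewrite mulr_sumr -big_split /=; apply: eq_bigr => i _.
  by rewrite !mxE mulrDl mulrA.
exact: tangent_tvec.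
Qed.

Lemma tangent0 p : tangent A p 0.
Proof.
have [k kA kp] := atlas_chart p; have ka := atlas_admissible kA.
rewrite (_ : 0 = tvec A k p 0); first exact: tangent_tvec.
apply/funext => f; rewrite /tvec; case: ifP => // _.
by rewrite big1 // => i _; rewrite mxE mul0r.
Qed.

Lemma tangent_differentiable k p f : admissible k -> cdom k p -> smooth_at A p f ->
  differentiable (f \o cinv k) (cfun k p).
Proof.
by move=> ka kp /(smooth_at_chart ka kp) [U [oU Up sU]];
    exact: smooth_differentiable oU Up sU.
Qed.

Lemma tangent_add p v f h : tangent A p v -> smooth_at A p f -> smooth_at A p h ->
  v (fun q => f q + h q) = v f + v h.
Proof.
move=> tv sf sh; have [k kA kp] := atlas_chart p; have ka := atlas_admissible kA.
rewrite !(tangent_expand ka kp tv) //; last exact: smooth_at_add.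
rewrite -big_split; apply: eq_bigr => i _ /=; rewrite -mulrDr; congr (_ * _).
rewrite /partial -deriveD //; apply: diff_derivable; exact: tangent_differentiable.
Qed.

Lemma tangent_mul p v f h : tangent A p v -> smooth_at A p f -> smooth_at A p h ->
  v (fun q => f q * h q) = f p * v h + h p * v f.
Proof.
move=> tv sf sh; have [k kA kp] := atlas_chart p; have ka := atlas_admissible kA.
have kK : cinv k (cfun k p) = p by case: ka => -[_ _ ->].
rewrite !(tangent_expand ka kp tv) //; last exact: smooth_at_mul.
rewrite !mulr_sumr -big_split; apply: eq_bigr => i _ /=.
rewrite {1}/partial -[X in _ * X = _]/('D__ ((f \o cinv k) * (h \o cinv k)) _).
rewrite deriveM; try by apply: diff_derivable; exact: tangent_differentiable.
by rewrite /= kK /partial mulrDr !mulrA; congr (_ * _ + _ * _); rewrite mulrC.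
Qed.

Lemma tangent_cst p v (a : R) : tangent A p v -> v (cst a) = 0.
Proof.
move=> tv; have [k kA kp] := atlas_chart p; have ka := atlas_admissible kA.
rewrite (tangent_expand ka kp tv); last exact: smooth_at_cst.
by rewrite big1 // => i _; rewrite /partial -[_ \o _]/(cst a) derive_cst mulr0.
Qed.

Lemma tangent_scale p v (a : R) f : tangent A p v -> smooth_at A p f ->
  v (fun q => a * f q) = a * v f.
Proof.
move=> tv sf; have := tangent_mul tv (smooth_at_cst p a) sf.
by rewrite (tangent_cst a tv) mulr0 addr0.
Qed.

Lemma tangent_sum p v (I : Type) (r : seq I) (P : pred I) (F : I -> M -> R) :
  tangent A p v -> (forall i, P i -> smooth_at A p (F i)) ->
  v (fun q => \sum_(i <- r | P i) F i q) = \sum_(i <- r | P i) v (F i).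
Proof.
move=> tv HF; elim: r => [|i r IHr].
  rewrite [RHS]big_nil; transitivity (v (cst 0)); last exact: (tangent_cst 0 tv).
  congr (v _).
  by apply/funext => q; rewrite big_nil.
rewrite big_cons; case: ifP => Pi; last first.
  by rewrite -IHr; congr (v _); apply/funext => q; rewrite big_cons Pi.
rewrite -IHr -(tangent_add tv (HF i Pi) (smooth_at_sum _ HF)).
by congr (v _); apply/funext => q; rewrite big_cons Pi.
Qed.

Lemma smooth_fderiv X f : vector_field A X -> smooth_fun A f ->
  smooth_fun A (fderiv X f).
Proof.
move=> [tX sX] sf p; have [k kA kp] := atlas_chart p.
have ka := atlas_admissible kA; have [[okd _ _ _ _] _] := ka.
have : smooth_at A p (fun q => \sum_i X q (coord k i) *
    partial i (f \o cinv k) (cfun k q)).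
  apply: smooth_at_sum => i _; apply: smooth_at_mul; first exact: sX.
  exact: smooth_at_partial.
apply: smooth_at_eq; have : nbhs p (cdom k) by exact: open_nbhs_nbhs.
by apply: filterS => q kq; rewrite -(tangent_expand ka kq).
Qed.

Lemma vector_field_lin h X Y : smooth_fun A h -> vector_field A X ->
  vector_field A Y -> vector_field A (fscale h X + Y).
Proof.
move=> sh [tX sX] [tY sY]; split=> [p|k i kA p kp].
  exact: (tangent_lin (h p) (tX p) (tY p)).
apply: smooth_at_add; last exact: sY.
by apply: smooth_at_mul; [exact: sh | exact: sX].
Qed.

Lemma vector_field0 : vector_field A 0.
Proof.
split=> [p|k i kA p kp]; first exact: tangent0.
exact: (smooth_at_cst p 0).
Qed.

Lemma vector_field_coord k i : admissible k -> cdom k = setT ->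
  vector_field A (coord_field A k i).
Proof.
move=> ka kT; split=> [p|k' j kA' p k'p]; first by apply: tangent_tvec => //;
    rewrite kT.
have kp : cdom k p by rewrite kT.
have ka' := atlas_admissible kA'.
have : smooth_at A p (fun q => partial i (coord k' j \o cinv k) (cfun k q)).
  by apply: smooth_at_partial => //; exact: smooth_at_coord.
apply: smooth_at_eq; have [[okd' _ _ _ _] _] := ka'.
have : nbhs p (cdom k') by exact: open_nbhs_nbhs.
apply: filterS => q k'q; rewrite /coord_field /tvec asboolT;
    last exact: smooth_at_coord.
rewrite (bigD1 i) //= mxE !eqxx mul1r big1 ?addr0 // => l li.
by rewrite mxE (negbTE li) andbF mul0r.
Qed.

End ManifoldCalculus.

(** * Rigidity of traceless cubic forms *)
Section Dot.
Context {R : realType}.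

Definition dot n (x y : 'rV[R]_n) : R := (x *m y^T) 0 0.

Lemma dotE n (x y : 'rV[R]_n) : dot x y = \sum_i x 0 i * y 0 i.
Proof. by rewrite /dot mxE; apply: eq_bigr => i _; rewrite mxE. Qed.

Lemma dotC n (x y : 'rV[R]_n) : dot x y = dot y x.
Proof. by rewrite !dotE; apply: eq_bigr => i _; rewrite mulrC. Qed.

Lemma dotDl n (x y z : 'rV[R]_n) : dot (x + y) z = dot x z + dot y z.
Proof. by rewrite /dot mulmxDl mxE. Qed.

Lemma dotZl n a (x z : 'rV[R]_n) : dot (a *: x) z = a * dot x z.
Proof. by rewrite /dot -scalemxAl mxE. Qed.

Lemma dotDr n (x y z : 'rV[R]_n) : dot z (x + y) = dot z x + dot z y.
Proof. by rewrite !(dotC z) dotDl. Qed.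

Lemma dotZr n a (x z : 'rV[R]_n) : dot z (a *: x) = a * dot z x.
Proof. by rewrite !(dotC z) dotZl. Qed.

Lemma dotNl n (x z : 'rV[R]_n) : dot (- x) z = - dot x z.
Proof. by rewrite -scaleN1r dotZl mulN1r. Qed.

Lemma dot0l n (z : 'rV[R]_n) : dot 0 z = 0.
Proof. by rewrite /dot mul0mx mxE. Qed.

Lemma dot_ge0 n (x : 'rV[R]_n) : 0 <= dot x x.
Proof. by rewrite dotE sumr_ge0 // => i _; rewrite -expr2 sqr_ge0. Qed.

Lemma dot_eq0 n (x : 'rV[R]_n) : dot x x = 0 -> x = 0.
Proof.
rewrite dotE => /eqP; rewrite psumr_eq0; last by move=> i _; rewrite -expr2 sqr_ge0.
by move=> /allP H; apply/rowP => i; rewrite mxE; apply/eqP;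
  have := H i (mem_index_enum _); rewrite /= -expr2 sqrf_eq0.
Qed.

Lemma dot_sym n (x y : 'rV[R]_n) (B : 'M[R]_n) : B^T = B -> dot (x *m B)
    y = dot (y *m B) x.
Proof. by move=> BT; rewrite dotC /dot trmx_mul BT mulmxA. Qed.

(** The matrix [y^T *m z] is the rank one operator [x |-> (x . y) z] on row vectors. *)
Lemma mul_tr_row n (x : 'rV[R]_n) (y : 'rV[R]_n) l (z : 'rV[R]_l) :
  x *m (y^T *m z) = dot x y *: z.
Proof. by rewrite mulmxA [x *m _]mx11_scalar mul_scalar_mx. Qed.

Lemma trace_tr_row n (x y : 'rV[R]_n) : \tr (x^T *m y) = dot y x.
Proof. by rewrite mxtrace_mulC /dot /mxtrace big_ord1. Qed.

Lemma orth_split n (e x : 'rV[R]_n) : dot e e = 1 ->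
  exists y (s : R), dot e y = 0 /\ x = y + s *: e.
Proof.
move=> ee; exists (x - dot e x *: e), (dot e x).
by rewrite subrK dotDr -scaleNr dotZr ee mulr1 subrr.
Qed.

Lemma compact_sphere n (s : R) : compact [set x : 'rV[R]_n | dot x x = s].
Proof.
apply: bounded_closed_compact.
  exists (1 + `|s|); split; first by rewrite num_real.
  move=> b sb x /= xs; apply: norm_row_le.
    by apply: le_trans (ltW sb); rewrite addr_ge0.
  move=> i; apply: le_trans (ltW sb).
  have s0 : 0 <= s by rewrite -xs dot_ge0.
  rewrite (ger0_norm s0).
  have xi : `|x 0 i| ^+ 2 <= s.
    rewrite real_normK ?num_real // -xs dotE (bigD1 i) //= -expr2 lerDl.
    by rewrite sumr_ge0 // => j _; rewrite -expr2 sqr_ge0.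
  have := normr_ge0 (x 0 i); nra.
have cd : continuous (fun x : 'rV[R]_n => dot x x).
  have H : Ck 0 setT (fun x : 'rV[R]_n => \sum_i x 0 i * x 0 i).
    by apply: Ck_sum => [|i _]; [exact: openT | apply: Ck_mul;
        [exact: openT | exact: (@smooth_coord _ _ _ i 0%N)
        | exact: (@smooth_coord _ _ _ i 0%N)]].
  move=> x; have := H x I; rewrite (_ : (fun x => \sum_i _) = fun x => dot x x) //.
  by apply/funext => y; rewrite dotE.
rewrite (_ : [set x | _] = (fun x : 'rV[R]_n => dot x x) @^-1` [set s]) //.
by apply: closed_comp => // x _; exact: cd.
Qed.

Lemma poly_right_ge0 (p : {poly R}) : (forall t, 0 < t -> 0 <= p.[t]) -> 0 <= p.[0].
Proof.
move=> H; rewrite leNgt; apply/negP => p0.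
have /cvgrPdist_lt /(_ (- p.[0])) := @continuous_horner R p 0.
rewrite oppr_gt0 p0 => /(_ isT) /nbhs_ballP [e /= e0 He].
have e20 : 0 < e / 2 by rewrite divr_gt0.
have := He (e / 2); rewrite -ball_normE /= sub0r normrN gtr0_norm //.
rewrite ltr_pdivrMr // ltr_pMr // ltr1n => /(_ isT).
by have := H _ e20; rewrite ltr_norml => h /andP[]; lra.
Qed.

Lemma horner_rec_right_ge0 (s : seq R) :
  (forall t, 0 < t -> 0 <= horner_rec s t) -> 0 <= horner_rec s 0.
Proof.
move=> H; rewrite -horner_Poly; apply: poly_right_ge0 => t t0.
by rewrite horner_Poly; exact: H.
Qed.

(** Necessary conditions for a maximum of a cubic form, along the parametrisation
    [((1 - t^2) e + 2 t y) / (1 + t^2)] of a great circle: being rational, it turns the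
    first and second order conditions into statements about polynomials in [t].  Here
    [lam], [c1], [c2], [c3] are the values of the form on [eee], [eey], [eyy], [yyy]. *)
Lemma circle_max (lam c1 c2 c3 : R) :
  (forall t, (1 - t ^+ 2) ^+ 3 * lam + 6 * t * (1 - t ^+ 2) ^+ 2 * c1
     + 12 * t ^+ 2 * (1 - t ^+ 2) * c2 + 8 * t ^+ 3 * c3 <= lam * (1 + t ^+ 2) ^+ 3) ->
  c1 = 0 /\ 2 * c2 <= lam.
Proof.
move=> H.
have le0 (d1 d3 : R) :
    (forall t, (1 - t ^+ 2) ^+ 3 * lam + 6 * t * (1 - t ^+ 2) ^+ 2 * d1
     + 12 * t ^+ 2 * (1 - t ^+ 2) * c2 + 8 * t ^+ 3 * d3 <= lam * (1 + t ^+ 2) ^+ 3) ->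
    d1 <= 0.
  (* The coefficients of (right-hand side - left-hand side) / t. *)
  move=> Hd; have := @horner_rec_right_ge0 ([:: - 6 * d1; 6 * lam - 12 * c2;
    12 * d1 - 8 * d3; 12 * c2; - 6 * d1; 2 * lam]).
  rewrite /= => K; suff : 0 <= - 6 * d1 by lra.
  rewrite [X in 0 <= X](_ : _ = (((((0 * 0 + 2 * lam) * 0 + - 6 * d1) * 0 + 12 * c2) * 0
     + (12 * d1 - 8 * d3)) * 0 + (6 * lam - 12 * c2)) * 0 + - 6 * d1); last by ring.
  apply: K => t t0; rewrite -(pmulr_rge0 _ t0).
  by have := Hd t; rewrite -subr_ge0; congr (0 <= _); ring.
have c10 : c1 = 0.
  apply/le_anti; rewrite (le0 c1 c3 H) /= -oppr_le0; apply: (le0 _ (- c3)) => t.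
  by have := H (- t); congr (_ <= _); ring.
(* As [c1 = 0], a second factor [t] can be removed. *)
split=> //; have := @horner_rec_right_ge0 ([:: 6 * lam - 12 * c2; - 8 * c3; 12 * c2;
   0; 2 * lam]).
rewrite /= => K; suff : 0 <= 6 * lam - 12 * c2 by lra.
rewrite [X in 0 <= X](_ : _ = ((((0 * 0 + 2 * lam) * 0 + 0) * 0 + 12 * c2) * 0
     + - 8 * c3) * 0 + (6 * lam - 12 * c2)); last by ring.
apply: K => t t0; rewrite -(pmulr_rge0 _ t0) -(pmulr_rge0 _ t0).
by have := H t; rewrite -subr_ge0 c10; congr (0 <= _); ring.
Qed.

End Dot.

Section Gram.
Context {R : realType} {m : nat}.

(** Gram-Schmidt: as long as there is room, the kernel of the pairing with the
    rows found so far supplies a new direction. *)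
Lemma orthonormal_extend (G : 'M[R]_m) k0 (P0 : 'M[R]_(k0, m)) :
  (forall x : 'rV_m, x != 0 -> 0 < (x *m G *m x^T) 0 0) -> G^T = G ->
  P0 *m G *m P0^T = 1%:M ->
  forall k, (k0 + k <= m)%N ->
  exists P : 'M[R]_(k, m), P *m G *m P^T = 1%:M /\ P0 *m G *m P^T = 0.
Proof.
move=> Gpos Gsym P0G; elim=> [|k IHk] km.
  by exists 0; split; [apply/matrixP => -[] | apply/matrixP => i []].
have [|P [PG P0P]] := IHk; first by rewrite (leq_trans _ km) // addnS.
pose B := kermx (G *m (col_mx P0 P)^T).
have rB : (0 < \rank B)%N.
  rewrite mxrank_ker subn_gt0 (@leq_ltn_trans (k0 + k)%N) //; last by rewrite -addnS.
  by rewrite (leq_trans (mxrankM_maxr _ _)) // rank_leq_col.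
have [i wn0] : exists i, row i B != 0.
  apply/existsP; apply: contraTT rB; rewrite negb_exists -leqNgt => /forallP H.
  suff -> : B = 0 by rewrite mxrank0.
  by apply/row_matrixP => i; rewrite row0; apply/eqP; rewrite -[_ == _]negbK H.
set w := row i B in wn0.
have : w *m G *m (col_mx P0 P)^T = 0 by rewrite -mulmxA /w -row_mul mulmx_ker row0.
rewrite tr_col_mx mul_mx_row -row_mx0 => /eq_row_mx [wP0 wP].
have s0 := Gpos w wn0; set s := (_ *m _) 0 0 in s0.
pose w' := (Num.sqrt s)^-1 *: w.
have w'P : w' *m G *m P^T = 0 by rewrite /w' -!scalemxAl wP scaler0.
have w'P0 : w' *m G *m P0^T = 0 by rewrite /w' -!scalemxAl wP0 scaler0.
have swap l (Q : 'M[R]_(l, m)) : w' *m G *m Q^T = 0 -> Q *m G *m w'^T = 0.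
  by move=> Q0; apply: trmx_inj; rewrite !trmx_mul trmxK Gsym mulmxA Q0 trmx0.
have w'w' : w' *m G *m w'^T = 1%:M.
  rewrite /w' [(_ *: w)^T]linearZ /= -!scalemxAl -scalemxAr scalerA.
  rewrite [w *m _ *m _]mx11_scalar -/s scale_scalar_mx.
  by rewrite -invfM -expr2 sqr_sqrtr ?ltW // mulVf ?gt_eqF.
rewrite -addn1; exists (col_mx P w'); split.
  rewrite mul_col_mx tr_col_mx mul_col_mx !mul_mx_row PG w'P (swap _ _ w'P) w'w'.
  by rewrite -block_mxEv -scalar_mx_block.
by rewrite tr_col_mx mul_mx_row P0P (swap _ _ w'P0) row_mx0.
Qed.

Lemma orthonormal_rows (G : 'M[R]_m) :
  (forall x : 'rV_m, x != 0 -> 0 < (x *m G *m x^T) 0 0) ->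
  G^T = G -> exists P : 'M[R]_m, P *m G *m P^T = 1%:M.
Proof.
move=> Gpos Gsym.
have [||P [PG _]] := @orthonormal_extend G 0 0 Gpos Gsym _ m; last by exists P.
  by apply/matrixP => -[].
by rewrite add0n.
Qed.

End Gram.

Section Rigidity.
Context {R : realType}.

Section Step.
Context (n : nat) (mu : R) (K : 'rV[R]_n.+1 -> 'M[R]_n.+1).
Context (mu0 : mu < 0).
Context (Klin : forall a x y, K (a *: x + y) = a *: K x + K y).
Context (Ksym : forall x y, x *m K y = y *m K x).
Context (KT : forall x, (K x)^T = K x).
Context (Ktr : forall x, \tr (K x) = 0).
Context (KK : forall x y,
  K x *m K y - K y *m K x = mu *: (x^T *m y - y^T *m x)).

Let cub x := dot (x *m K x) x.

Lemma cubic_op0 : K 0 = 0.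
Proof.
have := Klin 1 0 0; rewrite !scale1r addr0 => /eqP.
by rewrite -subr_eq subrr eq_sym => /eqP.
Qed.

Lemma cubic_opZ a x : K (a *: x) = a *: K x.
Proof. by rewrite -{1}(addr0 (a *: x)) Klin cubic_op0 addr0. Qed.

Lemma cubic_op_expand x : K x = \sum_l x 0 l *: K (delta_mx 0 l).
Proof.
rewrite {1}(row_sum_delta x); elim/big_rec2 : _ => [|l y z _ <-];
    first exact: cubic_op0.
by rewrite Klin.
Qed.

Lemma cubic_continuous : continuous cub.
Proof.
pose F (x : 'rV[R]_n.+1) :=
  \sum_j (\sum_i x 0 i * (\sum_l x 0 l * K (delta_mx 0 l) i j)) * x 0 j.
have oT := @openT 'rV[R]_n.+1.
have sc i : Ck 0 setT (fun x : 'rV[R]_n.+1 => x 0 i)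
    by exact: (@smooth_coord _ _ _ i 0%N).
have H : Ck 0 setT F.
  apply: Ck_sum => // j _; apply: Ck_mul => //.
  apply: Ck_sum => // i _; apply: Ck_mul => //.
  apply: Ck_sum => // l _; apply: Ck_mul => //; exact: Ck_cst.
move=> x; have := H x I; rewrite (_ : F = cub) //; apply/funext => y.
rewrite /F /cub dotE; apply: eq_bigr => j _; rewrite mxE; congr (_ * _).
apply: eq_bigr => i _; rewrite cubic_op_expand summxE; congr (_ * _).
by apply: eq_bigr => l _; rewrite mxE.
Qed.

Lemma cubic_max_exists : exists e, dot e e = 1 /\ forall x, dot x x = 1 ->
    cub x <= cub e.
Proof.
pose S := [set x : 'rV[R]_n.+1 | dot x x = 1].
have [||c cS cmax] := @compact_EVT_max _ _ cub S _ (@compact_sphere R n.+1 1).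
- exists (delta_mx 0 0); rewrite /S /= dotE (bigD1 ord0) //= big1 ?addr0.
    by rewrite mxE !eqxx mulr1.
  by move=> i i0; rewrite mxE eqxx (negbTE i0) mulr0.
- exact/continuous_subspaceT/cubic_continuous.
exists c; move: cS; rewrite inE => cS; split=> // x xS.
by apply: cmax; rewrite inE.
Qed.

Lemma cubic_combination e y (a b : R) : cub (a *: e + b *: y) =
  a ^+ 3 * cub e + 3 * a ^+ 2 * b * dot (e *m K e) y
    + 3 * a * b ^+ 2 * dot (y *m K e) y + b ^+ 3 * cub y.
Proof.
rewrite /cub Klin cubic_opZ mulmxDr -!scalemxAr !mulmxDl -!scalemxAl !dotDl !dotDr.
rewrite !dotZl !dotZr !dotDl !dotZl.
have sym u v w : dot (u *m K v) w = dot (w *m K v) u by exact: dot_sym.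
rewrite [dot (e *m K y) e](_ : _ = dot (e *m K e) y); last by rewrite Ksym sym.
rewrite [dot (y *m K e) e](_ : _ = dot (e *m K e) y); last by rewrite sym.
rewrite [dot (e *m K y) y](_ : _ = dot (y *m K e) y); last by rewrite Ksym.
rewrite [dot (y *m K y) e](_ : _ = dot (y *m K e) y); last by rewrite sym Ksym.
ring.
Qed.

Lemma cubic_scale (a : R) x : cub (a *: x) = a ^+ 3 * cub x.
Proof. by rewrite /cub cubic_opZ -scalemxAr -scalemxAl !dotZl dotZr; ring. Qed.

(** Since [|(1 - t^2) e + 2 t y| = 1 + t^2], the maximality of [e] and homogeneity give
    the hypothesis of [circle_max]. *)
Lemma cubic_max_unit e y : dot e e = 1 -> (forall x, dot x x = 1 -> cub x <= cub e) ->
  dot y y = 1 -> dot e y = 0 ->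
  dot (e *m K e) y = 0 /\ 2 * dot (y *m K e) y <= cub e.
Proof.
move=> ee emax yy ey; apply: (@circle_max _ _ _ _ (cub y)) => t.
pose x := (1 - t ^+ 2) *: e + (2 * t) *: y.
have s0 : 0 < 1 + t ^+ 2 by have := sqr_ge0 t; lra.
have xx : dot x x = (1 + t ^+ 2) ^+ 2.
  by rewrite /x !dotDl !dotDr !dotZl !dotZr (dotC y e) ee yy ey; ring.
have := emax ((1 + t ^+ 2)^-1 *: x).
rewrite dotZl dotZr xx cubic_scale exprVn expr2 mulKf ?gt_eqF // mulVf ?gt_eqF // =>
    /(_ erefl).
rewrite ler_pdivrMl ?exprn_gt0 // mulrC cubic_combination => h.
by apply: le_trans h; rewrite le_eqVlt; apply/orP; left; apply/eqP; ring.
Qed.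

Lemma cubic_max_orth e y : dot e e = 1 -> (forall x, dot x x = 1 -> cub x <= cub e) ->
  dot e y = 0 ->
  dot (e *m K e) y = 0 /\ 2 * dot (y *m K e) y <= cub e * dot y y.
Proof.
move=> ee emax ey; have [yy0|yy0] := eqVneq (dot y y) 0.
  by rewrite (dot_eq0 yy0) mul0mx !dot0l dotC dot0l !mulr0.
have yy : 0 < dot y y by rewrite lt_neqAle eq_sym yy0 dot_ge0.
pose s := Num.sqrt (dot y y); have s0 : 0 < s by rewrite sqrtr_gt0.
have sE : dot y y = s ^+ 2 by rewrite sqr_sqrtr ?ltW.
have [||H1 H2] := cubic_max_unit (y := s^-1 *: y) ee emax.
- by rewrite dotZl dotZr sE expr2 mulKf ?gt_eqF // mulVf ?gt_eqF.
- by rewrite dotZr ey mulr0.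
split.
  move/eqP: H1; rewrite dotZr mulf_eq0 invr_eq0 gt_eqF //= => /eqP.
  by [].
move: H2; rewrite -scalemxAl dotZl dotZr sE.
rewrite (_ : 2 * _ = (2 * dot (y *m K e) y) / s ^+ 2); last first.
  by field; rewrite gt_eqF.
by rewrite ler_pdivrMr // exprn_gt0.
Qed.

(** At a maximum [e] of the cubic form on the unit sphere, the Gauss equation
    makes [K e] act on the orthogonal complement by a root of a quadratic
    polynomial; the second order condition selects the smaller root, and the
    vanishing of the trace determines the eigenvalue in the direction [e]. *)
Lemma distinguished_direction : exists e nu, [/\ dot e e = 1, 0 < nu &
  K e = (n.+1%:R * nu) *: (e^T *m e) - nu%:M].
Proof.
have [e [ee emax]] := cubic_max_exists; pose lam := cub e.
have eK : e *m K e = lam *: e.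
  apply/eqP; rewrite -subr_eq0; apply/eqP/dot_eq0.
  set v := _ - _; have ve : dot e v = 0.
    by rewrite dotC /v dotDl dotNl dotZl ee mulr1 subrr.
  have [H _] := cubic_max_orth ee emax ve.
  by rewrite {1}/v dotDl dotNl dotZl ve mulr0 subr0.
pose d := Num.sqrt (lam ^+ 2 - 4 * mu).
have disc : 0 < lam ^+ 2 - 4 * mu.
  by rewrite ltr_wpDl ?sqr_ge0 // oppr_gt0 pmulr_rlt0.
have d2 : d ^+ 2 = lam ^+ 2 - 4 * mu.
  by rewrite sqr_sqrtr // ltW.
have d0 : 0 < d by rewrite sqrtr_gt0.
have dlam : lam < d.
  rewrite ltNge; apply/negP => dl; have : d ^+ 2 <= lam ^+ 2.
    by rewrite !expr2 ler_pM // ltW.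
  by rewrite d2 gerDl oppr_le0 pmulr_rge0 // leNgt mu0.
have perp y : dot e y = 0 -> dot e (y *m K e) = 0.
  by move=> ey; rewrite dotC dot_sym // eK dotZl ey mulr0.
(* The Gauss equation for the pair [e], [y], applied to [e]. *)
have quad y : dot e y = 0 -> lam *: (y *m K e) - y *m K e *m K e = mu *: y.
  move=> ey; have := congr1 (fun B => e *m B) (KK e y).
  rewrite mulmxBr !mulmxA eK (Ksym e y) -scalemxAl (Ksym e y) => ->.
  by rewrite -scalemxAr mulmxBr !mul_tr_row ee ey scale0r subr0 scale1r.
(* With [A = lam - 2 K_e], [quad] reads [(A - d) (A + d) = 0], and [A >= 0] on the
   complement of [e], so that [A + d] is injective there. *)
have Ky y : dot e y = 0 -> y *m K e = ((lam - d) / 2) *: y.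
  move=> ey; pose z := (lam - d) *: y - 2 *: (y *m K e).
  have ez : dot e z = 0.
    by rewrite /z dotDr -scaleNr !dotZr ey (perp _ ey) !mulr0 addr0.
  have zE : (lam + d) *: z - 2 *: (z *m K e) = 0.
    rewrite /z mulmxBl -!scalemxAl.
    have -> : y *m K e *m K e = lam *: (y *m K e) - mu *: y.
      by rewrite -(quad y ey) opprB addrC subrK.
    apply/rowP => i; rewrite !mxE.
    set a := y 0 i; set b := (\sum_j _).
    transitivity ((lam ^+ 2 - 4 * mu - d ^+ 2) * a); first by ring.
    by rewrite d2 subrr mul0r.
  have [_ Hz] := cubic_max_orth ee emax ez.
  have : dot ((lam + d) *: z - 2 *: (z *m K e)) z = 0 by rewrite zE dot0l.
  rewrite dotDl dotNl !dotZl => Hd.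
  have zz : dot z z = 0.
    by apply/le_anti; rewrite dot_ge0 andbT; have := dot_ge0 z; rewrite -/lam in Hz;
        nra.
  have : z = 0 by exact: dot_eq0.
  move=> /eqP; rewrite subr_eq0 => /eqP zz'.
  apply: (@scalerI _ _ 2) => //.
  by rewrite -zz' scalerA; congr (_ *: _); field.
pose nu := (d - lam) / 2; have nu0 : 0 < nu by rewrite divr_gt0 // subr_gt0.
have KE : K e = (lam + nu) *: (e^T *m e) - nu%:M.
  apply/row_matrixP => i; rewrite rowE [RHS]rowE.
  have [y [s [ey ->]]] := orth_split (delta_mx 0 i) ee.
  rewrite !mulmxDl -!scalemxAl (Ky y ey) eK mulmxBr mulmxBr -!scalemxAr !mul_tr_row.
  rewrite dotC ey ee !mul_mx_scalar; apply/rowP => j; rewrite !mxE /nu.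
  by field.
have lamE : lam = n%:R * nu.
  have := Ktr e; rewrite KE linearB linearZ /= trace_tr_row ee mxtrace_scalar mulr1.
  by rewrite mulrSr -mulr_natl; lra.
exists e, nu; split=> //; rewrite KE lamE; congr (_ *: _ - _).
by rewrite -natr1; ring.
Qed.

Section Derivative.
Context (L : 'rV[R]_n.+1 -> 'rV[R]_n.+1 -> 'M[R]_n.+1).
Context (LC : forall x y, L x y = L y x).
Context (LT : forall x y, (L x y)^T = L x y).
Context (Lsym : forall x y z, z *m L x y = y *m L x z).
Context (Ltr : forall x y, \tr (L x y) = 0).
Context (KL : forall x y z,
  L x y *m K z - K z *m L x y + (K y *m L x z - L x z *m K
    y) = 0).

(** The linearised Gauss equation, applied to a distinguished direction, expresses
    [L x e] through the single vector [e *m L x e]; its trace then kills the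
    component along [e], and the total symmetry of [L] does the rest. *)
Lemma linearised_vanish e nu : dot e e = 1 -> 0 < nu ->
  K e = (n.+1%:R * nu) *: (e^T *m e) - nu%:M -> forall x, L x e = 0.
Proof.
move=> ee nu0 KE.
have KeE y : dot e y = 0 -> y *m K e = - nu *: y.
  by move=> ey; rewrite KE mulmxBr -scalemxAr mul_tr_row (dotC y e) ey scale0r
    scaler0 sub0r mul_mx_scalar scaleNr.
have eK : e *m K e = (n%:R * nu) *: e.
  rewrite KE mulmxBr -scalemxAr mul_tr_row ee scale1r mul_mx_scalar -scalerBl.
  by congr (_ *: _); rewrite -natr1; ring.
pose a : R := n.+2%:R * nu.
have a0 : 0 < a by rewrite mulr_gt0.
have step x y : dot e y = 0 -> let w := e *m L x e in
    a *: (y *m L x e) = (n.+1%:R * nu * dot w y) *: e - w *m K y.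
  move=> ey w; have := congr1 (fun B => e *m B) (KL x y e).
  rewrite mulmx0 mulmxDr !mulmxBr !mulmxA (Lsym x y e) eK (Ksym e y) (KeE _ ey).
  rewrite -!scalemxAl (Lsym x y e) KE mulmxBr -scalemxAr mul_tr_row mul_mx_scalar.
  rewrite -/w => /rowP H; apply/rowP => i; move/(_ i): H; rewrite !mxE.
  have -> : dot (y *m L x e) e = dot w y by rewrite dot_sym // dotC -/w dotC.
  set u := (\sum_j _); set v := (\sum_j _) => H.
  rewrite /a -!natr1; rewrite -!natr1 in H; lra.
have tr x (w := e *m L x e) : dot w e = 0.
  pose w' := w - dot w e *: e.
  have ew' : dot e w' = 0.
    by rewrite /w' dotDr -scaleNr dotZr ee mulr1 (dotC w e) subrr.
  have wE : w = w' + dot w e *: e by rewrite /w' subrK.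
  have ME : a *: L x e = (n.+1%:R * nu) *: (w^T *m e) + (nu * dot w e)%:M - K w'
      + e^T *m (a *: w - (n.+1%:R * nu * dot w e) *: e
               - (nu * dot w e) *: e - nu *: w').
    apply/row_matrixP => i; rewrite rowE [RHS]rowE.
    have [y [s [ey ->]]] := orth_split (delta_mx 0 i) ee.
    rewrite -scalemxAr [in LHS]mulmxDl scalerDr (step x y ey) -/w -scalemxAl -/w.
    rewrite mulmxDr mulmxBr mulmxDr -scalemxAr !mul_tr_row mul_mx_scalar.
    rewrite {2}wE mulmxDl -scalemxAl (Ksym e y) (KeE _ ey).
    rewrite (mulmxDl _ _ (K w')) -scalemxAl (Ksym e w') (KeE _ ew') (Ksym y w').
    rewrite !dotDl !dotZl (dotC y w) (dotC y e) ey ee (dotC e w).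
    apply/rowP => j; rewrite !mxE; set u := (\sum_j _).
    ring.
  have := congr1 mxtrace ME.
  rewrite linearZ /= Ltr mulr0 linearD linearB linearD linearZ /= !trace_tr_row.
  rewrite Ktr mxtrace_scalar !dotDl !dotNl !dotZl ee (dotC w' e) ew' (dotC e w).
  rewrite -mulr_natl => H.
  have : (2 * n.+1%:R * nu) * dot w e = 0.
    by rewrite H /a -!natr1; ring.
  by move/eqP; rewrite !mulf_eq0 pnatr_eq0 pnatr_eq0 (gt_eqF nu0) /= => /eqP.
have Lee : L e e = 0.
  have w0 : e *m L e e = 0.
    pose w := e *m L e e; apply: dot_eq0.
    by rewrite -/w {1}/w (dot_sym _ _ (LT e e)) Lsym LC; exact: tr.
  have Hy y : dot e y = 0 -> y *m L e e = 0.
    move=> ey; have := step e y ey; rewrite /= w0 dot0l mulr0 scale0r mul0mx subrr.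
    by move=> /eqP; rewrite scaler_eq0 gt_eqF //= => /eqP.
  apply/row_matrixP => i; rewrite rowE row0.
  have [y [s [ey ->]]] := orth_split (delta_mx 0 i) ee.
  by rewrite mulmxDl -scalemxAl w0 scaler0 addr0 Hy.
move=> x; have w0 : e *m L x e = 0.
  by rewrite LC Lsym Lee mulmx0.
have Hy y : dot e y = 0 -> y *m L x e = 0.
  move=> ey; have := step x y ey; rewrite /= w0 dot0l mulr0 scale0r mul0mx subrr.
  by move=> /eqP; rewrite scaler_eq0 gt_eqF //= => /eqP.
apply/row_matrixP => i; rewrite rowE row0.
have [y [s [ey ->]]] := orth_split (delta_mx 0 i) ee.
by rewrite mulmxDl -scalemxAl w0 scaler0 addr0 Hy.
Qed.

End Derivative.
End Step.

(** Splitting off a distinguished direction [e] leaves a tensor [K] of the same kind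
    on the orthogonal complement of [e], with [mu - nu ^ 2] in place of [mu], to which
    induction on the dimension applies; [linearised_vanish] disposes of the components
    of [L] that involve [e]. *)
Theorem cubic_rigidity n : forall (mu : R) (K : 'rV[R]_n -> 'M[R]_n)
    (L : 'rV[R]_n -> 'rV[R]_n -> 'M[R]_n),
  mu < 0 ->
  (forall a x y, K (a *: x + y) = a *: K x + K y) ->
  (forall x y, x *m K y = y *m K x) ->
  (forall x, (K x)^T = K x) ->
  (forall x, \tr (K x) = 0) ->
  (forall x y, K x *m K y - K y *m K x = mu *: (x^T *m y - y^T *m x)) ->
  (forall z a x y, L z (a *: x + y) = a *: L z x + L z y) ->
  (forall x y, L x y = L y x) ->
  (forall x y, (L x y)^T = L x y) ->
  (forall x y z, z *m L x y = y *m L x z) ->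
  (forall x y, \tr (L x y) = 0) ->
  (forall x y z,
     L x y *m K z - K z *m L x y + (K y *m L x z - L x z *m K y) = 0) ->
  forall x y, L x y = 0.
Proof.
elim: n => [|n IHn] mu K L mu0 Klin Ksym KT Ktr KK Llin LC LT Lsym Ltr KL x y.
  by apply/matrixP => -[].
have [e [nu [ee nu0 KE]]] := distinguished_direction mu0 Klin Ksym KT Ktr KK.
have Le := linearised_vanish Ksym Ktr LC LT Lsym Ltr KL ee nu0 KE.
have [||||P [PP eP]] := @orthonormal_extend R n.+1 1%:M 1 e _ _ _ n.
- move=> v v0; rewrite mulmx1 -/(dot v v) lt_neqAle dot_ge0 andbT eq_sym.
  by apply: contra_neq v0; exact: dot_eq0.
- exact: trmx1.
- by rewrite mulmx1 [LHS]mx11_scalar -/(dot e e) ee.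
- by rewrite add1n.
rewrite mulmx1 in PP; rewrite mulmx1 in eP.
have Pe : P *m e^T = 0 by apply: trmx_inj; rewrite trmx_mul trmxK eP trmx0.
have PtP : P^T *m P = 1%:M - e^T *m e.
  have : row_mx e^T P^T *m col_mx e P = 1%:M.
    rewrite -tr_col_mx; apply: (mulmx1C (n := 1 + n)).
    rewrite tr_col_mx mul_col_row eP Pe PP [e *m e^T]mx11_scalar -/(dot e e) ee.
    by rewrite -scalar_mx_block.
  by rewrite mul_row_col => <-; rewrite addrAC subrr add0r.
have orth u : dot e (u *m P) = 0.
  by rewrite /dot trmx_mul mulmxA eP mul0mx mxE.
have eK u : e *m K (u *m P) = - nu *: (u *m P).
  rewrite Ksym KE mulmxBr -scalemxAr mul_tr_row dotC orth scale0r scaler0 sub0r.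
  by rewrite mul_mx_scalar scaleNr.
have eL u v : e *m L u v = 0 by rewrite Lsym Le mulmx0.
have Ke u : K (u *m P) *m e^T = - nu *: (u *m P)^T.
  by apply: trmx_inj; rewrite trmx_mul trmxK KT eK linearZ /= trmxK.
have Le' u v : L u v *m e^T = 0.
  by apply: trmx_inj; rewrite trmx_mul trmxK LT eL trmx0.
(* Compressing a product to the complement of [e] costs a rank one correction. *)
have cut (B C : 'M[R]_n.+1) : P *m B *m P^T *m (P *m C *m P^T) =
    P *m (B *m C - B *m e^T *m (e *m C)) *m P^T.
  by rewrite -!mulmxA (mulmxA P^T P) PtP !mulmxBl mul1mx !mulmxBr !mulmxA.
pose K' u := P *m K (u *m P) *m P^T.
pose L' u v := P *m L (u *m P) (v *m P) *m P^T.
have L'0 : forall u v, L' u v = 0.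
  apply: (IHn (mu - nu ^+ 2) K' L').
  - by have := sqr_ge0 nu; lra.
  - by move=> a u v; rewrite /K' mulmxDl -scalemxAl Klin mulmxDr mulmxDl -!scalemxAr
        -!scalemxAl.
  - by move=> u v; rewrite /K' !mulmxA Ksym.
  - by move=> u; rewrite /K' !trmx_mul trmxK KT mulmxA.
  - move=> u; rewrite /K' mxtrace_mulC mulmxA PtP mulmxBl mul1mx linearB /= Ktr.
    by rewrite -mulmxA eK -scalemxAr linearZ /= trace_tr_row dotC orth mulr0 subrr.
  - move=> u v; rewrite /K' !cut !Ke !eK -!scalemxAl -!scalemxAr !scalerA.
    have PX (w z : 'rV[R]_n) : P *m ((w *m P)^T *m (z *m P)) *m P^T = w^T *m z.
      by rewrite trmx_mul !mulmxA PP mul1mx -mulmxA PP mulmx1.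
    rewrite -mulmxBl -mulmxBr; set X := (u *m P)^T *m _; set Y := (v *m P)^T *m _.
    set B := K _ *m K _; set B' := K _ *m K _.
    have -> : B - (- nu * - nu) *: X - (B' - (- nu * - nu) *: Y) =
        (mu - nu ^+ 2) *: (X - Y).
      rewrite scalerBl -KK -/B -/B'; apply/matrixP => i j; rewrite !mxE.
      by set s := (\sum_l _); set s' := (\sum_l _); ring.
    by rewrite -scalemxAr -scalemxAl mulmxBr mulmxBl !PX.
  - by move=> w a u v;
        rewrite /L' mulmxDl -scalemxAl Llin mulmxDr mulmxDl -!scalemxAr -!scalemxAl.
  - by move=> u v; rewrite /L' LC.
  - by move=> u v; rewrite /L' !trmx_mul trmxK LT mulmxA.
  - by move=> u v w; rewrite /L' !mulmxA Lsym.
  - move=> u v; rewrite /L' mxtrace_mulC mulmxA PtP mulmxBl mul1mx linearB /= Ltr.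
    by rewrite -mulmxA eL mulmx0 linear0 subrr.
  - move=> u v w; rewrite /L' /K' !cut !eL !Le' !mulmx0 !mul0mx !subr0.
    by rewrite -!mulmxBl -!mulmxBr -mulmxDl -mulmxDr KL mulmx0 mul0mx.
have LPP u v : L (u *m P) (v *m P) = 0.
  have := L'0 u v; rewrite /L' => H.
  have -> : L (u *m P) (v *m P) =
      (P^T *m P + e^T *m e) *m L (u *m P) (v *m P) *m (P^T *m P + e^T *m e).
    by rewrite PtP subrK mul1mx mulmx1.
  rewrite mulmxDl -(mulmxA e^T) eL mulmx0 addr0 mulmxDr mulmxA.
  rewrite -!mulmxA (mulmxA _ e^T) Le' mul0mx !mulmx0 addr0.
  by rewrite (mulmxA _ P^T) (mulmxA P) (mulmxA P) H mul0mx mulmx0.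
have Lz u v : L u v = L u (v *m P^T *m P).
  rewrite -mulmxA PtP mulmxBr mulmx1 mul_tr_row.
  by rewrite addrC -scaleNr Llin Le scaler0 add0r.
by rewrite Lz LC Lz LPP.
Qed.

End Rigidity.

(** * Gradients *)
Section Metric.
Context {R : realType} {m : nat} {M : topologicalType} (A : set (chart R m M)).
Context (hM : smooth_manifold A) (g : @metric R M) (hg : riemannian_metric A g).
Implicit Types (k : chart R m M) (p q : M) (f h : M -> R) (X Y Z : @field R M).

Lemma metricC p v w : tangent A p v -> tangent A p w -> g p v w = g p w v.
Proof. by case: hg => _ + _ _; apply. Qed.

Lemma metric_lin p (a : R) u v w : tangent A p u -> tangent A p v -> tangent A p w ->
  g p (a *: u + v) w = a * g p u w + g p v w.
Proof. by case: hg => + _ _ _; apply. Qed.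

Lemma metric0 p w : tangent A p w -> g p 0 w = 0.
Proof.
move=> tw; have t0 := tangent0 hM p.
have := metric_lin 1 t0 t0 tw; rewrite scale1r addr0 mul1r => /eqP.
by rewrite -subr_eq subrr eq_sym => /eqP.
Qed.

Lemma metric_nondegenerate p v w : tangent A p v -> tangent A p w ->
  (forall u, tangent A p u -> g p v u = g p w u) -> v = w.
Proof.
move=> tv tw H; apply/eqP; rewrite -subr_eq0; apply/negPn/negP => vw0.
have td : tangent A p (v - w).
  by rewrite addrC -scaleN1r; exact: tangent_lin.
case: hg => _ _ pos _; have := pos p _ td vw0.
rewrite {1}addrC -{1}scaleN1r metric_lin // (H _ td) mulN1r.
by rewrite addrC subrr ltxx.
Qed.

Lemma tangent_sumv p (I : Type) (r : seq I) (P : pred I) (a : I -> R)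
    (u : I -> (M -> R) -> R) : (forall i, P i -> tangent A p (u i)) ->
  tangent A p (\sum_(i <- r | P i) a i *: u i).
Proof.
move=> tu; elim: r => [|i r IHr]; first by rewrite big_nil; exact: tangent0.
rewrite big_cons; case: ifP => // Pi; exact: (tangent_lin hM (a i) (tu i Pi) IHr).
Qed.

Lemma metric_sum p (I : Type) (r : seq I) (P : pred I) (a : I -> R)
    (u : I -> (M -> R) -> R) w : (forall i, P i -> tangent A p (u i)) ->
  tangent A p w ->
  g p (\sum_(i <- r | P i) a i *: u i) w = \sum_(i <- r | P i) a i * g p (u i) w.
Proof.
move=> tu tw; elim: r => [|i r IHr]; first by rewrite !big_nil metric0.
rewrite !big_cons; case: ifP => // Pi; rewrite metric_lin ?IHr //.
  exact: tu.
exact: tangent_sumv.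
Qed.

Definition gram k p : 'M[R]_m :=
  \matrix_(i, j) gfield g (coord_field A k i) (coord_field A k j) p.

Lemma tvec_sum k p (a : 'rV[R]_m) :
  tvec A k p a = \sum_i a 0 i *: coord_field A k i p.
Proof.
apply/funext => f; rewrite fct_sumE /coord_field /tvec; case: ifP => sf.
  apply: eq_bigr => i _; rewrite -[RHS]/(a 0 i * (if _ then _ else _)) sf.
  congr (_ * _); rewrite (bigD1 i) //= mxE !eqxx mul1r big1 ?addr0 // => l li.
  by rewrite mxE (negbTE li) andbF mul0r.
rewrite big1 // => i _; rewrite -[LHS]/(a 0 i * (if _ then _ else _)) sf.
by rewrite mulr0.
Qed.

Lemma metric_tvec k p (a b : 'rV[R]_m) : admissible A k -> cdom k p ->
  g p (tvec A k p a) (tvec A k p b) = (a *m gram k p *m b^T) 0 0.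
Proof.
move=> ka kp; rewrite !tvec_sum.
have tc i : tangent A p (coord_field A k i p) by exact: tangent_tvec.
rewrite metric_sum //; last by apply: tangent_sumv.
rewrite -mulmxA mxE; apply: eq_bigr => i _; congr (_ * _).
rewrite metricC //; last by apply: tangent_sumv.
rewrite metric_sum // mxE; apply: eq_bigr => j _.
by rewrite !mxE mulrC /gfield metricC.
Qed.

Lemma gram_sym k p : admissible A k -> cdom k p -> (gram k p)^T = gram k p.
Proof.
by move=> ka kp; apply/matrixP => i j; rewrite !mxE /gfield metricC //;
    exact: tangent_tvec.
Qed.

Lemma gram_pos k p (x : 'rV[R]_m) : admissible A k -> cdom k p -> x != 0 ->
  0 < (x *m gram k p *m x^T) 0 0.
Proof.
move=> ka kp x0; rewrite -metric_tvec //; case: hg => _ _ pos _; apply: pos.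
  exact: tangent_tvec.
apply: contra_neq x0 => x0; apply/rowP => i.
by rewrite -(tvec_coord hM x i ka kp) x0 mxE.
Qed.

Lemma gram_unit k p : admissible A k -> cdom k p -> gram k p \in unitmx.
Proof.
move=> ka kp; rewrite unitmxE unitfE; apply/negP => /det0P [x x0 xG].
by have := gram_pos ka kp x0; rewrite xG mul0mx mxE ltxx.
Qed.

Lemma smooth_at_det p n (F : M -> 'M[R]_n) :
  (forall i j, smooth_at A p (fun q => F q i j)) ->
  smooth_at A p (fun q => \det (F q)).
Proof.
move=> sF; rewrite /determinant; apply: smooth_at_sum => // s _.
apply: smooth_at_mul => //; first exact: smooth_at_cst.
by apply: smooth_at_prod.
Qed.

(** The differential of [h], with its index raised by the inverse Gram matrix. *)
Definition gradient_in k h p : (M -> R) -> R :=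
  tvec A k p ((\row_i partial i (h \o cinv k) (cfun k p)) *m invmx (gram k p)).

Lemma gradient_inP k h p v : admissible A k -> cdom k p -> smooth_at A p h ->
  tangent A p v -> g p (gradient_in k h p) v = v h.
Proof.
move=> ka kp sh tv; rewrite {1}(tangent_tvec_coord hM ka kp tv) metric_tvec //.
rewrite mulmxKV ?gram_unit // mxE (tangent_expand hM ka kp tv sh).
by apply: eq_bigr => i _; rewrite !mxE mulrC.
Qed.

(** The chart used at a point is chosen arbitrarily; nondegeneracy makes the gradient
    independent of it.  Cramer's rule makes the inverse Gram matrix smooth. *)
Lemma gradient_exists h : smooth_fun A h ->
  exists2 X, vector_field A X & forall p v, tangent A p v -> g p (X p) v = v h.
Proof.
move=> sh.
have [p|c cP] := @choice _ _ (fun p k => A k /\ cdom k p).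
  by have [k kA kp] := atlas_chart hM p; exists k.
exists (fun p => gradient_in (c p) h p); last first.
  move=> p v tv; have [kA kp] := cP p; apply: gradient_inP => //.
  exact: atlas_admissible.
split=> [p|k i kA p kp].
  have [kA kp] := cP p; apply: tangent_tvec => //; exact: atlas_admissible.
have ka := atlas_admissible hM kA.
have E q : cdom k q -> gradient_in (c q) h q = gradient_in k h q.
  move=> kq; have [cA cq] := cP q; have ca := atlas_admissible hM cA.
  apply: metric_nondegenerate; try exact: tangent_tvec.
  by move=> u tu; rewrite !gradient_inP.
have : smooth_at A p (fun q => \sum_j partial j (h \o cinv k) (cfun k q) *
    ((\det (gram k q))^-1 * cofactor (gram k q) i j)).
  have sg a b : smooth_at A p (fun q => gram k q a b).
    have [_ _ _ sm] := hg; apply: smooth_at_eq (sm k a b kA p kp) => //.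
    by apply: nearW => q; rewrite mxE.
  apply: smooth_at_sum => // j _; apply: smooth_at_mul => //.
    exact: smooth_at_partial.
  apply: smooth_at_mul => //.
    apply: smooth_at_inv => //; first exact: smooth_at_det.
    by rewrite -unitfE -unitmxE gram_unit.
  apply: smooth_at_mul => //; first exact: smooth_at_cst.
  apply: smooth_at_det => a b.
  apply: smooth_at_eq (sg (lift i a) (lift j b)) => //.
  by apply: nearW => q; rewrite !mxE.
apply: smooth_at_eq => //.
have : nbhs p (cdom k) by case: ka => -[okd _ _ _ _] _; exact: open_nbhs_nbhs.
apply: filterS => q kq; rewrite E // /gradient_in tvec_coord // mxE.
apply: eq_bigr => j _; rewrite mxE /invmx gram_unit // !mxE.
by [].
Qed.

End Metric.

(** * Tensoriality, Parseval frames and orthonormal frames *)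
Section Parseval.
Context {R : realType} {m : nat} {M : topologicalType} (A : set (chart R m M)).
Context (hM : smooth_manifold A) (g : @metric R M) (hg : riemannian_metric A g).
Implicit Types (k : chart R m M) (p q : M) (f h : M -> R) (X Y Z W : @field R M).

Local Notation VF X := (vector_field A X).
Local Notation SF f := (smooth_fun A f).
Local Notation G := (gfield g).

Lemma vector_field_tangent X p : VF X -> tangent A p (X p). Proof. by case. Qed.

Lemma smooth_fun_cst (a : R) : SF (cst a). Proof. by move=> p;
    exact: smooth_at_cst. Qed.

Lemma smooth_fun_add f h : SF f -> SF h -> SF (fun q => f q + h q).
Proof. by move=> sf sh p; exact: smooth_at_add. Qed.

Lemma smooth_fun_mul f h : SF f -> SF h -> SF (fun q => f q * h q).
Proof. by move=> sf sh p; exact: smooth_at_mul. Qed.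

Lemma smooth_fun_sum (I : Type) (r : seq I) (P : pred I) (F : I -> M -> R) :
  (forall i, P i -> SF (F i)) -> SF (fun q => \sum_(i <- r | P i) F i q).
Proof. by move=> sF p; apply: smooth_at_sum => // i /sF. Qed.

Lemma fscale1 X : fscale (cst 1) X = X.
Proof. by apply/funext => p; apply/funext => f; rewrite /fscale /= mul1r. Qed.

Lemma vector_field_add X Y : VF X -> VF Y -> VF (X + Y).
Proof.
by move=> vX vY; rewrite -(fscale1 X); apply: vector_field_lin => //;
    exact: smooth_fun_cst.
Qed.

Lemma vector_field_scale h X : SF h -> VF X -> VF (fscale h X).
Proof.
by move=> sh vX; rewrite -[fscale h X]addr0; apply: vector_field_lin => //;
    exact: (vector_field0 hM).
Qed.

Lemma vector_field_opp X : VF X -> VF (- X).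
Proof.
move=> vX; rewrite (_ : - X = fscale (cst (-1)) X);
    first exact/vector_field_scale/vX/smooth_fun_cst.
by apply/funext => p; apply/funext => f; rewrite /fscale /= mulN1r.
Qed.

Lemma vector_field_sub X Y : VF X -> VF Y -> VF (X - Y).
Proof. by move=> vX vY; apply: vector_field_add => //; exact: vector_field_opp. Qed.

Lemma vector_field_sum (I : Type) (r : seq I) (P : pred I) (F : I -> field) :
  (forall i, P i -> VF (F i)) -> VF (\sum_(i <- r | P i) F i).
Proof. by move=> vF; elim/big_ind : _ => //; [exact: (vector_field0 hM)
    | exact: vector_field_add]. Qed.

Lemma gfield_lin h X Y Z p : VF X -> VF Y -> VF Z ->
  G (fscale h X + Y) Z p = h p * G X Z p + G Y Z p.
Proof.
by move=> vX vY vZ; apply: (metric_lin hg (h p)); exact: vector_field_tangent.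
Qed.

Lemma gfield_sym X Y p : VF X -> VF Y -> G X Y p = G Y X p.
Proof. by move=> vX vY; apply: (metricC hg); exact: vector_field_tangent. Qed.

(** Linearity over the smooth functions; it makes [B X] depend only on the value of [X]
    at [p] ([tensorial_at]). *)
Definition tensorial p (B : field -> R) : Prop := forall h X Y, SF h -> VF X -> VF Y ->
  B (fscale h X + Y) = h p * B X + B Y.

Lemma tensorial0 p B : tensorial p B -> B 0 = 0.
Proof.
move=> tB; have := tB (cst 1) 0 0 (smooth_fun_cst 1) (vector_field0 hM)
    (vector_field0 hM).
by rewrite fscale1 addr0 mul1r => /eqP; rewrite -subr_eq subrr eq_sym => /eqP.
Qed.

Lemma tensorial_add p B X Y : tensorial p B -> VF X -> VF Y -> B (X + Y) = B X + B Y.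
Proof.
by move=> tB vX vY; rewrite -{1}(fscale1 X) tB ?mul1r //; exact: smooth_fun_cst.
Qed.

Lemma tensorial_scale p B h X : tensorial p B -> SF h -> VF X -> B (fscale h X)
    = h p * B X.
Proof.
move=> tB sh vX; rewrite -[fscale h X]addr0 tB ?(tensorial0 tB) ?addr0 //;
    exact: (vector_field0 hM).
Qed.

Lemma tensorial_opp p B X : tensorial p B -> VF X -> B (- X) = - B X.
Proof.
move=> tB vX; have := tensorial_add tB vX (vector_field_opp vX);
    rewrite subrr (tensorial0 tB).
by move=> /eqP; rewrite eq_sym addrC addr_eq0 => /eqP.
Qed.

Lemma tensorial_sub p B X Y : tensorial p B -> VF X -> VF Y -> B (X - Y) = B X - B Y.
Proof.
by move=> tB vX vY; rewrite (tensorial_add tB) ?(tensorial_opp tB) //;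
    exact: vector_field_opp.
Qed.

Lemma tensorial_sum p B (I : Type) (r : seq I) (P : pred I) (h : I -> M -> R)
    (F : I -> field) :
  tensorial p B -> (forall i, SF (h i)) -> (forall i, VF (F i)) ->
  B (\sum_(i <- r | P i) fscale (h i) (F i)) = \sum_(i <- r | P i) h i p * B (F i).
Proof.
move=> tB sh vF; elim: r => [|i r IHr]; first by rewrite !big_nil (tensorial0 tB).
rewrite !big_cons; case: ifP => // _; rewrite tB ?IHr //.
by apply: vector_field_sum => j _; exact: vector_field_scale.
Qed.

Lemma tensorial_gfield p X : VF X -> tensorial p (fun Y => G Y X p).
Proof. by move=> vX h Y Z sh vY vZ; exact: gfield_lin. Qed.

Lemma tensorial_gfieldr p X : VF X -> tensorial p (fun Y => G X Y p).
Proof.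
move=> vX h Y Z sh vY vZ; rewrite !(gfield_sym p vX) //; first exact: gfield_lin.
exact: vector_field_lin.
Qed.

Lemma gfield_inj X Y p : VF X -> VF Y -> (forall Z, VF Z -> G X Z p = G Y Z p) ->
  (forall v, tangent A p v -> exists2 Z, VF Z & Z p = v) -> X p = Y p.
Proof.
move=> vX vY H ext; apply: (metric_nondegenerate hM hg);
    try exact: vector_field_tangent.
by move=> u /ext [Z vZ <-]; exact: H.
Qed.

Context (N : nat) (eps : 'I_N -> R) (phi : 'I_N -> M -> R).
Context (sphi : forall a, SF (phi a)).
Context (gphi : forall p v w, tangent A p v -> tangent A p w ->
  g p v w = \sum_a eps a * (v (phi a) * w (phi a))).
Context (E : 'I_N -> @field R M) (vE : forall a, VF (E a)).
Context (Egrad : forall a p v, tangent A p v -> g p (E a p) v = v (phi a)).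

Lemma gfield_gradient X a p : VF X -> G X (E a) p = X p (phi a).
Proof. by move=> vX; rewrite gfield_sym //; apply: Egrad;
    exact: vector_field_tangent. Qed.

Lemma smooth_fun_phi X a : VF X -> SF (fun q => eps a * X q (phi a)).
Proof. by move=> vX; apply: smooth_fun_mul;
    [exact: smooth_fun_cst | exact: smooth_fderiv]. Qed.

(** The gradients of the components of an isometric embedding form a global
    Parseval frame, so that every vector field is a combination of finitely many
    fixed ones with smooth coefficients. *)
Lemma field_expand X : VF X ->
  X = \sum_a fscale (fun q => eps a * X q (phi a)) (E a).
Proof.
move=> vX; apply/funext => p; apply: (metric_nondegenerate hM hg).
- exact: vector_field_tangent.
- by apply: vector_field_tangent; apply: vector_field_sum => a _;
      apply: vector_field_scale => //; exact: smooth_fun_phi.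
move=> u tu; rewrite fct_sumE.
rewrite (gphi (vector_field_tangent p vX) tu).
rewrite -[X in g p X u]/(\sum_a (eps a * X p (phi a)) *: E a p).
rewrite (metric_sum hM hg) //; last by move=> a _; exact: vector_field_tangent.
by apply: eq_bigr => a _; rewrite Egrad // mulrA.
Qed.

Lemma tensorial_expand_parseval p B X : tensorial p B -> VF X ->
  B X = \sum_a eps a * G X (E a) p * B (E a).
Proof.
move=> tB vX; rewrite {1}(field_expand vX) (tensorial_sum _ _ tB) //.
  by apply: eq_bigr => a _; rewrite gfield_gradient.
by move=> a; exact: smooth_fun_phi.
Qed.

Lemma tensorial_at p B X Y : tensorial p B -> VF X -> VF Y -> X p = Y p -> B X = B Y.
Proof.
move=> tB vX vY XY; rewrite (tensorial_expand_parseval tB vX)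
    (tensorial_expand_parseval tB vY).
by apply: eq_bigr => a _; rewrite /gfield XY.
Qed.

(** Frames at a point are made of global vector fields; the Parseval frame, with constant
    coefficients, extends any tangent vector. *)
Lemma field_through p v : tangent A p v -> exists2 Z, VF Z & Z p = v.
Proof.
move=> tv; pose Z : @field R M := \sum_a fscale (cst (eps a * v (phi a))) (E a).
have vZ : VF Z by apply: vector_field_sum => a _; apply: vector_field_scale => //;
    exact: smooth_fun_cst.
exists Z => //; apply: (metric_nondegenerate hM hg (vector_field_tangent p vZ) tv).
move=> u tu; rewrite /Z fct_sumE.
rewrite -[X in g p X u]/(\sum_a (eps a * v (phi a)) *: E a p).
rewrite (metric_sum hM hg) //; last by move=> a _; exact: vector_field_tangent.
by rewrite gphi //; apply: eq_bigr => a _; rewrite Egrad // mulrA.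
Qed.

Lemma field_eq_at X Y p : VF X -> VF Y -> (forall Z, VF Z -> G X Z p = G Y Z p) ->
  X p = Y p.
Proof. by move=> vX vY H; apply: gfield_inj => // v; exact: field_through. Qed.

Lemma smooth_gfield X Y : VF X -> VF Y -> SF (G X Y).
Proof.
move=> vX vY; have : SF (fun q => \sum_a eps a * (X q (phi a) * Y q (phi a))).
  apply: smooth_fun_sum => a _; apply: smooth_fun_mul; first exact: smooth_fun_cst.
  by apply: smooth_fun_mul; exact: smooth_fderiv.
congr (SF _); apply/funext => q; rewrite /gfield gphi //; exact: vector_field_tangent.
Qed.

Lemma gfield_expandE X Y p : VF X -> VF Y ->
  G X Y p = \sum_a eps a * G X (E a) p * G Y (E a) p.
Proof.
move=> vX vY; rewrite (tensorial_expand_parseval (tensorial_gfield p vY) vX).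
by apply: eq_bigr => a _; rewrite (gfield_sym p vY).
Qed.

Definition orthonormal_at p (e : 'I_m -> @field R M) : Prop :=
  (forall i, VF (e i)) /\ (forall i j, G (e i) (e j) p = (i == j)%:R).

Lemma orthonormal_exists p : exists e, orthonormal_at p e.
Proof.
have [k kA kp] := atlas_chart hM p; have ka := atlas_admissible hM kA.
have [P PG] := orthonormal_rows (fun x => gram_pos hM hg ka kp) (gram_sym hM hg ka kp).
have [|e He] := @choice _ _ (fun i X => VF X /\ X p = tvec A k p (row i P)).
  move=> i; have [Z vZ ZE] := field_through (tangent_tvec hM (row i P) ka kp).
  by exists Z.
exists e; split=> [i|i j]; first by case: (He i).
rewrite /gfield; have [_ ->] := He i; have [_ ->] := He j.
rewrite (metric_tvec hM hg) // -row_mul.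
move/matrixP/(_ i j): PG; rewrite [in RHS]mxE => <-; rewrite !mxE.
by apply: eq_bigr => l _; rewrite !mxE.
Qed.

Lemma frame_orthonormal_at p : orthonormal_at p (frame A g p).
Proof.
have [e He] := orthonormal_exists p.
rewrite /frame; case: xgetP => [y -> //|H]; exfalso; exact: (H e).
Qed.

(** There are as many fields as the dimension, so the matrix identity expressing
    orthonormality can be commuted. *)
Lemma orthonormal_expand p e X : orthonormal_at p e -> VF X ->
  X p = \sum_i G X (e i) p *: e i p.
Proof.
move=> [ve oe] vX; have [k kA kp] := atlas_chart hM p.
have ka := atlas_admissible hM kA.
pose P := \matrix_(i, l) e i p (coord k l).
pose x := \row_l X p (coord k l).
have eP i : e i p = tvec A k p (row i P).
  rewrite (tangent_tvec_coord hM ka kp (vector_field_tangent p (ve i))).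
  by congr (tvec _ _ _ _); apply/rowP => l; rewrite !mxE.
have XE : X p = tvec A k p x by exact: (tangent_tvec_coord hM ka kp
    (vector_field_tangent p vX)).
have PG : P *m gram A g k p *m P^T = 1%:M.
  apply/matrixP => i j; rewrite !mxE -oe /gfield !eP (metric_tvec hM hg) //.
  by rewrite -row_mul !mxE; apply: eq_bigr => l _; rewrite !mxE.
apply: (tangent_ext hM ka kp (vector_field_tangent p vX)).
  by apply: (tangent_sumv hM) => i _; exact: vector_field_tangent.
move=> l; have xl : X p (coord k l) = x 0 l by rewrite mxE.
rewrite fct_sumE xl.
have GPP : gram A g k p *m P^T *m P = 1%:M by rewrite mulmx1C // mulmxA.
rewrite -[x]mulmx1 -GPP !mulmxA mxE; apply: eq_bigr => i _.
rewrite [P i l]mxE -[RHS]/(_ * _); congr (_ * _).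
rewrite /gfield XE eP (metric_tvec hM hg) // !mxE; apply: eq_bigr => j _.
by rewrite !mxE.
Qed.

Lemma tensorial_expand p e B X : orthonormal_at p e -> tensorial p B -> VF X ->
  B X = \sum_i G X (e i) p * B (e i).
Proof.
move=> oe tB vX; have [ve _] := oe.
pose X' : @field R M := \sum_i fscale (cst (G X (e i) p)) (e i).
have vX' : VF X' by apply: vector_field_sum => i _; apply: vector_field_scale => //;
    exact: smooth_fun_cst.
rewrite (tensorial_at tB vX vX').
  by rewrite (tensorial_sum _ _ tB) // => i; exact: smooth_fun_cst.
by rewrite (orthonormal_expand oe vX) /X' fct_sumE.
Qed.

Lemma gfield_expand p e X Y : orthonormal_at p e -> VF X -> VF Y ->
  G X Y p = \sum_i G X (e i) p * G Y (e i) p.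
Proof.
move=> oe vX vY; have [ve _] := oe.
rewrite (tensorial_expand oe (tensorial_gfield p vY) vX).
by apply: eq_bigr => i _; rewrite (gfield_sym p vY).
Qed.

Definition bitensorial p (B : field -> field -> R) : Prop :=
  (forall Y, VF Y -> tensorial p (fun X => B X Y)) /\
  (forall X, VF X -> tensorial p (B X)).

(** Expand one argument of [B (e i) (e i)] in the Parseval frame and sum over [i]
    first. *)
Lemma trace_expand p e B : orthonormal_at p e -> bitensorial p B ->
  \sum_i B (e i) (e i) = \sum_a eps a * B (E a) (E a).
Proof.
move=> oe [B1 B2]; have [ve _] := oe.
transitivity (\sum_i \sum_a eps a * (G (E a) (e i) p * B (e i) (E a))).
  apply: eq_bigr => i _; rewrite (tensorial_expand_parseval (B2 _ (ve i)) (ve i)).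
  by apply: eq_bigr => a _; rewrite (gfield_sym p (vE a)) // !mulrA.
rewrite exchange_big; apply: eq_bigr => a _ /=.
by rewrite -mulr_sumr -(tensorial_expand oe (B1 _ (vE a)) (vE a)).
Qed.

End Parseval.

(** * Gauss and Codazzi equations *)
Section Structure.
Context {R : realType} {m : nat} {M : topologicalType} (A : set (chart R m M)).
Context (hM : smooth_manifold A) (g : @metric R M) (hg : riemannian_metric A g).
Implicit Types (p q : M) (f h : M -> R) (X Y Z W V : @field R M).

Local Notation VF X := (vector_field A X).
Local Notation SF f := (smooth_fun A f).
Local Notation G := (gfield g).
Local Notation tensorial := (tensorial A).

Section Connection.
Context (D : @connection R M) (affD : affine_connection A D).

Lemma vector_field_connection X Y : VF X -> VF Y -> VF (D X Y).
Proof. by case: affD => + _ _ _ _; apply. Qed.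

Lemma connection_linl h X X' Y : SF h -> VF X -> VF X' -> VF Y ->
  D (fscale h X + X') Y = fscale h (D X Y) + D X' Y.
Proof.
by move=> sh vX vX' vY; case: affD => _ Da Ds _ _; rewrite Da ?Ds //;
    exact: vector_field_scale.
Qed.

Lemma connection_linr h X Y Y' : SF h -> VF X -> VF Y -> VF Y' ->
  D X (fscale h Y + Y') = fscale (fderiv X h) Y + (fscale h (D X Y) + D X Y').
Proof.
move=> sh vX vY vY'; case: affD => _ _ _ Da Ds.
by rewrite Da ?Ds ?addrA //; exact: vector_field_scale.
Qed.

Lemma tensorial_connection p Y Z : VF Y -> VF Z -> tensorial p (fun X => G (D X Y) Z p).
Proof.
move=> vY vZ h X X' sh vX vX'; rewrite connection_linl //.
by rewrite (gfield_lin hg) //; exact: vector_field_connection.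
Qed.

Lemma torsion_act X Y f p : torsion_free A D -> VF X -> VF Y -> SF f ->
  X p (fderiv Y f) - Y p (fderiv X f) = D X Y p f - D Y X p f.
Proof.
move=> torD vX vY sf; have := congr1 (fun V : @field R M => V p f) (torD X Y vX vY).
by rewrite /lie asboolT => // <-.
Qed.

End Connection.

Context (D Dg : @connection R M).
Context (hstat : statistical_manifold A g D) (hDg : levi_civita A g Dg).

Let affD : affine_connection A D. Proof. by case: hstat. Qed.
Let torD : torsion_free A D. Proof. by case: hstat. Qed.
Let affg : affine_connection A Dg. Proof. by case: hDg. Qed.
Let torg : torsion_free A Dg. Proof. by case: hDg. Qed.

Local Notation VFD := (vector_field_connection affD).
Local Notation VFg := (vector_field_connection affg).

Lemma metric_compatible X Y Z p : VF X -> VF Y -> VF Z ->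
  X p (G Y Z) = G (Dg X Y) Z p + G Y (Dg X Z) p.
Proof.
move=> vX vY vZ; case: hDg => _ _ /(_ X Y Z p vX vY vZ); rewrite /cov_metric.
by move=> /eqP; rewrite subr_eq0 subr_eq addrC => /eqP.
Qed.

Local Notation K := (difference D Dg).
Definition cubic_form X Y Z p : R := G (K X Y) Z p.
Local Notation C := cubic_form.

Lemma vector_field_difference X Y : VF X -> VF Y -> VF (K X Y).
Proof. by move=> vX vY; apply: vector_field_sub => //; [exact: VFD | exact: VFg]. Qed.

Lemma connection_split X Y : D X Y = Dg X Y + K X Y.
Proof. by rewrite /difference addrC subrK. Qed.

Lemma difference_sym X Y : VF X -> VF Y -> K X Y = K Y X.
Proof.
move=> vX vY; have E : D X Y - D Y X = Dg X Y - Dg Y X by rewrite torD ?torg.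
rewrite /difference -[D X Y](subrK (D Y X)) E.
by rewrite addrAC [Dg X Y - _]addrC addrK addrC.
Qed.

Lemma difference_linl h X X' Y : SF h -> VF X -> VF X' -> VF Y ->
  K (fscale h X + X') Y = fscale h (K X Y) + K X' Y.
Proof.
move=> sh vX vX' vY; rewrite /difference (connection_linl affD)
    // (connection_linl affg) //.
rewrite opprD addrACA; congr (_ + _).
by apply/funext => p; apply/funext => f; rewrite /fscale -[LHS]/(_ - _) -mulrBr.
Qed.

Lemma cubic_form_sym12 X Y Z : VF X -> VF Y -> C X Y Z = C Y X Z.
Proof. by move=> vX vY; rewrite /C difference_sym. Qed.

(** The Codazzi equation of the statistical structure is the total symmetry of
    the cubic form. *)
Lemma cubic_form_sym13 X Y Z : VF X -> VF Y -> VF Z -> C X Y Z = C Z Y X.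
Proof.
move=> vX vY vZ; apply/funext => p.
have cov U V W : VF U -> VF V -> VF W ->
    cov_metric D g U V W p = - (C U V W p + C U W V p).
  move=> vU vV vW; rewrite /cov_metric (metric_compatible p vU vV vW) /C /difference.
  have E S V' W' : VF V' -> VF W' -> VF S -> G (D V' W' - Dg V' W') S p
      = G (D V' W') S p - G (Dg V' W') S p.
    by move=> ? ? ?; rewrite (tensorial_sub hM (tensorial_gfield hg p _)) //;
        [exact: VFD|exact: VFg].
  rewrite (gfield_sym hg p vV (VFg vU vW)) (gfield_sym hg p vV (VFD vU vW)) !E //.
  ring.
have [_ _ _ cod] := hstat.
have := cod X Z Y p vX vZ vY; rewrite !cov // (cubic_form_sym12 _ vX vZ); lra.
Qed.

Lemma cubic_form_sym23 X Y Z : VF X -> VF Y -> VF Z -> C X Y Z = C X Z Y.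
Proof.
by move=> vX vY vZ; rewrite (cubic_form_sym12 Z vX vY) (cubic_form_sym13 vY vX vZ)
    (cubic_form_sym12 Y vZ vX).
Qed.

Context (N : nat) (eps : 'I_N -> R) (phi : 'I_N -> M -> R).
Context (sphi : forall a, SF (phi a)).
Context (gphi : forall p v w, tangent A p v -> tangent A p w ->
  g p v w = \sum_a eps a * (v (phi a) * w (phi a))).
Context (E : 'I_N -> @field R M) (vE : forall a, VF (E a)).
Context (Egrad : forall a p v, tangent A p v -> g p (E a p) v = v (phi a)).

Lemma smooth_inner X Y : VF X -> VF Y -> SF (G X Y).
Proof. exact: (smooth_gfield hM sphi gphi). Qed.

Lemma smooth_cubic_form X Y Z : VF X -> VF Y -> VF Z -> SF (C X Y Z).
Proof. by move=> vX vY vZ; apply: smooth_inner => //;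
    exact: vector_field_difference. Qed.

Lemma cubic_form_lin1 h X X' Y Z p : SF h -> VF X -> VF X' -> VF Y -> VF Z ->
  C (fscale h X + X') Y Z p = h p * C X Y Z p + C X' Y Z p.
Proof.
move=> sh vX vX' vY vZ; rewrite /C difference_linl //.
by rewrite (gfield_lin hg) //; exact: vector_field_difference.
Qed.

Lemma tensorial_cubic_form1 p Y Z : VF Y -> VF Z -> tensorial p (fun X => C X Y Z p).
Proof. by move=> vY vZ h X X' sh vX vX'; exact: cubic_form_lin1. Qed.

Lemma tensorial_cubic_form2 p X Z : VF X -> VF Z -> tensorial p (fun Y => C X Y Z p).
Proof.
move=> vX vZ h Y Y' sh vY vY'; rewrite !(cubic_form_sym12 Z vX) //;
    first exact: cubic_form_lin1.
exact: (vector_field_lin hM).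
Qed.

Lemma tensorial_cubic_form3 p X Y : VF X -> VF Y -> tensorial p (C X Y ^~ p).
Proof. by move=> vX vY; apply: (tensorial_gfieldr hM hg);
    exact: vector_field_difference. Qed.

Lemma tangent_act X f h p : VF X -> SF f -> SF h ->
  X p (fun q => f q + h q) = X p f + X p h.
Proof. by move=> [tX _] sf sh; exact: (tangent_add hM). Qed.

Lemma tangent_actM X f h p : VF X -> SF f -> SF h ->
  X p (fun q => f q * h q) = f p * X p h + h p * X p f.
Proof. by move=> [tX _] sf sh; exact: (tangent_mul hM). Qed.

Definition cubic_deriv X Y Z W p : R :=
  X p (C Y Z W) - C (Dg X Y) Z W p - C Y (Dg X Z) W p - C Y Z (Dg X W) p.
Local Notation DC := cubic_deriv.

Lemma cubic_deriv_sym23 X Y Z W p : VF X -> VF Y -> VF Z -> VF W ->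
  DC X Y Z W p = DC X Z Y W p.
Proof.
move=> vX vY vZ vW; rewrite /DC (cubic_form_sym12 W vY vZ)
    (cubic_form_sym12 W (VFg vX vY) vZ).
by rewrite (cubic_form_sym12 W vY (VFg vX vZ)) (cubic_form_sym12 _ vY vZ); ring.
Qed.

Lemma cubic_deriv_sym34 X Y Z W p : VF X -> VF Y -> VF Z -> VF W ->
  DC X Y Z W p = DC X Y W Z p.
Proof.
move=> vX vY vZ vW; rewrite /DC (cubic_form_sym23 vY vZ vW)
    (cubic_form_sym23 (VFg vX vY) vZ vW).
by rewrite (cubic_form_sym23 vY (VFg vX vZ) vW) (cubic_form_sym23 vY vZ (VFg vX vW));
    ring.
Qed.

Lemma tensorial_cubic_deriv1 p Y Z W : VF Y -> VF Z -> VF W ->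
    tensorial p (fun X => DC X Y Z W p).
Proof.
move=> vY vZ vW h X X' sh vX vX'; rewrite /DC.
rewrite !(connection_linl affg) // (@tensorial_cubic_form1 p _ _ vZ vW) //;
    try exact: VFg.
rewrite (@tensorial_cubic_form2 p _ _ vY vW) //; try exact: VFg.
rewrite (@tensorial_cubic_form3 p _ _ vY vZ) //; try exact: VFg.
rewrite -[(fscale h X + X') p _]/(h p * X p _ + X' p _).
ring.
Qed.

Lemma tensorial_cubic_deriv2 p X Z W : VF X -> VF Z -> VF W ->
    tensorial p (fun Y => DC X Y Z W p).
Proof.
move=> vX vZ vW h Y Y' sh vY vY'; rewrite /DC.
have -> : C (fscale h Y + Y') Z W = fun q => h q * C Y Z W q + C Y' Z W q.
  by apply/funext => q; exact: cubic_form_lin1.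
have sC := smooth_cubic_form vY vZ vW; have sC' := smooth_cubic_form vY' vZ vW.
have shC : SF (fun q => h q * C Y Z W q) by exact: smooth_fun_mul.
rewrite (tangent_act p vX shC sC') (tangent_actM p vX sh sC).
have vh : VF (fscale h (Dg X Y) + Dg X Y').
  by apply: (vector_field_lin hM) => //; exact: VFg.
rewrite (connection_linr affg) // !(cubic_form_lin1 p) //; try exact: VFg.
  by rewrite /fderiv; ring.
exact: (smooth_fderiv hM).
Qed.

Definition riemann X Y Z W p : R := G (curvature A Dg X Y Z) W p.
Local Notation Rm := riemann.

Lemma vector_field_lie X Y : VF X -> VF Y -> VF (lie A X Y).
Proof. by move=> vX vY; rewrite -torg //; apply: vector_field_sub => //;
    exact: VFg. Qed.

Lemma vector_field_curvature X Y Z : VF X -> VF Y -> VF Z -> VF (curvature A Dg X Y Z).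
Proof.
move=> vX vY vZ; rewrite /curvature.
apply: (vector_field_sub hM); last by apply: VFg => //; exact: vector_field_lie.
by apply: (vector_field_sub hM); apply: VFg => //; exact: VFg.
Qed.

Lemma gfield_levi_civita X V Z p : VF X -> VF V -> VF Z ->
  G (Dg X V) Z p = X p (G V Z) - G V (Dg X Z) p.
Proof. by move=> vX vV vZ; rewrite (metric_compatible p vX vV vZ) addrK. Qed.

Lemma riemannE X Y Z W p : VF X -> VF Y -> VF Z -> VF W ->
  Rm X Y Z W p = X p (G (Dg Y Z) W) - G (Dg Y Z) (Dg X W) p
    - (Y p (G (Dg X Z) W) - G (Dg X Z) (Dg Y W) p)
    - (G (Dg (Dg X Y) Z) W p - G (Dg (Dg Y X) Z) W p).
Proof.
move=> vX vY vZ vW; rewrite /Rm /curvature -torg //.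
have tW := tensorial_gfield hg p vW.
rewrite !(tensorial_sub hM tW)
    ?(tensorial_sub hM (@tensorial_connection _ affg p _ _ vZ vW)) //;
  rewrite -?(gfield_levi_civita _ vX) -?(gfield_levi_civita _ vY) //; do ?[exact: VFg];
  do ?[apply: (vector_field_sub hM)]; do ?[apply: VFg => //]; do ?[exact: VFg].
  by apply: (vector_field_sub hM); exact: VFg.
Qed.

(** Both second covariant derivatives act on the function [g(Z, W)], where the
    commutator is the Lie bracket. *)
Lemma riemann_skew X Y Z W p : VF X -> VF Y -> VF Z -> VF W ->
  Rm X Y Z W p = - Rm X Y W Z p.
Proof.
move=> vX vY vZ vW; rewrite !riemannE //.
have act U V : VF U -> VF V ->
    U p (G (Dg V Z) W) + U p (G (Dg V W) Z) = U p (fderiv V (G Z W)).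
  move=> vU vV; rewrite -tangent_act //; do ?by apply: smooth_inner => //; exact: VFg.
  congr (U p _); apply/funext => q; rewrite /fderiv (metric_compatible q vV vZ vW).
  by rewrite (gfield_sym hg q vZ (VFg vV vW)).
have := torsion_act p torg vX vY (smooth_inner vZ vW).
rewrite -!act // (metric_compatible p (VFg vX vY) vZ vW)
    (metric_compatible p (VFg vY vX) vZ vW).
rewrite (gfield_sym hg p vZ (VFg (VFg vX vY) vW)) (gfield_sym hg p vZ (VFg (VFg vY vX)
    vW)).
rewrite (gfield_sym hg p (VFg vY vZ) (VFg vX vW)) (gfield_sym hg p (VFg vX vZ)
    (VFg vY vW)).
lra.
Qed.

Lemma gfield_connection_split X V W p : VF X -> VF V -> VF W ->
  G (D X V) W p = G (Dg X V) W p + C X V W p.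
Proof.
by move=> vX vV vW; rewrite connection_split (tensorial_add hM (tensorial_gfield hg p
    vW)) //;
  [exact: VFg | exact: vector_field_difference].
Qed.

(** By the symmetry of the cubic form this is [g([K_X, K_Y] Z, W)]. *)
Definition gauss_term X Y Z W p : R := G (K Y Z) (K X W) p - G (K X Z) (K Y W) p.
Local Notation KK := gauss_term.

Lemma cubic_form_difference X Y Z W p : VF X -> VF Y -> VF Z -> VF W ->
  C X (K Y Z) W p = G (K Y Z) (K X W) p.
Proof.
move=> vX vY vZ vW; have vK := vector_field_difference vY vZ;
    rewrite (cubic_form_sym23 vX vK vW).
by rewrite /C (gfield_sym hg) //; exact: vector_field_difference.
Qed.

(** Expand [D = Dg + K]; the terms with one derivative of [K] assemble to the covariant
    derivative of the cubic form because [Dg] is torsion-free. *)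
Lemma curvatureD X Y Z W p : VF X -> VF Y -> VF Z -> VF W ->
  G (curvature A D X Y Z) W p =
  Rm X Y Z W p + (DC X Y Z W p - DC Y X Z W p) + KK X Y Z W p.
Proof.
move=> vX vY vZ vW; have tW := tensorial_gfield hg p vW.
have part U V : VF U -> VF V -> G (D U (D V Z)) W p =
    U p (G (Dg V Z) W) + U p (C V Z W) - G (Dg V Z) (Dg U W) p - C V Z (Dg U W) p
    + C U (Dg V Z) W p + G (K V Z) (K U W) p.
  move=> vU vV; have vVZ := VFg vV vZ; have vKZ := vector_field_difference vV vZ.
  rewrite gfield_connection_split //; last exact: VFD.
  rewrite (gfield_levi_civita p vU (VFD vV vZ) vW)
      (gfield_connection_split p vV vZ (VFg vU vW)).
  have -> : G (D V Z) W = fun q => G (Dg V Z) W q + C V Z W q.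
    by apply/funext => q; exact: gfield_connection_split.
  rewrite (tangent_act p vU (smooth_inner vVZ vW) (smooth_cubic_form vV vZ vW)).
  rewrite [C U (D V Z) W p](_ : _ = C U (Dg V Z) W p + C U (K V Z) W p); last first.
    by rewrite connection_split (tensorial_add hM (@tensorial_cubic_form2 p _ _ vU vW)).
  rewrite cubic_form_difference //; ring.
have vXY := VFg vX vY; have vYX := VFg vY vX.
have lieE : G (D (lie A X Y) Z) W p =
    G (Dg (Dg X Y) Z) W p - G (Dg (Dg Y X) Z) W p
    + (C (Dg X Y) Z W p - C (Dg Y X) Z W p).
  rewrite gfield_connection_split //; last exact: vector_field_lie.
  rewrite -torg // (tensorial_sub hM (@tensorial_connection _ affg p _ _ vZ vW)) //.
  by rewrite (tensorial_sub hM (@tensorial_cubic_form1 p _ _ vZ vW)).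
have vDXY := VFD vX (VFD vY vZ); have vDYX := VFD vY (VFD vX vZ).
have vL := VFD (vector_field_lie vX vY) vZ.
rewrite /curvature (tensorial_sub hM tW (vector_field_sub hM vDXY vDYX) vL).
rewrite (tensorial_sub hM tW vDXY vDYX) !part // lieE riemannE // /DC /KK; ring.
Qed.

Context (lambda : R) (hlambda : constant_curvature A g D lambda).

Lemma curvature_split X Y Z W p : VF X -> VF Y -> VF Z -> VF W ->
  Rm X Y Z W p + (DC X Y Z W p - DC Y X Z W p) + KK X Y Z W p =
  lambda * (G Y Z p * G X W p - G X Z p * G Y W p).
Proof.
move=> vX vY vZ vW; rewrite -curvatureD // hlambda //.
have tW := tensorial_gfield hg p vW.
have -> : lambda *: (fscale (G Y Z) X - fscale (G X Z) Y) =
    fscale (fun q => lambda * G Y Z q) X + fscale (fun q => - lambda * G X Z q) Y.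
  apply/funext => q; apply/funext => f; rewrite /fscale.
  rewrite -[LHS]/(lambda * (G Y Z q * X q f - G X Z q * Y q f)).
  by rewrite -[RHS]/(lambda * G Y Z q * X q f + - lambda * G X Z q * Y q f); ring.
have s1 : SF (fun q => lambda * G Y Z q) by apply: smooth_fun_mul => //;
    [exact: (smooth_fun_cst hM)|exact: smooth_inner].
have s2 : SF (fun q => - lambda * G X Z q) by apply: smooth_fun_mul => //;
    [exact: (smooth_fun_cst hM)|exact: smooth_inner].
rewrite tW //; last exact: (vector_field_scale hM).
by rewrite (tensorial_scale hM tW) //; ring.
Qed.

(** The symmetric part (in the last two arguments) of the curvature identity is
    the Codazzi equation, its skew part the Gauss equation. *)
Lemma codazzi_equation X Y Z W p : VF X -> VF Y -> VF Z -> VF W ->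
  DC X Y Z W p = DC Y X Z W p.
Proof.
move=> vX vY vZ vW.
have H1 := curvature_split p vX vY vZ vW; have H2 := curvature_split p vX vY vW vZ.
move: H1 H2; rewrite (riemann_skew p vX vY vZ vW) /KK.
rewrite (cubic_deriv_sym34 p vX vY vW vZ) (cubic_deriv_sym34 p vY vX vW vZ).
rewrite (gfield_sym hg p (vector_field_difference vY vW)
    (vector_field_difference vX vZ)) (gfield_sym hg p (vector_field_difference vX vW)
    (vector_field_difference vY vZ)).
lra.
Qed.

Lemma gauss_equation X Y Z W p : VF X -> VF Y -> VF Z -> VF W ->
  Rm X Y Z W p + KK X Y Z W p = lambda * (G Y Z p * G X W p - G X Z p * G Y W p).
Proof.
move=> vX vY vZ vW; rewrite -curvature_split // (codazzi_equation p vX vY vZ vW) subrr.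
by rewrite addr0.
Qed.

Context (c : R) (hc : constant_sectional_curvature A g Dg c).

(** The deviation of the curvature of [g] from constant curvature [c], rewritten by the
    Gauss equation; in this form it is visibly tensorial with the symmetries of a
    curvature tensor. *)
Definition sectional_defect X Y Z W p : R :=
  (lambda - c) * (G Y Z p * G X W p - G X Z p * G Y W p) - KK X Y Z W p.
Local Notation Edev := sectional_defect.

Lemma tensorial_sectional_defect p Y Z W : VF Y -> VF Z -> VF W ->
    tensorial p (fun X => Edev X Y Z W p).
Proof.
move=> vY vZ vW h X X' sh vX vX'.
have KE V : VF V -> KK V Y Z W p = C V W (K Y Z) p - C V Z (K Y W) p.
  by move=> vV; rewrite /KK (gfield_sym hg p (vector_field_difference vY vZ)
      (vector_field_difference vV vW)).
have vhX : VF (fscale h X + X') by exact: (vector_field_lin hM).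
rewrite /Edev !KE // !(cubic_form_lin1 p) //; do ?[exact: vector_field_difference].
by rewrite !(gfield_lin hg) //; ring.
Qed.

Lemma sectional_defect_skew12 X Y Z W p : Edev X Y Z W p = - Edev Y X Z W p.
Proof. by rewrite /Edev /KK; ring. Qed.

Lemma sectional_defect_pair X Y Z W p : VF X -> VF Y -> VF Z -> VF W ->
  Edev X Y Z W p = Edev Z W X Y p.
Proof.
move=> vX vY vZ vW; rewrite /Edev /KK (difference_sym vW vX) (difference_sym vZ vY)
    (difference_sym vZ vX).
rewrite (difference_sym vW vY) (gfield_sym hg p (vector_field_difference vX vW)
    (vector_field_difference vY vZ)).
rewrite (gfield_sym hg p vW vX) (gfield_sym hg p vZ vY) (gfield_sym hg p vZ vX)
    (gfield_sym hg p vW vY).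
ring.
Qed.

Lemma sectional_defect_bianchi X Y Z W p : VF X -> VF Y -> VF Z -> VF W ->
  Edev X Y Z W p + Edev Y Z X W p + Edev Z X Y W p = 0.
Proof.
move=> vX vY vZ vW; rewrite /Edev /KK (difference_sym vY vX) (difference_sym vZ vX)
    (difference_sym vZ vY).
by rewrite (gfield_sym hg p vY vX) (gfield_sym hg p vZ vX) (gfield_sym hg p vZ vY);
    ring.
Qed.

Lemma gfield_eq0 X p : VF X -> G X X p = 0 -> X p = 0.
Proof.
move=> vX X0; apply/eqP/negPn/negP => Xp; have [_ _ pos _] := hg.
by have := pos p (X p) (vector_field_tangent p vX) Xp; rewrite -/(G X X p) X0 ltxx.
Qed.

(** For independent vectors this is the hypothesis on sectional curvatures; for dependent
    ones both terms vanish by skewness. *)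
Lemma sectional_defect_diagonal X Y p : VF X -> VF Y -> Edev X Y Y X p = 0.
Proof.
move=> vX vY.
have vanish Z U V W : VF Z -> VF U -> VF V -> VF W -> Z p = 0 -> Edev Z U V W p = 0.
  move=> vZ vU vV vW Z0.
  rewrite (tensorial_at hM hg sphi gphi vE Egrad (@tensorial_sectional_defect p _ _ _
      vU vV vW) vZ (vector_field0 hM)) //.
  exact: (tensorial0 hM (@tensorial_sectional_defect p _ _ _ vU vV vW)).
have [Y0|Y0] := eqVneq (G Y Y p) 0.
  by rewrite sectional_defect_skew12 vanish ?oppr0 //; exact: gfield_eq0.
have [area|area] := eqVneq (G X X p * G Y Y p - G X Y p ^+ 2) 0; last first.
  have H : Rm X Y Y X p = c * (G X X p * G Y Y p - G X Y p ^+ 2).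
    by rewrite -[in RHS](hc vX vY area) divfK.
  have := gauss_equation p vX vY vY vX; rewrite /Edev H (gfield_sym hg p vY vX); lra.
(* Equality in Cauchy-Schwarz: [X - al Y] vanishes at [p]. *)
pose al := G X Y p / G Y Y p.
pose Z : @field R M := fscale (cst (- al)) Y + X.
have vZ : VF Z by apply: (vector_field_lin hM) => //; exact: (smooth_fun_cst hM).
have Z0 : Z p = 0.
  have GZ V : VF V -> G Z V p = - al * G Y V p + G X V p.
    by move=> vV; rewrite (gfield_lin hg) //; exact: (smooth_fun_cst hM).
  apply: gfield_eq0 => //; rewrite GZ // (gfield_sym hg p vY vZ)
      (gfield_sym hg p vX vZ) !GZ //.
  rewrite (gfield_sym hg p vY vX) /al.
  apply: (mulIf Y0); rewrite mul0r -area; field.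
  exact: Y0.
have := vanish Z Y Y X vZ vY vY vX Z0.
rewrite /Z (@tensorial_sectional_defect p _ _ _ vY vY vX (cst (- al))
    Y X (smooth_fun_cst hM _) vY vX).
have -> : Edev Y Y Y X p = 0 by have := sectional_defect_skew12 Y Y Y X p; lra.
by rewrite mulr0 add0r.
Qed.

(** Polarisation: an algebraic curvature tensor is determined by its sectional
    curvatures. *)
Lemma sectional_defect0 X Y Z W p : VF X -> VF Y -> VF Z -> VF W -> Edev X Y Z W p = 0.
Proof.
move: X Y Z W.
have add1 X X' Y Z W : VF X -> VF X' -> VF Y -> VF Z -> VF W ->
    Edev (X + X') Y Z W p = Edev X Y Z W p + Edev X' Y Z W p.
  by move=> vX vX' vY vZ vW;
      exact: (tensorial_add hM (@tensorial_sectional_defect p _ _ _ vY vZ vW)).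
have add2 X X' Y Z W : VF X -> VF X' -> VF Y -> VF Z -> VF W ->
    Edev Y (X + X') Z W p = Edev Y X Z W p + Edev Y X' Z W p.
  move=> vX vX' vY vZ vW; rewrite !(sectional_defect_skew12 Y) add1 // opprD //.
have add3 X X' Y Z W : VF X -> VF X' -> VF Y -> VF Z -> VF W ->
    Edev Y Z (X + X') W p = Edev Y Z X W p + Edev Y Z X' W p.
  move=> vX vX' vY vZ vW; have vXX := vector_field_add hM vX vX'.
  by rewrite (sectional_defect_pair p vY vZ vXX vW)
      add1 // !(sectional_defect_pair p vY vZ _ vW).
have add4 X X' Y Z W : VF X -> VF X' -> VF Y -> VF Z -> VF W ->
    Edev Y Z W (X + X') p = Edev Y Z W X p + Edev Y Z W X' p.
  move=> vX vX' vY vZ vW; have vXX := vector_field_add hM vX vX'.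
  by rewrite (sectional_defect_pair p vY vZ vW vXX)
      add2 // !(sectional_defect_pair p vY vZ vW).
have P1 X Y Z : VF X -> VF Y -> VF Z -> Edev X Y Y Z p = 0.
  move=> vX vY vZ; have vXZ := vector_field_add hM vX vZ.
  have := sectional_defect_diagonal p vXZ vY; rewrite add1 // !add4 //.
  rewrite !sectional_defect_diagonal //.
  have H1 := sectional_defect_pair p vZ vY vY vX; have H2 :=
      sectional_defect_skew12 Y X Z Y p.
  have H3 := sectional_defect_pair p vX vY vZ vY; have H4 :=
      sectional_defect_skew12 Z Y X Y p.
  have H5 := sectional_defect_pair p vY vZ vX vY; lra.
have P2 X Y Z W : VF X -> VF Y -> VF Z -> VF W -> Edev X Y Z W p = - Edev X Z Y W p.
  move=> vX vY vZ vW; have vYZ := vector_field_add hM vY vZ.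
  have := P1 X (Y + Z) W vX vYZ vW; rewrite add2 // !add3 // !P1 //; lra.
move=> X Y Z W vX vY vZ vW.
have := sectional_defect_bianchi p vX vY vZ vW.
rewrite (P2 Y Z X W) // (sectional_defect_skew12 Y X) (sectional_defect_skew12 Z X)
    (P2 X Z Y W) //; lra.
Qed.

Lemma gauss_constant X Y Z W p : VF X -> VF Y -> VF Z -> VF W ->
  KK X Y Z W p = (lambda - c) * (G Y Z p * G X W p - G X Z p * G Y W p).
Proof.
by move=> vX vY vZ vW; have := sectional_defect0 p vX vY vZ vW; rewrite /Edev; lra.
Qed.

Lemma riemann_const X Y Z W p : VF X -> VF Y -> VF Z -> VF W ->
  Rm X Y Z W p = c * (G Y Z p * G X W p - G X Z p * G Y W p).
Proof.
move=> vX vY vZ vW; have := gauss_equation p vX vY vZ vW;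
    rewrite (gauss_constant p vX vY vZ vW); lra.
Qed.

Definition difference_deriv V Y Z : field :=
  Dg V (K Y Z) - (K (Dg V Y) Z + K Y (Dg V Z)).
Local Notation DKf := difference_deriv.

Lemma vector_field_difference_deriv V Y Z : VF V -> VF Y -> VF Z -> VF (DKf V Y Z).
Proof.
move=> vV vY vZ; apply: (vector_field_sub hM); first by apply: VFg => //;
    exact: vector_field_difference.
by apply: (vector_field_add hM); apply: vector_field_difference => //; exact: VFg.
Qed.

Lemma gfield_difference_deriv V Y Z W p : VF V -> VF Y -> VF Z -> VF W ->
  G (DKf V Y Z) W p = DC V Y Z W p.
Proof.
move=> vV vY vZ vW; have tW := tensorial_gfield hg p vW.
have vK := vector_field_difference vY vZ; have v1 :=
    vector_field_difference (VFg vV vY) vZ; have v2 :=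
    vector_field_difference vY (VFg vV vZ).
rewrite /DKf (tensorial_sub hM tW (VFg vV vK) (vector_field_add hM v1 v2))
    (tensorial_add hM tW v1 v2).
by rewrite (gfield_levi_civita p vV vK vW) /DC /C; ring.
Qed.

Lemma gfield_deriv_difference V Y Z W p : VF V -> VF Y -> VF Z -> VF W ->
  G (Dg V (K Y Z)) W p =
  G (DKf V Y Z) W p + G (K (Dg V Y) Z) W p + G (K Y (Dg V Z)) W p.
Proof.
move=> vV vY vZ vW; rewrite gfield_difference_deriv // (gfield_levi_civita p vV
    (vector_field_difference vY vZ) vW) /DC /C; ring.
Qed.

(** The right-hand side of [gauss_constant] is parallel. *)
Lemma gauss_deriv V X Y Z W p : VF V -> VF X -> VF Y -> VF Z -> VF W ->
  G (DKf V Y Z) (K X W) p + G (K Y Z) (DKf V X W) p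
    - G (DKf V X Z) (K Y W) p - G (K X Z) (DKf V Y W) p = 0.
Proof.
move=> vV vX vY vZ vW.
have vVX := VFg vV vX; have vVY := VFg vV vY; have vVZ := VFg vV vZ.
have vVW := VFg vV vW.
have dK U S U' S' : VF U -> VF S -> VF U' -> VF S' -> V p (G (K U S) (K U' S')) =
    G (DKf V U S) (K U' S') p + G (K U S) (DKf V U' S') p
    + G (K (Dg V U) S) (K U' S') p + G (K U (Dg V S)) (K U' S') p
    + G (K U S) (K (Dg V U') S') p + G (K U S) (K U' (Dg V S')) p.
  move=> vU vS vU' vS'; have vK := vector_field_difference vU vS; have vK' :=
      vector_field_difference vU' vS'.
  rewrite (metric_compatible p vV vK vK') (gfield_sym hg p vK (VFg vV vK'))
      !gfield_deriv_difference //.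
  rewrite (gfield_sym hg p (vector_field_difference_deriv vV vU' vS') vK).
  rewrite (gfield_sym hg p (vector_field_difference (VFg vV vU') vS') vK).
  by rewrite (gfield_sym hg p (vector_field_difference vU' (VFg vV vS')) vK); ring.
have sK U S U' S' : VF U -> VF S -> VF U' -> VF S' -> SF (G (K U S) (K U' S')).
  by move=> *; apply: smooth_inner; exact: vector_field_difference.
have E1 : G (K Y Z) (K X W) = fun q => G (K X Z) (K Y W) q +
    (lambda - c) * (G Y Z q * G X W q + (- 1) * (G X Z q * G Y W q)).
  by apply/funext => q; have := gauss_constant q vX vY vZ vW; rewrite /KK; lra.
have sYZ := smooth_inner vY vZ; have sXW := smooth_inner vX vW; have sXZ :=
    smooth_inner vX vZ; have sYW := smooth_inner vY vW.
have sm r f : SF f -> SF (fun q => r * f q) by move=> sf; apply: smooth_fun_mul => //;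
    exact: (smooth_fun_cst hM).
have sA := smooth_fun_mul hM sYZ sXW; have sB := smooth_fun_mul hM sXZ sYW.
have sS := smooth_fun_add hM sA (sm (-1) _ sB).
have := congr1 (V p) E1; rewrite dK //.
rewrite (tangent_act p vV (sK _ _ _ _ vX vZ vY vW) (sm _ _ sS)) dK //.
rewrite (tangent_scale hM _ (vector_field_tangent p vV) (sS p))
    (tangent_act p vV sA (sm _ _ sB)).
rewrite (tangent_scale hM _ (vector_field_tangent p vV) (sB p)).
rewrite !(tangent_actM p vV) // (metric_compatible p vV vY vZ)
    (metric_compatible p vV vX vW).
rewrite (metric_compatible p vV vX vZ) (metric_compatible p vV vY vW).
have := gauss_constant p vVX vY vZ vW; have := gauss_constant p vX vVY vZ vW.
have := gauss_constant p vX vY vVZ vW; have := gauss_constant p vX vY vZ vVW.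
rewrite /KK; lra.
Qed.

(** * The Tchebychev field *)
Lemma expand_parseval p B X : tensorial p B -> VF X ->
  B X = \sum_a eps a * G X (E a) p * B (E a).
Proof. exact: (tensorial_expand_parseval hM hg sphi gphi vE Egrad). Qed.

Lemma parseval X Y p : VF X -> VF Y ->
  G X Y p = \sum_a eps a * G X (E a) p * G Y (E a) p.
Proof. exact: (gfield_expandE hM hg sphi gphi vE Egrad). Qed.

(** The derivative of [parseval] says that the inverse metric [sum eps_a E_a (x) E_a] is
    parallel. *)
Lemma parseval_deriv X Y Z p : VF X -> VF Y -> VF Z ->
  \sum_a eps a * (G (Dg X (E a)) Y p * G (E a) Z p
                  + G (E a) Y p * G (Dg X (E a)) Z p) = 0.
Proof.
move=> vX vY vZ.
have sE V a : VF V -> SF (G V (E a)) by move=> vV; exact: smooth_inner.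
have sm r f : SF f -> SF (fun q => r * f q) by move=> sf; apply: smooth_fun_mul => //;
    exact: (smooth_fun_cst hM).
have E1 : G Y Z = fun q => \sum_a eps a * (G Y (E a) q * G Z (E a) q).
  by apply/funext => q; rewrite (parseval q vY vZ); apply: eq_bigr => a _;
      rewrite mulrA.
have := congr1 (X p) E1; rewrite (metric_compatible p vX vY vZ).
rewrite (tangent_sum hM _ (vector_field_tangent p vX)); last first.
  by move=> a _; apply: sm; apply: smooth_fun_mul => //; exact: sE.
have -> : \sum_a X p (fun q => eps a * (G Y (E a) q * G Z (E a) q)) =
    \sum_a eps a * G (Dg X Y) (E a) p * G Z (E a) p
    + \sum_a eps a * G (Dg X Z) (E a) p * G Y (E a) p
    + \sum_a eps a * (G (Dg X (E a)) Y p * G (E a) Z p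
                  + G (E a) Y p * G (Dg X (E a)) Z p).
  rewrite -!big_split; apply: eq_bigr => a _ /=.
  rewrite (tangent_scale hM _ (vector_field_tangent p vX));
      last by apply: smooth_fun_mul => //; exact: sE.
  rewrite (tangent_actM p vX (sE _ _ vY) (sE _ _ vZ)).
  rewrite (metric_compatible p vX vY (vE a)) (metric_compatible p vX vZ (vE a)).
  have vXE := VFg vX (vE a).
  rewrite (gfield_sym hg p vXE vY) (gfield_sym hg p vXE vZ) (gfield_sym hg p (vE a) vY).
  by rewrite (gfield_sym hg p (vE a) vZ); ring.
rewrite -(parseval p (VFg vX vY) vZ) -(parseval p (VFg vX vZ) vY).
rewrite (gfield_sym hg p (VFg vX vZ) vY); lra.
Qed.

(** Covariant differentiation commutes with metric traces, by [parseval_deriv]. *)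
Lemma trace_deriv (B : field -> field -> M -> R) X p : VF X ->
  (forall Y Z, VF Y -> VF Z -> SF (B Y Z)) ->
  bitensorial A p (fun Y Z => B Y Z p) ->
  X p (fun q => \sum_a eps a * B (E a) (E a) q) =
  \sum_a eps a * (X p (B (E a) (E a)) - B (Dg X (E a)) (E a) p - B (E a) (Dg X (E a))
      p).
Proof.
move=> vX sB [tB1 tB2].
rewrite (tangent_sum hM _ (vector_field_tangent p vX)); last first.
  by move=> a _; exact: (smooth_fun_mul hM (smooth_fun_cst hM (eps a)) (sB _ _ (vE a)
      (vE a))).
apply/eqP; rewrite -subr_eq0 -sumrB.
have -> : \sum_a (X p (fun q => eps a * B (E a) (E a) q) - eps a *
     (X p (B (E a) (E a)) - B (Dg X (E a)) (E a) p - B (E a) (Dg X (E a)) p)) =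
   \sum_a \sum_b \sum_d eps b * eps d * B (E b) (E d) p * (eps a *
     (G (Dg X (E a)) (E b) p * G (E a) (E d) p
      + G (E a) (E b) p * G (Dg X (E a)) (E d) p)).
  apply: eq_bigr => a _.
  rewrite (tangent_scale hM _ (vector_field_tangent p vX)); last exact: sB.
  have vXE := VFg vX (vE a).
  have E2 Y Z : VF Y -> VF Z -> B Y Z p =
      \sum_b \sum_d eps b * eps d * B (E b) (E d) p * (G Y (E b) p * G Z (E d) p).
    move=> vY vZ; rewrite (expand_parseval (tB1 Z vZ) vY); apply: eq_bigr => b _.
    rewrite (expand_parseval (tB2 (E b) (vE b)) vZ) mulr_sumr; apply: eq_bigr => d _.
    by ring.
  rewrite (E2 _ _ vXE (vE a)) (E2 _ _ (vE a) vXE).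
  transitivity (eps a * (\sum_b \sum_d eps b * eps d * B (E b) (E d) p *
      (G (Dg X (E a)) (E b) p * G (E a) (E d) p) +
      \sum_b \sum_d eps b * eps d * B (E b) (E d) p *
      (G (E a) (E b) p * G (Dg X (E a)) (E d) p))); first by ring.
  rewrite -big_split mulr_sumr; apply: eq_bigr => b _ /=.
  rewrite -big_split mulr_sumr; apply: eq_bigr => d _ /=.
  by ring.
rewrite exchange_big big1 // => b _; rewrite exchange_big big1 // => d _ /=.
by rewrite -mulr_sumr (parseval_deriv p vX (vE b) (vE d)) mulr0.
Qed.

Lemma trace_frame p e B : orthonormal_at A g p e -> bitensorial A p B ->
  \sum_i B (e i) (e i) = \sum_a eps a * B (E a) (E a).
Proof. exact: (trace_expand hM hg sphi gphi vE Egrad). Qed.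

Lemma frame_orthonormal p : orthonormal_at A g p (frame A g p).
Proof. exact: (frame_orthonormal_at hM hg gphi vE Egrad). Qed.

Lemma expand_frame p e B X : orthonormal_at A g p e -> tensorial p B -> VF X ->
  B X = \sum_i G X (e i) p * B (e i).
Proof. exact: (tensorial_expand hM hg sphi gphi vE Egrad). Qed.

Lemma gfield_frame p e X Y : orthonormal_at A g p e -> VF X -> VF Y ->
  G X Y p = \sum_i G X (e i) p * G Y (e i) p.
Proof. exact: (gfield_expand hM hg sphi gphi vE Egrad). Qed.

(** The trace over the Parseval frame shows that the Tchebychev field is smooth, which the
    pointwise choice of orthonormal frames hides. *)
Definition tchebychev_field : field := \sum_a fscale (cst (eps a)) (K (E a) (E a)).
Local Notation Tv := tchebychev_field.

Lemma vector_field_tchebychev : VF Tv.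
Proof.
apply: (vector_field_sum hM) => a _; apply: (vector_field_scale hM);
    first exact: (smooth_fun_cst hM).
exact: vector_field_difference.
Qed.

Lemma gfield_tchebychev W p : VF W -> G Tv W p = \sum_a eps a * C (E a) (E a) W p.
Proof.
move=> vW; rewrite /Tv (tensorial_sum hM _ _ (tensorial_gfield hg p vW)) //.
  by move=> a; exact: (smooth_fun_cst hM).
by move=> a; exact: vector_field_difference.
Qed.

Lemma bitensorial_cubic_form p W : VF W -> bitensorial A p (fun Y Z => C Y Z W p).
Proof.
by move=> vW; split=> [Z vZ|Y vY];
    [exact: tensorial_cubic_form1 | exact: tensorial_cubic_form2].
Qed.

Lemma gfield_tchebychev_frame p e W : orthonormal_at A g p e -> VF W ->
  G Tv W p = \sum_i C (e i) (e i) W p.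
Proof. by move=> oe vW;
    rewrite gfield_tchebychev // (trace_frame oe (bitensorial_cubic_form p vW)). Qed.

Lemma tchebychevE : tchebychev A g D Dg = Tv.
Proof.
apply/funext => p; have oe := frame_orthonormal p; have [ve _] := oe.
rewrite /tchebychev.
have -> : \sum_i difference D Dg (frame A g p i) (frame A g p i) p =
    \sum_i 1 *: K (frame A g p i) (frame A g p i) p.
  by apply: eq_bigr => i _; rewrite scale1r.
have tK i : tangent A p (K (frame A g p i) (frame A g p i) p).
  by apply: vector_field_tangent; exact: vector_field_difference.
apply: (metric_nondegenerate hM hg).
- by apply: (tangent_sumv hM).
- exact: (vector_field_tangent p vector_field_tchebychev).
move=> u tu; have [Z vZ <-] := field_through hM hg gphi vE Egrad tu.
rewrite (metric_sum hM hg) //; last exact: vector_field_tangent.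
rewrite -[RHS]/(G Tv Z p) (gfield_tchebychev_frame oe vZ); apply: eq_bigr => i _.
by rewrite mul1r.
Qed.

Definition tchebychev_deriv X W p : R := G (Dg X Tv) W p.
Local Notation S := tchebychev_deriv.

Lemma smooth_tchebychev_deriv X W : VF X -> VF W -> SF (S X W).
Proof. by move=> vX vW; apply: smooth_inner => //; apply: VFg => //;
    exact: vector_field_tchebychev. Qed.

Lemma tchebychev_deriv_trace X W p : VF X -> VF W ->
  S X W p = \sum_a eps a * DC X (E a) (E a) W p.
Proof.
move=> vX vW; rewrite /S (gfield_levi_civita p vX vector_field_tchebychev vW).
have -> : G Tv W = fun q => \sum_a eps a * C (E a) (E a) W q.
  by apply/funext => q; exact: gfield_tchebychev.
rewrite (trace_deriv (B := fun Y Z => C Y Z W) vX _ (bitensorial_cubic_form p vW));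
    last first.
  by move=> Y Z vY vZ; exact: smooth_cubic_form.
rewrite (gfield_tchebychev p (VFg vX vW)) -sumrB; apply: eq_bigr => a _; rewrite /DC;
    ring.
Qed.

(** By [tchebychev_deriv_trace] and the total symmetry of the derivative of [C]; in
    other words, the 1-form dual to the Tchebychev field is closed. *)
Lemma tchebychev_deriv_sym X W p : VF X -> VF W -> S X W p = S W X p.
Proof.
move=> vX vW; rewrite !tchebychev_deriv_trace //; apply: eq_bigr => a _; congr (_ * _).
rewrite (codazzi_equation p vX) // (cubic_deriv_sym23 p _ vX)
    // (cubic_deriv_sym34 p _ _ vX) //.
by rewrite (cubic_deriv_sym23 p _ _ vW) // (codazzi_equation p _ vW).
Qed.

(** The second covariant derivative of the 1-form dual to the Tchebychev field. *)
Definition tchebychev_deriv2 X Y Z p : R :=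
  X p (S Y Z) - S (Dg X Y) Z p - S Y (Dg X Z) p.
Local Notation DS := tchebychev_deriv2.

Lemma tchebychev_deriv2_sym23 X Y Z p : VF X -> VF Y -> VF Z -> DS X Y Z p = DS X Z Y p.
Proof.
move=> vX vY vZ; rewrite /DS (tchebychev_deriv_sym p (VFg vX vY) vZ)
    (tchebychev_deriv_sym p vY (VFg vX vZ)).
have -> : S Y Z = S Z Y by apply/funext => q; exact: tchebychev_deriv_sym.
by ring.
Qed.

Lemma ricci_identity X Y Z p : VF X -> VF Y -> VF Z ->
  DS X Y Z p = DS Y X Z p + Rm X Y Tv Z p.
Proof. by move=> vX vY vZ; rewrite riemannE //; [rewrite /DS /S;
    ring | exact: vector_field_tchebychev]. Qed.

Lemma tensorial_tchebychev_deriv1 p W : VF W -> tensorial p (fun X => S X W p).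
Proof. by move=> vW; apply: (tensorial_connection affg) => //;
    exact: vector_field_tchebychev. Qed.

Lemma tensorial_tchebychev_derivr p X : VF X -> tensorial p (S X ^~ p).
Proof. by move=> vX; apply: (tensorial_gfieldr hM hg); apply: VFg => //;
    exact: vector_field_tchebychev. Qed.

Lemma bitensorial_tchebychev_deriv p : bitensorial A p (fun X W => S X W p).
Proof. by split=> [W vW|X vX];
    [exact: tensorial_tchebychev_deriv1 | exact: tensorial_tchebychev_derivr]. Qed.

Lemma tensorial_tchebychev_deriv2 p X Z : VF X -> VF Z ->
    tensorial p (fun Y => DS X Y Z p).
Proof.
move=> vX vZ h Y Y' sh vY vY'; rewrite /DS.
have -> : S (fscale h Y + Y') Z = fun q => h q * S Y Z q + S Y' Z q.
  by apply/funext => q; exact: tensorial_tchebychev_deriv1.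
have sS := smooth_tchebychev_deriv vY vZ; have sS' := smooth_tchebychev_deriv vY' vZ.
rewrite (tangent_act p vX (smooth_fun_mul hM sh sS) sS') (tangent_actM p vX sh sS).
have vXZ := VFg vX vZ; have vXY := VFg vX vY; have vXY' := VFg vX vY'.
have vh : VF (fscale h (Dg X Y) + Dg X Y') by exact: (vector_field_lin hM).
have sXh : SF (fderiv X h) by exact: (smooth_fderiv hM).
rewrite (connection_linr affg sh vX vY vY').
rewrite (@tensorial_tchebychev_deriv1 p _ vZ _ _ _ sXh vY vh)
    (@tensorial_tchebychev_deriv1 p _ vZ _ _ _ sh vXY vXY').
by rewrite (@tensorial_tchebychev_deriv1 p _ vXZ _ _ _ sh vY vY') /fderiv; ring.
Qed.

Lemma bitensorial_tchebychev_deriv2 p X : VF X ->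
    bitensorial A p (fun Y Z => DS X Y Z p).
Proof.
move=> vX; split=> [Z vZ|Y vY]; first exact: tensorial_tchebychev_deriv2.
move=> h Z Z' sh vZ vZ'.
have vZZ : VF (fscale h Z + Z') by exact: (vector_field_lin hM).
rewrite !(tchebychev_deriv2_sym23 p vX vY) //; exact: tensorial_tchebychev_deriv2.
Qed.

Definition tchebychev_div p : R := \sum_a eps a * S (E a) (E a) p.
Local Notation dv := tchebychev_div.

Lemma smooth_tchebychev_div : SF dv.
Proof.
by apply: (smooth_fun_sum hM) => a _;
    apply: (smooth_fun_mul hM (smooth_fun_cst hM (eps a)));
    exact: smooth_tchebychev_deriv.
Qed.

Lemma deriv_tchebychev_div X p : VF X -> X p dv = \sum_a eps a * DS X (E a) (E a) p.
Proof.
by move=> vX; rewrite (trace_deriv (B := S)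
    vX smooth_tchebychev_deriv (bitensorial_tchebychev_deriv p)).
Qed.

Lemma riemann_trace p e Z : orthonormal_at A g p e -> VF Z ->
  \sum_i Rm (e i) Z Tv (e i) p = c * (m%:R - 1) * G Tv Z p.
Proof.
move=> oe vZ; have [ve oee] := oe; have vT := vector_field_tchebychev.
under eq_bigr => i _ do rewrite (riemann_const p (ve i) vZ vT (ve i)) oee eqxx mulr1.
rewrite -mulr_sumr sumrB sumr_const card_ord -mulr_natl (gfield_sym hg p vZ vT).
have -> : \sum_i G (e i) Tv p * G Z (e i) p = G Tv Z p.
  rewrite (gfield_frame oe vT vZ); apply: eq_bigr => i _.
  by rewrite (gfield_sym hg p (ve i) vT).
ring.
Qed.

Lemma tchebychev_deriv2_trace p e Z : orthonormal_at A g p e -> VF Z ->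
  \sum_i DS (e i) (e i) Z p = Z p dv + c * (m%:R - 1) * G Tv Z p.
Proof.
move=> oe vZ; have [ve oee] := oe.
rewrite (deriv_tchebychev_div p vZ)
    -(trace_frame oe (bitensorial_tchebychev_deriv2 p vZ)) -(riemann_trace oe vZ).
rewrite -big_split; apply: eq_bigr => i _ /=.
by rewrite tchebychev_deriv2_sym23 // ricci_identity.
Qed.

Context (hsemi : semi_equiaffine A g D Dg).

Lemma semi_equiaffine_laplacian p e Z : e = frame A g p -> VF Z ->
  \sum_i DS (e i) (e i) Z p + \sum_i (\sum_j Rm (e j) (e i) Tv (e j) p) * G (e i)
      Z p = 0.
Proof.
move=> eE vZ; have vT := vector_field_tchebychev.
have [ve _] : orthonormal_at A g p e by rewrite eE; exact: frame_orthonormal.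
have := congr1 (fun V : field => g p (V p) (Z p)) (proj1 hsemi).
rewrite /= (metric0 hM hg); last exact: vector_field_tangent.
rewrite tchebychevE => H0; apply: etrans H0.
pose U i : field := Dg (e i) (Dg (e i) Tv) - Dg (Dg (e i) (e i)) Tv.
have vU i : VF (U i).
  by apply: (vector_field_sub hM); apply: VFg => //; apply: VFg.
pose V1 : (M -> R) -> R := \sum_i 1 *: U i p.
pose V2 : (M -> R) -> R := \sum_i ricci A g Dg (e i) Tv p *: e i p.
have t1 : tangent A p V1.
  by apply: (tangent_sumv hM) => i _; exact: vector_field_tangent.
have t2 : tangent A p V2.
  by apply: (tangent_sumv hM) => i _; exact: vector_field_tangent.
have -> : (rough_laplacian A g Dg Tv + ricci_field A g Dg Tv) p = 1 *: V1 + V2.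
  rewrite scale1r /V2 eE; congr (_ + _); rewrite /V1 /U eE.
  by apply: eq_bigr => i _; rewrite scale1r.
rewrite (metric_lin hg) //; last exact: vector_field_tangent.
rewrite mul1r.
have -> : g p V1 (Z p) = \sum_i 1 * g p (U i p) (Z p).
  by rewrite (metric_sum hM hg) // => *; exact: vector_field_tangent.
have -> : g p V2 (Z p) = \sum_i ricci A g Dg (e i) Tv p * g p (e i p) (Z p).
  by rewrite (metric_sum hM hg) // => *; exact: vector_field_tangent.
congr (_ + _); apply: eq_bigr => i _; last by rewrite /ricci eE.
rewrite mul1r -[RHS]/(G (U i) Z p) /U.
have vii := VFg (ve i) (ve i); have viT := VFg (ve i) vT.
rewrite (tensorial_sub hM (tensorial_gfield hg p vZ) (VFg (ve i) viT) (VFg vii vT)).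
by rewrite (gfield_levi_civita p (ve i) viT vZ) /DS /S; ring.
Qed.

(** Closedness turns the rough Laplacian into the gradient of the divergence plus a
    Ricci term, and [Ric = c (m - 1) g]. *)
Lemma tchebychev_div_deriv Z p : VF Z -> Z p dv = - (2 * c * (m%:R - 1)) * G Tv Z p.
Proof.
move=> vZ; have oe := frame_orthonormal p; have [ve _] := oe; have vT :=
    vector_field_tchebychev.
have := semi_equiaffine_laplacian (erefl (frame A g p)) vZ.
under [X in _ + X]eq_bigr => i _ do rewrite (riemann_trace oe (ve i)) -mulrA.
have -> : \sum_i c * (m%:R - 1) * (G Tv (frame A g p i) p * G (frame A g p i) Z p) =
    c * (m%:R - 1) * G Tv Z p.
  rewrite -mulr_sumr (gfield_frame oe vT vZ); congr (_ * _); apply: eq_bigr => i _.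
  by rewrite (gfield_sym hg p (ve i) vZ).
rewrite (tchebychev_deriv2_trace oe vZ); lra.
Qed.

Lemma semi_equiaffine_transport Z p : VF Z -> dv p * G Tv Z p + S Tv Z p = 0.
Proof.
move=> vZ; have vT := vector_field_tchebychev; have oe := frame_orthonormal p.
have := congr1 (fun V : field => g p (V p) (Z p)) (proj2 hsemi).
rewrite /= (metric0 hM hg); last exact: vector_field_tangent.
rewrite tchebychevE => H0; apply: etrans H0.
have E1 : dv p = divergence A g Dg Tv p by rewrite /dv -(trace_frame oe
    (bitensorial_tchebychev_deriv p)).
rewrite -[(_ + _) p]/(divergence A g Dg Tv p *: Tv p + Dg Tv Tv p) -E1.
rewrite (metric_lin hg) //; try exact: vector_field_tangent.
by apply: vector_field_tangent; exact: VFg.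
Qed.

(** Taking the divergence of the second semi-equiaffine condition and using the
    first one yields a pointwise identity whose sign is governed by [c]. *)
Lemma divergence_identity p e : orthonormal_at A g p e ->
  dv p ^+ 2 + \sum_i G (Dg (e i) Tv) (Dg (e i) Tv) p = 3 * c * (m%:R - 1) * G Tv Tv p.
Proof.
move=> oe; have [ve oee] := oe; have vT := vector_field_tchebychev.
have deriv X Z : VF X -> VF Z ->
    X p dv * G Tv Z p + dv p * S X Z p + DS X Tv Z p + S (Dg X Tv) Z p = 0.
  move=> vX vZ; have sT := smooth_inner vT vZ; have sS := smooth_tchebychev_deriv vT vZ.
  have H : (fun q => dv q * G Tv Z q + S Tv Z q) = cst 0.
    by apply/funext => q; exact: semi_equiaffine_transport.
  have := congr1 (X p) H; rewrite (tangent_cst hM 0 (vector_field_tangent p vX)).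
  rewrite (tangent_act p vX (smooth_fun_mul hM smooth_tchebychev_div sT) sS)
      (tangent_actM p vX smooth_tchebychev_div sT).
  rewrite (metric_compatible p vX vT vZ) /DS -/(S X Z p).
  have := semi_equiaffine_transport p (VFg vX vZ); lra.
have -> : \sum_i G (Dg (e i) Tv) (Dg (e i) Tv) p = \sum_i S (Dg (e i) Tv) (e i) p.
  by apply: eq_bigr => i _; rewrite (tchebychev_deriv_sym p (VFg (ve i) vT) (ve i)).
have H :
  \sum_i ((e i) p dv * G Tv (e i) p + dv p * S (e i) (e i) p + DS (e i) Tv (e i) p
    + S (Dg (e i) Tv) (e i) p) = 0 by apply: big1 => i _; exact: deriv.
have : \sum_i e i p dv * G Tv (e i) p + dv p * \sum_i S (e i) (e i) p
    + \sum_i DS (e i) Tv (e i) p + \sum_i S (Dg (e i) Tv) (e i) p = 0.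
  by rewrite mulr_sumr -!big_split.
have -> : \sum_i e i p dv * G Tv (e i) p = - (2 * c * (m%:R - 1)) * G Tv Tv p.
  rewrite (gfield_frame oe vT vT) mulr_sumr; apply: eq_bigr => i _.
  by rewrite (tchebychev_div_deriv p (ve i)) mulrA.
have -> : \sum_i S (e i) (e i)
    p = dv p by rewrite (trace_frame oe (bitensorial_tchebychev_deriv p)).
have -> : \sum_i DS (e i) Tv (e i) p = - (c * (m%:R - 1)) * G Tv Tv p.
  under eq_bigr => i _ do rewrite (tchebychev_deriv2_sym23 p (ve i) vT (ve i)).
  by rewrite (tchebychev_deriv2_trace oe vT) (tchebychev_div_deriv p vT); ring.
rewrite expr2; lra.
Qed.

(** The full trace of the Gauss equation. *)
Lemma sqnorm_identity p : (lambda - c) * (m%:R * (m%:R - 1)) =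
  G Tv Tv p - difference_sqnorm A g D Dg p.
Proof.
have oe := frame_orthonormal p; have [ve oee] := oe; have vT := vector_field_tchebychev.
rewrite /difference_sqnorm; set e := frame A g p in oe ve oee *.
have vK i j : VF (K (e i) (e j)) by exact: vector_field_difference.
have -> : G Tv Tv p = \sum_i \sum_j G (K (e j) (e j)) (K (e i) (e i)) p.
  rewrite (gfield_tchebychev_frame oe vT); apply: eq_bigr => i _.
  by rewrite /C (gfield_sym hg p (vK i i) vT) (gfield_tchebychev_frame oe (vK i i)).
rewrite -sumrB.
transitivity (\sum_(i < m) \sum_(j < m) (lambda - c) * (1 - (i == j)%:R)).
  have -> : \sum_(i < m) \sum_(j < m) (lambda - c) * (1 - (i == j)%:R) =
     \sum_(i < m) (lambda - c) * (m%:R - 1).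
    apply: eq_bigr => i _; rewrite -mulr_sumr sumrB sumr_const card_ord.
    rewrite (bigD1 i) //= eqxx big1 ?addr0 // => j ji.
    by rewrite eq_sym (negbTE ji).
  by rewrite sumr_const card_ord -mulr_natl; ring.
apply: eq_bigr => i _; rewrite -sumrB; apply: eq_bigr => j _.
have := gauss_constant p (ve i) (ve j) (ve j) (ve i).
rewrite /KK !oee !eqxx (difference_sym (ve j) (ve i)) => ->.
by rewrite [j == i]eq_sym; case: (i == j) => /=; ring.
Qed.

Lemma gfield_ge0 X p : VF X -> 0 <= G X X p.
Proof.
move=> vX; have [X0|X0] := eqVneq (X p) 0.
  by rewrite /gfield X0 (metric0 hM hg) //; exact: (tangent0 hM).
by apply: ltW; case: hg => _ _ pos _; apply: pos => //; exact: vector_field_tangent.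
Qed.

Lemma sum_G_ge0 (U : 'I_m -> field) p : (forall i, VF (U i)) ->
  0 <= \sum_i G (U i) (U i) p.
Proof. by move=> vU; apply: sumr_ge0 => i _; exact: gfield_ge0. Qed.

Lemma sum_G_eq0 (U : 'I_m -> field) p : (forall i, VF (U i)) ->
  \sum_i G (U i) (U i) p = 0 -> forall i, U i p = 0.
Proof.
move=> vU /eqP; rewrite psumr_eq0; last by move=> i _; exact: gfield_ge0.
by move=> /allP H i; apply: gfield_eq0 => //; apply/eqP; exact: H (mem_index_enum _).
Qed.

Context (hm : (2 <= m)%N).

Lemma dim_gt1 : 0 < m%:R - 1 :> R.
Proof. by rewrite subr_gt0 ltr1n. Qed.

Lemma vector_field_tchebychev_deriv i p (e := frame A g p) : VF (Dg (e i) Tv).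
Proof. by apply: VFg; [case: (frame_orthonormal p)
    | exact: vector_field_tchebychev]. Qed.

Lemma tchebychev_vanish_neg p : c < 0 -> Tv p = 0.
Proof.
move=> c0; apply: gfield_eq0; first exact: vector_field_tchebychev.
have := divergence_identity (frame_orthonormal p).
have := sum_G_ge0 p (vector_field_tchebychev_deriv ^~ p); have := sqr_ge0 (dv p).
have T0 := gfield_ge0 p vector_field_tchebychev; set s := \sum_i _ => s0 d0 H.
have c1 : 0 < - c * (m%:R - 1) by rewrite mulr_gt0 ?oppr_gt0 // dim_gt1.
apply/le_anti; rewrite T0 andbT; have := mulr_ge0 (ltW c1) T0 => H1.
by rewrite -(pmulr_rle0 _ c1); lra.
Qed.

Lemma tchebychev_parallel X W p : c = 0 -> VF X -> VF W -> S X W p = 0.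
Proof.
move=> c0 vX vW; have oe := frame_orthonormal p; have [ve _] := oe.
have := divergence_identity oe; rewrite c0 mulr0 !mul0r.
have := sum_G_ge0 p (vector_field_tchebychev_deriv ^~ p); have := sqr_ge0 (dv p)
    => d0 s0 H.
have Z : forall i, Dg (frame A g p i) Tv p = 0.
  by apply: (@sum_G_eq0 _ p (vector_field_tchebychev_deriv ^~ p)); lra.
rewrite (expand_frame oe (tensorial_tchebychev_deriv1 p vW) vX) big1 // => i _.
rewrite /S /gfield Z (metric0 hM hg) ?mulr0 //; exact: vector_field_tangent.
Qed.

Lemma tangent_max p v h : tangent A p v -> SF h -> (forall q, h q <= h p) -> v h = 0.
Proof.
move=> tv sh hmax; have [k kA kp] := atlas_chart hM p.
have ka := atlas_admissible hM kA; rewrite (tangent_expand hM ka kp tv) //.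
have kK : cinv k (cfun k p) = p by case: ka => -[_ _ ->].
have [U [oU Up sU]] := smooth_at_chart hM ka kp (sh p).
apply: big1 => i _; set F := h \o cinv k in sU *; set x := cfun k p in Up *.
have /nbhs_ballP [r /= r0 Hr] : nbhs x U by exact: open_nbhs_nbhs.
pose d : 'rV[R]_m := delta_mx 0 i.
pose Fl (s : R) := F (x + s *: d).
have dd s : s \in `](- r), r[ -> is_derive s 1 Fl ('D_d F (x + s *: d)).
  rewrite in_itv /= => sr; apply: is_derive_line; apply: diff_derivable.
  apply: (smooth_differentiable oU _ sU); apply: Hr; rewrite -ball_normE /=.
  rewrite opprD addNKr normrN; apply: norm_row_lt => // j.
  rewrite !mxE eqxx /=; case: (j == i); rewrite ?mulr1 ?mulr0 ?normr0 //.
  by rewrite ltr_norml.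
have r00 : (0 : R) \in `](- r), r[ by rewrite in_itv /= oppr_lt0 r0.
have rr : - r <= r by rewrite ge0_cp // ltW.
have der s : s \in `](- r), r[ -> derivable Fl s 1.
  by move=> /dd [].
have Fmax s : s \in `](- r), r[ -> Fl s <= Fl 0.
  by move=> _; rewrite /Fl scale0r addr0 /F /= kK.
have [_ D0] := derive1_at_max rr der r00 Fmax.
have [_] := dd 0 r00; rewrite D0 scale0r addr0 => D0'.
by rewrite /partial -D0' mulr0.
Qed.

(** At a maximum of the squared divergence either the divergence or the Tchebychev field
    vanishes, and by [divergence_identity] the latter implies the former. *)
Lemma tchebychev_vanish_pos p : compact [set: M] -> 0 < c -> Tv p = 0.
Proof.
move=> cM c0; have vT := vector_field_tchebychev; have sd := smooth_tchebychev_div.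
have s2 := smooth_fun_mul hM sd sd.
have c1 : 0 < c * (m%:R - 1) by rewrite mulr_gt0 // dim_gt1.
have [||q _ qmax] := @compact_EVT_max M R (fun q => dv q * dv q) setT _ cM.
- by exists p.

- by apply: continuous_subspaceT => q; exact: (smooth_at_continuous hM (s2 q)).
have q0 : dv q = 0.
  have := tangent_max (vector_field_tangent q vT) s2 (fun q' => qmax q' (in_setT _)).
  rewrite (tangent_actM q vT sd sd) (tchebychev_div_deriv q vT) => H.
  have [//|dq] := eqVneq (dv q) 0.
  have TT : G Tv Tv q = 0.
    have : (4 * (c * (m%:R - 1))) * dv q * G Tv Tv q = 0 by lra.
    move/eqP; rewrite !mulf_eq0 (negbTE dq) (gt_eqF c0) (gt_eqF dim_gt1).
    by rewrite (gt_eqF (ltr0n _ 4)) /= => /eqP.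
  have := divergence_identity (frame_orthonormal q); rewrite TT mulr0.
  have := sum_G_ge0 q (vector_field_tchebychev_deriv ^~ q); have := sqr_ge0 (dv q)
      => d0 sum0 H1.
  by apply/eqP; rewrite -sqrf_eq0; apply/eqP; lra.
have d0 : dv = cst 0.
  apply/funext => q'; have := qmax q' (in_setT _); rewrite q0 mulr0 => H.
  by apply/eqP; rewrite -sqrf_eq0 expr2; apply/eqP/le_anti; rewrite H -expr2 sqr_ge0.
apply: gfield_eq0 => //; have := tchebychev_div_deriv p vT.
rewrite d0 (tangent_cst hM 0 (vector_field_tangent p vT)) => /eqP.
rewrite eq_sym mulf_eq0 oppr_eq0 !mulf_eq0 (gt_eqF c0) (gt_eqF dim_gt1).
by rewrite (gt_eqF (ltr0n _ 2)) /= => /eqP.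
Qed.

Lemma tensorial_cubic_deriv3 p X Y W : VF X -> VF Y -> VF W ->
    tensorial p (fun Z => DC X Y Z W p).
Proof.
move=> vX vY vW h Z Z' sh vZ vZ'.
have vZZ : VF (fscale h Z + Z') by exact: (vector_field_lin hM).
rewrite !(cubic_deriv_sym23 p vX vY) //; exact: tensorial_cubic_deriv2.
Qed.

Lemma cubic_deriv_spanned p n (e : 'I_n -> field) : (forall i, VF (e i)) ->
  (forall B X, tensorial p B -> VF X -> (forall i, B (e i) = 0) -> B X = 0) ->
  (forall i j k l, DC (e i) (e j) (e k) (e l) p = 0) ->
  forall X Y Z W, VF X -> VF Y -> VF Z -> VF W -> DC X Y Z W p = 0.
Proof.
move=> ve span H X Y Z W vX vY vZ vW.
have H1 U j k l : VF U -> DC U (e j) (e k) (e l) p = 0.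
  by move=> vU; exact: (span _ _ (tensorial_cubic_deriv1 p (ve j) (ve k) (ve l)) vU).
have H2 U V k l : VF U -> VF V -> DC U V (e k) (e l) p = 0.
  move=> vU vV; rewrite (codazzi_equation p vU vV (ve k) (ve l)).
  apply: (span _ _ (tensorial_cubic_deriv1 p vU (ve k) (ve l)) vV) => i.
  by rewrite (codazzi_equation p (ve i) vU (ve k) (ve l)) H1.
have H3 U V V' l : VF U -> VF V -> VF V' -> DC U V V' (e l) p = 0.
  move=> vU vV vV'; apply: (span _ _ (@tensorial_cubic_deriv3 p _ _ _ vU vV (ve l))
      vV') => i.
  exact: H2.
rewrite (cubic_deriv_sym34 p vX vY vZ vW).
apply: (span _ _ (@tensorial_cubic_deriv3 p _ _ _ vX vY vZ) vW) => i.
by rewrite (cubic_deriv_sym34 p vX vY (ve i) vZ); exact: H3.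
Qed.

(** * Nonzero curvature *)
Section Traceless.
Context (T0 : forall p, Tv p = 0).

Lemma gfield_tchebychev0 W p : VF W -> G Tv W p = 0.
Proof. by move=> vW; rewrite /gfield T0 (metric0 hM hg) //;
    exact: vector_field_tangent. Qed.

Lemma tchebychev_deriv0 X W p : VF X -> VF W -> S X W p = 0.
Proof.
move=> vX vW; rewrite /S (gfield_levi_civita p vX vector_field_tchebychev vW)
    gfield_tchebychev0 ?subr0; last exact: VFg.
rewrite (_ : G Tv W = cst 0); last by apply/funext => q; rewrite gfield_tchebychev0.
exact: (tangent_cst hM 0 (vector_field_tangent p vX)).
Qed.

Section Point.
Context (p : M) (e : 'I_m -> @field R M) (oe : orthonormal_at A g p e).

Let ve i : VF (e i). Proof. by case: oe. Qed.

(** Coordinates of tangent vectors at [p] in the frame [e], carried by global fields. *)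
Definition combination (x : 'rV[R]_m) : field := \sum_i fscale (cst (x 0 i)) (e i).

Lemma vector_field_combination x : VF (combination x).
Proof.
by apply: (vector_field_sum hM) => i _; apply: (vector_field_scale hM) => //;
    exact: (smooth_fun_cst hM).
Qed.

Lemma tensorial_combination B x : tensorial p B -> B (combination x)
    = \sum_i x 0 i * B (e i).
Proof.
by move=> tB; rewrite /combination (tensorial_sum hM _ _ tB) // => i;
    exact: (smooth_fun_cst hM).
Qed.

Lemma combination_lin a x y : combination (a *: x + y) = fscale (cst a) (combination x)
    + combination y.
Proof.
apply/funext => q; apply/funext => f.
transitivity (\sum_i (a *: x + y) 0 i * e i q f).
  by rewrite /combination !fct_sumE.
transitivity (a * (\sum_i x 0 i * e i q f) + \sum_i y 0 i * e i q f).
  by rewrite mulr_sumr -big_split; apply: eq_bigr => i _; rewrite !mxE mulrDl -mulrA.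
by rewrite -[RHS]/(a * combination x q f + combination y q f) /combination !fct_sumE.
Qed.

Lemma combination_delta i : combination (delta_mx 0 i) = e i.
Proof.
apply/funext => q; apply/funext => f; rewrite /combination !fct_sumE.
rewrite (bigD1 i) //= big1 ?addr0 => [|j ji]; rewrite /fscale !mxE eqxx /=.
  by rewrite eqxx mul1r.
by rewrite (negbTE ji) mul0r.
Qed.

Lemma gfield_combination x i : G (combination x) (e i) p = x 0 i.
Proof.
rewrite (tensorial_combination x (tensorial_gfield hg p (ve i))); have [_ oee] := oe.
rewrite (bigD1 i) //= oee eqxx mulr1 big1 ?addr0 // => j ji.
by rewrite oee (negbTE ji) mulr0.
Qed.

Definition cubic_mx x : 'M[R]_m := \matrix_(j, l) C (combination x) (e j) (e l) p.
Definition cubic_deriv_mx x y : 'M[R]_m := \matrix_(j, l) DC (combination x)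
    (combination y) (e j) (e l) p.

(** With vanishing Tchebychev field the matrices of [C] and of its covariant derivative
    satisfy the hypotheses of [cubic_rigidity], the linearised equation being
    [gauss_deriv]. *)
Lemma cubic_deriv_frame_zero : lambda - c < 0 ->
  forall i j k l, DC (e i) (e j) (e k) (e l) p = 0.
Proof.
move=> mu0 i j k l; have [_ oee] := oe.
have vc := vector_field_combination.
suff H x y : cubic_deriv_mx x y = 0.
  by have /matrixP/(_ k l) := H (delta_mx 0 i) (delta_mx 0 j);
      rewrite !mxE !combination_delta.
have KG X Y a : C X Y (e a) p = G (K X Y) (e a) p by [].
apply: (cubic_rigidity (K := cubic_mx) mu0).
- move=> a u v; apply/matrixP => s t; rewrite !mxE combination_lin.
  exact: (@tensorial_cubic_form1 p _ _ (ve s) (ve t) _ _ _ (smooth_fun_cst hM a) (vc u)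
      (vc v)).
- move=> u v; apply/rowP => t; rewrite !mxE.
  transitivity (C (combination v) (combination u) (e t) p).
    rewrite (tensorial_combination u (tensorial_cubic_form2 p (vc v) (ve t))).
    by apply: eq_bigr => s _; rewrite mxE.
  rewrite (cubic_form_sym12 _ (vc v) (vc u))
      (tensorial_combination v (tensorial_cubic_form2 p (vc u) (ve t))).
  by apply: eq_bigr => s _; rewrite mxE.
- by move=> u; apply/matrixP => s t; rewrite !mxE (cubic_form_sym23 (vc u) (ve t)
      (ve s)).
- move=> u; rewrite -(gfield_tchebychev0 p (vc u)) (gfield_tchebychev_frame oe (vc u)).
  apply: eq_bigr => s _; rewrite mxE (cubic_form_sym13 (vc u) (ve s) (ve s)).
  by [].
- move=> u v; apply/matrixP => s t; rewrite !mxE !big_ord1 !mxE.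
  have E1 x' y' : \sum_j0 cubic_mx x' s j0 * cubic_mx y' j0 t = G (K (combination x')
      (e s)) (K (combination y') (e t)) p.
    rewrite (gfield_frame oe (vector_field_difference (vc x') (ve s))
        (vector_field_difference (vc y') (ve t))).
    apply: eq_bigr => r _; rewrite !mxE; congr (_ * _).
    by rewrite (cubic_form_sym23 (vc y') (ve r) (ve t)).
  rewrite !E1; have := gauss_constant p (vc v) (vc u) (ve s) (ve t); rewrite /KK => ->.
  by rewrite !gfield_combination.
- move=> w a u v; apply/matrixP => s t; rewrite !mxE combination_lin.
  exact: (@tensorial_cubic_deriv2 p _ _ _ (vc w) (ve s) (ve t)
      _ _ _ (smooth_fun_cst hM a) (vc u) (vc v)).
- by move=> u v; apply/matrixP => s t; rewrite !mxE (codazzi_equation p (vc u) (vc v)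
      (ve s) (ve t)).
- by move=> u v; apply/matrixP => s t; rewrite !mxE (cubic_deriv_sym34 p (vc u) (vc v)
      (ve t) (ve s)).
- move=> u v w; apply/rowP => t; rewrite !mxE.
  transitivity (DC (combination u) (combination v) (combination w) (e t) p).
    rewrite (tensorial_combination w (@tensorial_cubic_deriv3 p _ _ _ (vc u) (vc v)
        (ve t))).
    by apply: eq_bigr => s _; rewrite mxE.
  rewrite (cubic_deriv_sym23 p (vc u) (vc v) (vc w) (ve t)).
  rewrite (tensorial_combination v (@tensorial_cubic_deriv3 p _ _ _ (vc u) (vc w)
      (ve t))).
  by apply: eq_bigr => s _; rewrite mxE.
- move=> u v; rewrite -(tchebychev_deriv0 p (vc u) (vc v))
      (tchebychev_deriv_trace p (vc u) (vc v)).
  rewrite -(trace_frame (B := fun Y Z => DC (combination u) Y Z (combination v) p) oe);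
      last first.
    by split=> [Z vZ|Y vY];
        [exact: tensorial_cubic_deriv2 | exact: tensorial_cubic_deriv3].
  apply: eq_bigr => s _; rewrite mxE.
  by rewrite (cubic_deriv_sym23 p (vc u) (vc v) (ve s) (ve s))
      (cubic_deriv_sym34 p (vc u) (ve s) (vc v) (ve s)).
- move=> u v w; apply/matrixP => s t; rewrite !mxE.
  have E1 y' z' : \sum_j0 cubic_deriv_mx u y' s j0 * cubic_mx z' j0 t =
      G (DKf (combination u) (combination y') (e s)) (K (combination z') (e t)) p.
    rewrite (gfield_frame oe (vector_field_difference_deriv (vc u) (vc y') (ve s))
        (vector_field_difference (vc z') (ve t))).
    apply: eq_bigr => r _; rewrite !mxE; congr (_ * _).
      by rewrite (gfield_difference_deriv p (vc u) (vc y') (ve s) (ve r)).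
    by rewrite (cubic_form_sym23 (vc z') (ve r) (ve t)).
  have E2 y' z' : \sum_j0 cubic_mx z' s j0 * cubic_deriv_mx u y' j0 t =
      G (K (combination z') (e s)) (DKf (combination u) (combination y') (e t)) p.
    rewrite (gfield_frame oe (vector_field_difference (vc z') (ve s))
        (vector_field_difference_deriv (vc u) (vc y') (ve t))).
    apply: eq_bigr => r _; rewrite !mxE; congr (_ * _).
    rewrite (cubic_deriv_sym34 p (vc u) (vc y') (ve r) (ve t)).
    by rewrite (gfield_difference_deriv p (vc u) (vc y') (ve t) (ve r)).
  rewrite !E1 !E2; have := gauss_deriv p (vc u) (vc w) (vc v) (ve s) (ve t); lra.
Qed.

Lemma cubic_deriv_zero X Y Z W : lambda - c < 0 -> VF X -> VF Y -> VF Z -> VF W ->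
  DC X Y Z W p = 0.
Proof.
move=> mu0; apply: (cubic_deriv_spanned ve _ (cubic_deriv_frame_zero mu0))
    => B U tB vU B0.
by rewrite (expand_frame oe tB vU) big1 // => i _; rewrite B0 mulr0.
Qed.

End Point.

(** If [K] is parallel, the curvature operators annihilate it; for a nonzero
    constant curvature and a traceless [K] this forces [K] to vanish. *)
Lemma parallel_zero : c != 0 ->
  (forall X Y Z W p, VF X -> VF Y -> VF Z -> VF W -> DC X Y Z W p = 0) ->
  forall X Y Z p, VF X -> VF Y -> VF Z -> C X Y Z p = 0.
Proof.
move=> c0 DC0 X Y Z p vX vY vZ.
have der V U S W q : VF V -> VF U -> VF S -> VF W ->
    V q (C U S W) = C (Dg V U) S W q + C U (Dg V S) W q + C U S (Dg V W) q.
  move=> vV vU vS vW; have := DC0 V U S W q vV vU vS vW; rewrite /DC; lra.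
have act U V S W T q : VF U -> VF V -> VF S -> VF W -> VF T ->
    U q (fderiv V (C S W T)) = 
    U q (C (Dg V S) W T) + U q (C S (Dg V W) T) + U q (C S W (Dg V T)).
  move=> vU vV vS vW vT.
  have vVS := VFg vV vS; have vVW := VFg vV vW; have vVT := VFg vV vT.
  have s1 := smooth_cubic_form vVS vW vT; have s2 := smooth_cubic_form vS vVW vT;
      have s3 := smooth_cubic_form vS vW vVT.
  rewrite -(tangent_act q vU s1 s2) -(tangent_act q vU (smooth_fun_add hM s1 s2) s3).
  congr (U q _); apply/funext => r; exact: der.
have curv U V S W T q : VF U -> VF V -> VF S -> VF W -> VF T ->
    C (curvature A Dg U V S) W T q + C S (curvature A Dg U V W) T q
    + C S W (curvature A Dg U V T) q = 0.
  move=> vU vV vS vW vT; have vUV := VFg vU vV; have vVU := VFg vV vU.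
  have vUS := VFg vU vS; have vVS := VFg vV vS; have vUW := VFg vU vW.
  have vVW := VFg vV vW; have vUT := VFg vU vT; have vVT := VFg vV vT.
  have tc B Z' : tensorial q B -> VF Z' -> B (curvature A Dg U V Z') =
      B (Dg U (Dg V Z')) - B (Dg V (Dg U Z')) - B (Dg (lie A U V) Z').
    move=> tB vZ'; rewrite /curvature.
    have v1 := VFg vU (VFg vV vZ'); have v2 := VFg vV (VFg vU vZ').
    by rewrite (tensorial_sub hM tB (vector_field_sub hM v1 v2)
        (VFg (vector_field_lie vU vV) vZ'))
      (tensorial_sub hM tB v1 v2).
  have := torsion_act q torg vU vV (smooth_cubic_form vS vW vT).
  have lieE f : Dg U V q f - Dg V U q f = lie A U V q f by rewrite -torg.
  rewrite lieE (der _ _ _ _ q (vector_field_lie vU vV) vS vW vT) !act // !der //.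
  rewrite (tc _ _ (@tensorial_cubic_form1 q _ _ vW vT) vS)
      (tc _ _ (@tensorial_cubic_form2 q _ _ vS vT) vW).
  rewrite (tc _ _ (@tensorial_cubic_form3 q _ _ vS vW) vT); lra.
have oe := frame_orthonormal p; have [ve oee] := oe; set e := frame A g p in oe ve oee.
have CRm U V S W T q : VF U -> VF V -> VF S -> VF W -> VF T ->
    C (curvature A Dg U V S) W T q = c * (G V S q * C W T U q - G U S q * C W T V q).
  move=> vU vV vS vW vT; have vR := vector_field_curvature vU vV vS.
  transitivity (Rm U V S (K W T) q).
    rewrite (cubic_form_sym12 _ vR vW) (cubic_form_sym23 vW vR vT)
        /C /Rm (gfield_sym hg) //; exact: vector_field_difference.
  rewrite (riemann_const q vU vV vS (vector_field_difference vW vT)).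
  by rewrite (gfield_sym hg q vU (vector_field_difference vW vT))
      (gfield_sym hg q vV (vector_field_difference vW vT)).
(* Contract [curv (e i) X Y Z (e i)] over [i]. *)
have main : \sum_i (c * (G X Y p * C Z (e i) (e i) p - G (e i) Y p * C Z (e i) X p)
   + c * (G X Z p * C Y (e i) (e i) p - G (e i) Z p * C Y (e i) X p)
   + c * (G X (e i) p * C Z Y (e i) p - G (e i) (e i) p * C Z Y X p)) = 0.
  apply: big1 => i _; have vi := ve i.
  have := curv (e i) X Y Z (e i) p vi vX vY vZ vi.
  rewrite (cubic_form_sym12 _ vY (vector_field_curvature vi vX vZ))
      (cubic_form_sym13 vY vZ (vector_field_curvature vi vX vi)).
  by rewrite !CRm.
have tr0 V : VF V -> \sum_i C V (e i) (e i) p = 0.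
  move=> vV; rewrite -[RHS](gfield_tchebychev0 p vV) (gfield_tchebychev_frame oe vV);
      apply: eq_bigr => i _.
  by rewrite (cubic_form_sym13 vV (ve i) (ve i)).
have ex V W : VF V -> VF W -> \sum_i G (e i) W p * C V (e i) X p = C V W X p.
  move=> vV vW; rewrite (expand_frame oe (@tensorial_cubic_form2 p _ _ vV vX) vW).
  by apply: eq_bigr => i _; rewrite (gfield_sym hg p (ve i) vW).
have ex3 : \sum_i G X (e i) p * C Z Y (e i) p = C Z Y X p.
  by rewrite -(expand_frame oe (@tensorial_cubic_form3 p _ _ vZ vY) vX).
have n3 : \sum_i G (e i) (e i) p * C Z Y X p = m%:R * C Z Y X p.
  rewrite -mulr_suml; congr (_ * _); under eq_bigr => i _ do rewrite oee eqxx.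
  by rewrite sumr_const card_ord.
have : c * (G X Y p * (\sum_i C Z (e i) (e i) p) - \sum_i G (e i) Y p * C Z (e i) X p)
   + c * (G X Z p * (\sum_i C Y (e i) (e i) p) - \sum_i G (e i) Z p * C Y (e i) X p)
   + c * (\sum_i G X (e i) p * C Z Y (e i) p - \sum_i G (e i) (e i) p * C Z Y X p) = 0.
  by rewrite -[RHS]main !mulr_sumr -!sumrB !mulr_sumr -!big_split.
rewrite !tr0 // !ex // ex3 n3 (cubic_form_sym12 _ vY vZ) (cubic_form_sym13 vZ vY vX)
    => H.
have : (- c * (m%:R + 1)) * C X Y Z p = 0 by lra.
move/eqP; rewrite !mulf_eq0 oppr_eq0 (negbTE c0) natr1 pnatr_eq0 /=.
by move=> /eqP.
Qed.

Lemma sqnorm_ge0 p : 0 <= difference_sqnorm A g D Dg p.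
Proof.
have [ve _] := frame_orthonormal p; rewrite /difference_sqnorm.
apply: sumr_ge0 => i _; apply: sumr_ge0 => j _; apply: gfield_ge0;
    exact: vector_field_difference.
Qed.

Lemma sqnorm_eq0 p : difference_sqnorm A g D Dg p = 0 ->
  forall X Y Z, VF X -> VF Y -> VF Z -> C X Y Z p = 0.
Proof.
have oe := frame_orthonormal p; have [ve oee] := oe.
rewrite /difference_sqnorm => H X Y Z vX vY vZ.
have cubic_op0 i j : K (frame A g p i) (frame A g p j) p = 0.
  have vK a b : VF (K (frame A g p a) (frame A g p b))
      by exact: vector_field_difference.
  apply: (@sum_G_eq0 (fun j => K (frame A g p i) (frame A g p j)) p (vK i)).
  apply/eqP; move/eqP: H; rewrite psumr_eq0.
    by move=> /allP /(_ i (mem_index_enum _)).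
  by move=> a _; apply: sum_G_ge0.
rewrite (expand_frame oe (@tensorial_cubic_form1 p _ _ vY vZ) vX) big1 // => i _.
rewrite (expand_frame oe (@tensorial_cubic_form2 p _ _ (ve i) vZ) vY)
    big1 ?mulr0 // => j _.
by rewrite /C /gfield cubic_op0 (metric0 hM hg) ?mulr0 //; exact: vector_field_tangent.
Qed.

Lemma traceless_rigid (p0 : M) : c != 0 -> lambda = c /\
  forall X Y Z p, VF X -> VF Y -> VF Z -> C X Y Z p = 0.
Proof.
move=> c0.
have sq p : (lambda - c) * (m%:R * (m%:R - 1)) = - difference_sqnorm A g D Dg p.
  by rewrite (sqnorm_identity p) gfield_tchebychev0 ?sub0r //;
      exact: vector_field_tchebychev.
have md : 0 < m%:R * (m%:R - 1) :> R.
  by rewrite mulr_gt0 ?dim_gt1 // ltr0n (leq_trans _ hm).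
have mu0 : ~ (lambda - c < 0).
  move=> mu0; have C0 := parallel_zero c0 (fun X Y Z W p vX vY vZ vW =>
    cubic_deriv_zero (frame_orthonormal p) mu0 vX vY vZ vW).
  have [ve _] := frame_orthonormal p0.
  have : difference_sqnorm A g D Dg p0 = 0.
    rewrite /difference_sqnorm big1 // => i _; rewrite big1 // => j _.
    rewrite -[LHS]/(C _ _ _ p0) C0 //; exact: vector_field_difference.
  have := sq p0 => + E0; rewrite E0 oppr0 => /eqP.
  by rewrite mulf_eq0 (gt_eqF md) orbF => /eqP H; rewrite H ltxx in mu0.
have lc : lambda - c = 0.
  apply/le_anti/andP; split; last by rewrite leNgt; apply/negP.
  by rewrite -(pmulr_lle0 _ md) (sq p0) oppr_le0 sqnorm_ge0.
split; first by apply/eqP; rewrite -subr_eq0 lc.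
move=> X Y Z p; apply: sqnorm_eq0; have := sq p; rewrite lc mul0r => /eqP.
by rewrite eq_sym oppr_eq0 => /eqP.
Qed.

Lemma connections_agree (p0 : M) : c != 0 ->
  (forall X Y, VF X -> VF Y -> D X Y = Dg X Y) /\ lambda = c.
Proof.
move=> c0; have [-> C0] := traceless_rigid p0 c0; split=> // X Y vX vY.
rewrite connection_split; apply/eqP; rewrite -subr_eq0 addrAC subrr add0r; apply/eqP.
apply/funext => p; apply: (field_eq_at hM hg gphi vE Egrad).
- exact: vector_field_difference.
- exact: (vector_field0 hM).
move=> Z vZ; rewrite [RHS](metric0 hM hg); last exact: vector_field_tangent.
exact: C0.
Qed.

End Traceless.

(** * Zero curvature *)
Section Flat.
Context (c0 : c = 0) (eps1 : forall a, eps a = 1).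
Context (Eon : forall a b q, G (E a) (E b) q = (a == b)%:R).

Lemma gfield_gradient_const a b : G (E a) (E b) = cst (a == b)%:R.
Proof. by apply/funext => q; exact: Eon. Qed.

(** Koszul: an orthonormal frame of gradients commutes, hence is parallel. *)
Lemma gradient_parallel X a : VF X -> Dg X (E a) = 0.
Proof.
move=> vX.
have sym i j k q : G (Dg (E i) (E j)) (E k) q = G (Dg (E j) (E i)) (E k) q.
  have act b d r : fderiv (E b) (phi d) r = (b == d)%:R.
    by rewrite -(Eon b d r) (gfield_sym hg r (vE b) (vE d))
        /fderiv -(Egrad d (vector_field_tangent r (vE b))).
  have GE V r : VF V -> G V (E k) r = V r (phi k).
    by move=> vV; rewrite (gfield_sym hg r vV (vE k)); apply: Egrad;
        exact: vector_field_tangent.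
  rewrite !GE; try exact: VFg.
  apply/eqP; rewrite -subr_eq0 -(torsion_act q torg (vE i) (vE j) (sphi k)).
  have -> : fderiv (E j) (phi k) = cst (j == k)%:R by apply/funext => r; exact: act.
  have -> : fderiv (E i) (phi k) = cst (i == k)%:R by apply/funext => r; exact: act.
  by rewrite !(tangent_cst hM _ (vector_field_tangent q (vE _))) subrr.
have skew i j k q : G (Dg (E i) (E j)) (E k) q = - G (Dg (E i) (E k)) (E j) q.
  have := metric_compatible q (vE i) (vE j) (vE k).
  rewrite gfield_gradient_const (tangent_cst hM _ (vector_field_tangent q (vE i))).
  rewrite (gfield_sym hg q (vE j) (VFg (vE i) (vE k))); lra.
have Z i j k q : G (Dg (E i) (E j)) (E k) q = 0.
  have := skew i j k q; have := sym i k j q; have := skew k i j q.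
  have := sym k j i q; have := skew j k i q; have := sym j i k q; lra.
apply/funext => q; apply: (field_eq_at hM hg gphi vE Egrad) => //.
- exact: VFg.
- exact: (vector_field0 hM).
move=> W vW; rewrite [RHS](metric0 hM hg); last exact: vector_field_tangent.
rewrite (expand_parseval (@tensorial_connection _ affg q _ _ (vE a) vW) vX)
    big1 // => i _.
rewrite (expand_parseval (tensorial_gfieldr hM hg q (VFg (vE i) (vE a))) vW)
    big1 ?mulr0 // => j _.
by rewrite Z mulr0.
Qed.

Let cc a b d : M -> R := C (E a) (E b) (E d).

Let scc a b d : SF (cc a b d). Proof. exact: smooth_cubic_form. Qed.

Lemma cubic_form_zero1 Y Z p : VF Y -> VF Z -> C 0 Y Z p = 0.
Proof. by move=> vY vZ;
    exact: (tensorial0 hM (@tensorial_cubic_form1 p _ _ vY vZ)). Qed.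

Lemma cubic_form_zero2 Y Z p : VF Y -> VF Z -> C Y 0 Z p = 0.
Proof. by move=> vY vZ;
    exact: (tensorial0 hM (@tensorial_cubic_form2 p _ _ vY vZ)). Qed.

Lemma cubic_form_zero3 Y Z p : VF Y -> VF Z -> C Y Z 0 p = 0.
Proof. by move=> vY vZ;
    exact: (tensorial0 hM (@tensorial_cubic_form3 p _ _ vY vZ)). Qed.

Lemma component_deriv X a b d p : VF X -> X p (cc a b d) = DC X (E a) (E b) (E d) p.
Proof.
by move=> vX; rewrite /DC !gradient_parallel // cubic_form_zero1 // cubic_form_zero2 //
    cubic_form_zero3 // !subr0.
Qed.

Lemma sqnorm_components p :
  difference_sqnorm A g D Dg p = \sum_a \sum_b \sum_d cc a b d p * cc a b d p.
Proof.
have oe := frame_orthonormal p; have [ve _] := oe; rewrite /difference_sqnorm.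
set e := frame A g p in oe ve *.
have t2 X : VF X -> bitensorial A p (fun Y Z => G (K X Y) (K X Z) p).
  move=> vX; split=> [Z vZ|Y vY];
      first exact: (@tensorial_cubic_form2 p _ _ vX (vector_field_difference vX vZ)).
  move=> h Z Z' sh vZ vZ'; have vZZ : VF (fscale h Z + Z')
      by exact: (vector_field_lin hM).
  have sw V : VF V -> G (K X Y) (K X V) p = C X V (K X Y) p.
    by move=> vV; rewrite (gfield_sym hg p (vector_field_difference vX vY)
        (vector_field_difference vX vV)).
  by rewrite !sw //; exact: (@tensorial_cubic_form2 p _ _ vX (vector_field_difference
      vX vY)).
transitivity (\sum_i \sum_b G (K (E b) (e i)) (K (E b) (e i)) p).
  apply: eq_bigr => i _; rewrite (trace_frame oe (t2 _ (ve i))).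
  by apply: eq_bigr => b _; rewrite eps1 mul1r (difference_sym (vE b) (ve i)).
rewrite exchange_big; apply: eq_bigr => a _ /=.
rewrite (trace_frame oe (t2 _ (vE a))); apply: eq_bigr => b _; rewrite eps1 mul1r.
rewrite (parseval p (vector_field_difference (vE a) (vE b))
    (vector_field_difference (vE a) (vE b))).
by apply: eq_bigr => d _; rewrite eps1 mul1r.
Qed.

Lemma deriv_sum3 (X : field) p (F : 'I_N -> 'I_N -> 'I_N -> M -> R) : VF X ->
  (forall a b d, SF (F a b d)) ->
  X p (fun q => \sum_a \sum_b \sum_d F a b d q) =
  \sum_a \sum_b \sum_d X p (F a b d).
Proof.
move=> vX sF; have tX := vector_field_tangent p vX.
rewrite (tangent_sum hM _ tX) => [|a _]; last first.
  by apply: (smooth_fun_sum hM) => b _; apply: (smooth_fun_sum hM) => d _; exact: sF.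
apply: eq_bigr => a _; rewrite (tangent_sum hM _ tX) => [|b _]; last first.
  by apply: (smooth_fun_sum hM) => d _; exact: sF.
by apply: eq_bigr => b _; rewrite (tangent_sum hM _ tX) // => d _; exact: sF.
Qed.

(** Up to the constant [lambda m (m - 1)] the squared norm of [K] is that of the
    Tchebychev field, which is parallel. *)
Lemma sqnorm_deriv X p : VF X ->
  \sum_a \sum_b \sum_d cc a b d p * X p (cc a b d) = 0.
Proof.
move=> vX; have tX := vector_field_tangent p vX; have vT := vector_field_tchebychev.
have E1 : (fun q => \sum_a \sum_b \sum_d cc a b d q * cc a b d q) =
    fun q => G Tv Tv q + (- (lambda * (m%:R * (m%:R - 1)))).
  apply/funext => q; rewrite -sqnorm_components; have := sqnorm_identity q.
  by rewrite c0 subr0; lra.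
have := congr1 (X p) E1; rewrite deriv_sum3 //; last first.
  by move=> a b d; exact: (smooth_fun_mul hM (scc a b d) (scc a b d)).
rewrite (tangent_act p vX (smooth_inner vT vT) (smooth_fun_cst hM _)).
rewrite (tangent_cst hM _ tX) (metric_compatible p vX vT vT).
rewrite (gfield_sym hg p vT (VFg vX vT)) -/(S X Tv p) tchebychev_parallel //.
have -> : \sum_a \sum_b \sum_d X p (fun q => cc a b d q * cc a b d q) =
    2 * \sum_a \sum_b \sum_d cc a b d p * X p (cc a b d).
  rewrite mulr_sumr; apply: eq_bigr => a _; rewrite mulr_sumr; apply: eq_bigr => b _.
  rewrite mulr_sumr; apply: eq_bigr => d _.
  by rewrite (tangent_actM p vX (scc a b d) (scc a b d)); ring.
by lra.
Qed.

(** Simons' argument: differentiating once more and summing over the frame, the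
    term containing the Laplacian of [K] vanishes by the Codazzi equation and the
    parallelism of the trace of [K]. *)
Lemma flat_parallel p X Y Z W : VF X -> VF Y -> VF Z -> VF W -> DC X Y Z W p = 0.
Proof.
move: X Y Z W; have sE r a b d : SF (fderiv (E r) (cc a b d))
    by exact: (smooth_fderiv hM).
have comm r a f : SF f -> E r p (fderiv (E a) f) = E a p (fderiv (E r) f).
  move=> sf; have := torsion_act p torg (vE r) (vE a) sf.
  by rewrite !gradient_parallel // subrr => /eqP; rewrite subr_eq0 => /eqP.
have second r : \sum_a \sum_b \sum_d
    (cc a b d p * E r p (fderiv (E r) (cc a b d))
     + E r p (cc a b d) * E r p (cc a b d)) = 0.
  have E1 : (fun q => \sum_a \sum_b \sum_d cc a b d q * fderiv (E r) (cc a b d) q)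
      = cst 0.
    by apply/funext => q; exact: sqnorm_deriv.
  have := congr1 (E r p) E1; rewrite (tangent_cst hM _ (vector_field_tangent p (vE r)))
      => H.
  rewrite -[RHS]H deriv_sum3 //; last first.
    by move=> a b d; exact: (smooth_fun_mul hM (scc a b d) (sE r a b d)).
  apply: eq_bigr => a _; apply: eq_bigr => b _; apply: eq_bigr => d _.
  by rewrite (tangent_actM p (vE r) (scc a b d) (sE r a b d)).
(* By the total symmetry of the derivative of [C] and the commutation of the frame,
   the Laplacian of a component is a derivative of [Dg T]. *)
have lap a b d : \sum_r E r p (fderiv (E r) (cc a b d)) = 0.
  transitivity (E a p (fun q => \sum_r fderiv (E r) (cc r b d) q)).
    rewrite (tangent_sum hM _ (vector_field_tangent p (vE a))); last by move=> r _;
        exact: sE.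
    apply: eq_bigr => r _; rewrite -comm //; congr (E r p _); apply/funext => q.
    by rewrite /fderiv !component_deriv // (codazzi_equation q).
  have -> : (fun q => \sum_r fderiv (E r) (cc r b d) q) = cst 0.
    apply/funext => q; rewrite -[RHS](tchebychev_parallel q c0 (vE b) (vE d))
        tchebychev_deriv_trace //.
    apply: eq_bigr => r _; rewrite eps1 mul1r /fderiv component_deriv //.
    by rewrite (cubic_deriv_sym23 q (vE r) (vE r)) // (codazzi_equation q (vE r)) .
  exact: (tangent_cst hM _ (vector_field_tangent p (vE a))).
have total : \sum_r \sum_a \sum_b \sum_d E r p (cc a b d) * E r p (cc a b d) = 0.
  have H : \sum_r \sum_a \sum_b \sum_d
    (cc a b d p * E r p (fderiv (E r) (cc a b d))
     + E r p (cc a b d) * E r p (cc a b d)) = 0 by apply: big1 => r _; exact: second.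
  rewrite -[RHS]H -[LHS]add0r.
  rewrite -[X in X + _](_ : \sum_r \sum_a \sum_b \sum_d
      cc a b d p * E r p (fderiv (E r) (cc a b d)) = 0).
    rewrite -big_split; apply: eq_bigr => r _; rewrite -big_split;
        apply: eq_bigr => a _.
    by rewrite -big_split; apply: eq_bigr => b _; rewrite -big_split.
  rewrite exchange_big big1 // => a _; rewrite exchange_big big1 // => b _.
  by rewrite exchange_big big1 // => d _; rewrite -mulr_sumr lap mulr0.
apply: (cubic_deriv_spanned vE) => [B X tB vX B0|r a b d].
  by rewrite (expand_parseval tB vX) big1 // => a _; rewrite B0 mulr0.
rewrite -component_deriv //.
have sqge r' a' b' d' : 0 <= E r' p (cc a' b' d') * E r' p (cc a' b' d').
  by rewrite -expr2 sqr_ge0.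
move/eqP: total; rewrite psumr_eq0; last first.
  by move=> r' _; do 3!apply: sumr_ge0 => ? _.
move=> /allP /(_ r (mem_index_enum _)) /=; rewrite psumr_eq0; last first.
  by move=> a' _; do 2!apply: sumr_ge0 => ? _.
move=> /allP /(_ a (mem_index_enum _)) /=; rewrite psumr_eq0; last first.
  by move=> b' _; apply: sumr_ge0 => ? _.
move=> /allP /(_ b (mem_index_enum _)) /=; rewrite psumr_eq0; last by [].
move=> /allP /(_ d (mem_index_enum _)) /=.
by rewrite mulf_eq0 orbb => /eqP.
Qed.

(** The coordinate fields of parallel coordinates are parallel, and so is [K]. *)
Lemma component_stationary k i j l X p : admissible A k -> cdom k = setT ->
  parallel_coordinates A Dg k -> VF X ->
  X p (difference_component A D Dg k l i j) = 0.
Proof.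
move=> ka kT par vX; have kq q : cdom k q by rewrite kT.
have vP b : VF (coord_field A k b) by exact: (vector_field_coord hM).
have parD Y b q : VF Y -> X q (fderiv Y (coord k b)) = Dg X Y q (coord k b).
  by move=> vY; have := par b X Y q vX vY; rewrite /cov_oneform => /eqP;
    rewrite subr_eq0 => /eqP.
have DP b : Dg X (coord_field A k b) = 0.
  apply/funext => q; apply: (tangent_ext hM ka (kq q)).
  - by apply: vector_field_tangent; exact: VFg.
  - exact: (tangent0 hM).
  move=> d; rewrite -parD // (_ : fderiv _ _ = cst ((delta_mx 0 b : 'rV[R]_m) 0 d)).
    exact: (tangent_cst hM _ (vector_field_tangent q vX)).
  by apply/funext => r; rewrite /fderiv /coord_field (tvec_coord hM).
have vK := vector_field_difference (vP i) (vP j).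
rewrite [LHS](parD _ l p vK).
have -> : Dg X (K (coord_field A k i) (coord_field A k j)) p = 0; last by [].
apply: (field_eq_at hM hg gphi vE Egrad (VFg vX vK) (vector_field0 hM)) => W vW.
rewrite [RHS](metric0 hM hg); last exact: vector_field_tangent.
rewrite gfield_deriv_difference // gfield_difference_deriv // flat_parallel // !DP.
by rewrite -/(C 0 _ W p) -/(C _ 0 W p) cubic_form_zero1 // cubic_form_zero2 // !addr0.
Qed.

End Flat.

End Structure.

(** * Functions with vanishing derivative *)
Section Constancy.
Context {R : realType} {m : nat} {M : topologicalType} (A : set (chart R m M)).
Context (hM : smooth_manifold A).
Implicit Types (p q : M) (h : M -> R).

Lemma locally_constant h p : smooth_fun A h ->
  (forall q v, tangent A q v -> v h = 0) -> \forall q \near p, h q = h p.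
Proof.
move=> sh h0; have [k kA kp] := atlas_chart hM p.
have ka := atlas_admissible hM kA; have [[okd oki kK cf ci] _] := ka.
have [U [oU Up Uk sU]] := smooth_at_in hM ka kp (sh p).
have /nbhs_ballP [r /= r0 Hr] : nbhs (cfun k p) U by exact: open_nbhs_nbhs.
have part i y : U y -> partial i (h \o cinv k) y = 0.
  move=> /Uk ky; have [kq kE] := chart_image_inv (proj1 ka) ky.
  have := h0 _ _ (tangent_tvec hM (delta_mx 0 i) ka kq).
  rewrite /tvec asboolT // kE (bigD1 i) //= !mxE !eqxx mul1r big1 ?addr0 // => j ji.
  by rewrite mxE (negbTE ji) andbF mul0r.
have H1 : nbhs p (cdom k) by exact: open_nbhs_nbhs.
have H2 : nbhs p (cfun k @^-1` ball (cfun k p) r).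
  by apply: cf => //; exact: nbhsx_ballx.
apply: filterS (filterI H1 H2) => q [kq /= qr].
have inU y : `|y - cfun k p| <= `|cfun k q - cfun k p| -> U y.
  move=> yq; apply: Hr; move: qr; rewrite -!ball_normE /= => qr.
  by rewrite distrC (le_lt_trans yq) // distrC.
have [|e [ec E]] := @coordinate_walk R m (h \o cinv k) (cfun k p) (cfun k q - cfun k p).
  by move=> y i /inU Uy; apply: diff_derivable; exact: (smooth_differentiable oU Uy sU).
move: E; rewrite big1 => [|i _]; last by rewrite part ?mulr0 //; exact: inU.
by rewrite [cfun k p + _]addrC subrK /= !kK // => /eqP; rewrite subr_eq0 => /eqP.
Qed.

Lemma constant_on_connected h : simply_connected R M -> smooth_fun A h ->
  (forall q v, tangent A q v -> v h = 0) -> forall p q, h p = h q.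
Proof.
move=> [path _] sh h0 p q; have [gam [cg g0 g1]] := path p q.
have conn : connected (gam @` `[0, 1]).
  by apply: connected_continuous_connected cg; exact: segment_connected.
have lc : forall x, \forall y \near x, h y = h x by move=> x; exact: locally_constant.
pose B := gam @` `[0, 1] `&` [set x | h x = h p].
have BE : B = gam @` `[0, 1].
  apply: conn.
  - exists p; split=> //=; exists 0; rewrite ?g0 //=.
    by rewrite in_itv /= lexx ler01.
  - exists [set x | h x = h p] => //.
    rewrite openE => x /= hx; apply: filterS (lc x) => y; by rewrite hx.
  - exists [set x | h x = h p] => //.
    rewrite -openC openE => x /= hx; apply: filterS (lc x) => y yx /= yp.
    by apply: hx; rewrite /= -yx.
have : B q.
  by rewrite BE; exists 1; rewrite ?g1 //= in_itv /= ler01 lexx.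
by case.
Qed.

End Constancy.

(** * The three models *)
Section Embedding.
Context {R : realType} {m : nat} {M : topologicalType} (A : set (chart R m M)).
Context (hM : smooth_manifold A) (g : @metric R M) (hg : riemannian_metric A g).

Lemma gradients_exist N (phi : 'I_N -> M -> R) : (forall a, smooth_fun A (phi a)) ->
  exists E : 'I_N -> @field R M, (forall a, vector_field A (E a)) /\
    (forall a p v, tangent A p v -> g p (E a p) v = v (phi a)).
Proof.
move=> sphi.
have [a|E HE] := @choice _ _ (fun a X => vector_field A X /\
    forall p v, tangent A p v -> g p (X p) v = v (phi a)).
  by have [X vX gX] := gradient_exists hM hg (sphi a); exists X.
by exists E; split=> a; case: (HE a).
Qed.

Lemma sphere_compact (c : R) : 0 < c ->
  isometric_to A g (euclidean_form m.+1) (sphere m c) -> compact [set: M].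
Proof.
move=> c0 [phi [_ phiS [psi [phiK cpsi]] _]].
have -> : [set: M] = psi @` sphere m c.
  apply/seteqP; split=> // x _; exists (phi x); last exact: phiK.
  by rewrite -phiS; exists x.
apply: continuous_compact cpsi _.
have -> : sphere m c = [set x : 'rV[R]_m.+1 | dot x x = c^-1].
  have sc : 0 < Num.sqrt c by rewrite sqrtr_gt0.
  apply/seteqP; split=> x; rewrite /sphere /= dotE -/(euclidean_form _ x x).
    have e0 : 0 <= euclidean_form m.+1 x x.
      by apply: sumr_ge0 => i _; rewrite -expr2 sqr_ge0.
    by move=> H; rewrite -[LHS](sqr_sqrtr e0) H exprVn sqr_sqrtr // ltW.
  by move=> ->; rewrite sqrtrV // ltW.
exact: compact_sphere.
Qed.

End Embedding.

Theorem theorem4p7 (R : realType) (m : nat) (M : topologicalType)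
    (A : set (chart R m M)) (g : @metric R M) (D Dg : @connection R M)
    (lambda c : R)
    (hm : (2 <= m)%N) (hM : smooth_manifold A) (hO : orientable A)
    (hstat : statistical_manifold A g D) (hDg : levi_civita A g Dg)
    (hlambda : constant_curvature A g D lambda)
    (hsemi : semi_equiaffine A g D Dg)
    (hcomplete : complete_metric A g) (hsimply : simply_connected R M)
    (hc : constant_sectional_curvature A g Dg c) :
  [/\ (0 < c -> isometric_to A g (euclidean_form m.+1) (sphere m c) ->
         (forall X Y, vector_field A X -> vector_field A Y -> D X Y = Dg X Y) /\
         lambda = c),
      (c = 0 -> isometric_to A g (euclidean_form m) setT ->
         let T := tchebychev A g D Dg in
         (forall p, lambda * (m%:R * (m%:R - 1)) =
            gfield g T T p - difference_sqnorm A g D Dg p) /\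
         (forall k, global_coordinates A k -> parallel_coordinates A Dg k ->
            forall l i j : 'I_m, exists C : R,
              forall p, difference_component A D Dg k l i j p = C)) &
      (c < 0 -> isometric_to A g (lorentz_form m) (hyperbolic_space m c) ->
         (forall X Y, vector_field A X -> vector_field A Y -> D X Y = Dg X Y) /\
         lambda = c)].
Proof.
have hg : riemannian_metric A g by case: hstat.
split=> [c0 iso|c0 iso|c0 iso].
- have cM := sphere_compact c0 iso; case: iso => phi [sphi phiS _ gphi].
  have gphi' p v w : tangent A p v -> tangent A p w -> g p v w =
      \sum_(a < m.+1) 1 * (v (fun q => phi q 0 a) * w (fun q => phi q 0 a)).
    by move=> tv tw; rewrite gphi //; apply: eq_bigr => a _; rewrite !mxE mul1r.
  have [E [vE Egrad]] := gradients_exist hM hg sphi.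
  have [p0 _] : exists p0 : M, True.
    have : range phi ((Num.sqrt c)^-1 *: delta_mx 0 0).
      rewrite phiS /sphere /= /euclidean_form (bigD1 ord0) //= big1 ?addr0 => [|a a0].
        rewrite !mxE !eqxx mulr1 -expr2 sqrtr_sqr ger0_norm // invr_ge0.
      by rewrite !mxE eqxx (negbTE a0) mulr0 mul0r.
    by case=> p0 _ _; exists p0.
  have c1 : c != 0 by rewrite gt_eqF.
  apply: (connections_agree hM hg hstat hDg sphi gphi' vE Egrad hlambda hc hm _ p0 c1).
  move=> p; exact: (tchebychev_vanish_pos hM hg hstat hDg sphi gphi' vE Egrad hlambda
      hc hsemi hm p cM c0).
- case: iso => phi [sphi _ _ gphi].
  have gphi' p v w : tangent A p v -> tangent A p w -> g p v w =
      \sum_(a < m) 1 * (v (fun q => phi q 0 a) * w (fun q => phi q 0 a)).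
    by move=> tv tw; rewrite gphi //; apply: eq_bigr => a _; rewrite !mxE mul1r.
  have [E [vE Egrad]] := gradients_exist hM hg sphi.
  split=> [p|k [kc kT kA] kpar l i j].
    rewrite (tchebychevE hM hg hstat hDg sphi gphi' vE Egrad).
    rewrite -(sqnorm_identity hM hg hstat hDg sphi gphi' vE Egrad hlambda hc p).
    by rewrite c0 subr0.
  (* There are as many gradients as dimensions, so the Parseval identity makes the
     square matrix [Q] orthogonal. *)
  have Eon a b q : gfield g (E a) (E b) q = (a == b)%:R.
    have [e [ve oe]] := orthonormal_exists hM hg gphi' vE Egrad q.
    pose Q := \matrix_(i < m, a < m) gfield g (e i) (E a) q.
    have QQ : Q *m Q^T = 1%:M.
      apply/matrixP => s t; rewrite !mxE -oe.
      rewrite (parseval hM hg sphi gphi' vE Egrad q (ve s) (ve t)).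
      by apply: eq_bigr => r _; rewrite !mxE mul1r.
    have /matrixP/(_ a b) : Q^T *m Q = 1%:M by exact: mulmx1C.
    rewrite !mxE => <-.
    have oe' : orthonormal_at A g q e by split.
    rewrite (gfield_expand hM hg sphi gphi' vE Egrad oe' (vE a) (vE b)).
    apply: eq_bigr => r _; rewrite !mxE; congr (_ * _); exact: (gfield_sym hg).
  have ka : admissible A k by split.
  case: (pselect (exists p0 : M, True)) => [[p0 _]|noM]; last first.
    (* On the empty manifold any constant will do. *)
    by exists 0 => p; exfalso; apply: noM; exists p.
  exists (difference_component A D Dg k l i j p0) => p.
  apply: (constant_on_connected hM hsimply) => [|q v tv].
    apply: (smooth_fderiv hM); last first.
      by move=> q; apply: (smooth_at_coord hM) => //; rewrite kT.
    by apply: (vector_field_difference hM hstat hDg); apply: (vector_field_coord hM).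
  have [X vX <-] := field_through hM hg gphi' vE Egrad tv.
  exact: (component_stationary hM hg hstat hDg sphi gphi' vE Egrad hlambda hc hsemi
    c0 (fun=> erefl) Eon i j l q ka kT kpar vX).
- case: iso => phi [sphi phiS _ gphi].
  pose eps (a : 'I_m.+1) : R := if a == ord0 then -1 else 1.
  have gphi' p v w : tangent A p v -> tangent A p w -> g p v w =
      \sum_(a < m.+1) eps a * (v (fun q => phi q 0 a) * w (fun q => phi q 0 a)).
    move=> tv tw; rewrite gphi // /lorentz_form big_ord_recl /eps eqxx mulN1r !mxE.
    by congr (_ + _); apply: eq_bigr => a _; rewrite !mxE mul1r.
  have [E [vE Egrad]] := gradients_exist hM hg sphi.
  have [p0 _] : exists p0 : M, True.
    have s0 : 0 < Num.sqrt (- c^-1) by rewrite sqrtr_gt0 oppr_gt0 invr_lt0.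
    have : range phi (Num.sqrt (- c^-1) *: delta_mx 0 0).
      rewrite phiS /hyperbolic_space /= /lorentz_form; split;
          last by rewrite !mxE !eqxx mulr1.
      rewrite big1 ?addr0 => [|a _]; last by rewrite !mxE mulr0 mul0r.
      rewrite !mxE !eqxx mulr1 -expr2 sqr_sqrtr ?opprK //.
      by rewrite oppr_ge0 invr_le0 ltW.
    by case=> p0 _ _; exists p0.
  have c1 : c != 0 by rewrite lt_eqF.
  apply: (connections_agree hM hg hstat hDg sphi gphi' vE Egrad hlambda hc hm _ p0 c1).
  move=> p; exact: (tchebychev_vanish_neg hM hg hstat hDg sphi gphi' vE Egrad hlambda
      hc hsemi hm p c0).
Qed.
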